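(* Let $A = (a_{ij})$ be a random $n\times n$ matrix with $a_{ij} = 0$ for $i \ge j$ and with the entries $a_{ij}$, $1 \le i < j \le n$, independent standard normal $N(0,1)$ random variables (a Sherrington–Kirkpatrick instance). Then for all sufficiently large $n$, \[ \Pr_A\big[T_A \ge 2^{0.451 n}\big] \le 0.01. \]
   Context: For $x \in \{\pm1\}^n$ let $H(x) = \sum_{1\le i<j\le n} a_{ij}x_ix_j = x^T A x$ and $E_{\min}(H) = \min_{x\in\{\pm1\}^n} H(x)$. For $x \in \{\pm1\}^\ell$, $0 \le \ell \le n$, \[ \mathrm{Bound}_A(x) := \sum_{1\le i<j\le \ell} a_{ij}x_ix_j \;-\; \sum_{j=\ell+1}^n \Big|\sum_{i=1}^\ell a_{ij}x_i\Big| \;+\; \min_{z\in\{\pm1\}^{n-\ell}} \sum_{\ell+1\le i<j\le n} a_{ij}z_iz_j, \] where empty sums are $0$. The branch-and-bound tree is the complete binary tree whose nodes at depth $\ell$ are the strings $x \in \{\pm1\}^\ell$ ($0\le \ell\le n$), with node cost $\mathrm{Bound}_A(x)$. $T_A$ denotes the number of nodes of this tree truncated at the optimal cost, i.e. $T_A$ is (at most) the number of strings $x \in \bigcup_{\ell=0}^n \{\pm1\}^\ell$ with $\mathrm{Bound}_A(x) \le E_{\min}(H)$. *)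

(* Defs.v *)
From HB Require Import structures.
From mathcomp Require Import all_boot all_order all_algebra.
From mathcomp Require Import all_classical all_reals all_analysis.
Set Implicit Arguments. Unset Strict Implicit. Unset Printing Implicit Defensive.
Import Order.TTheory GRing.Theory Num.Theory.
Local Open Scope classical_set_scope.
Local Open Scope ring_scope.

Section SK.
Variable R : realType.

Definition spin (b : bool) : R := if b then 1 else -1.

Definition finmin (T : finType) (t0 : T) (F : T -> R) : R :=
  \big[Num.min/F t0]_(t : T) F t.

(* The coupling matrix is given 0-based: a i j for 0 <= i < j < n.
   A string x in {±1}^l is an {ffun 'I_l -> bool}; xv x i is its i-th
   coordinate as a real number (0 outside the range, never used). *)
Definition xv (l : nat) (x : {ffun 'I_l -> bool}) (i : nat) : R :=
  oapp (fun k : 'I_l => spin (x k)) 0 (insub i).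

Definition Ham (n : nat) (a : nat -> nat -> R) (x : {ffun 'I_n -> bool}) : R :=
  \sum_(i < n) \sum_(j < n | (i < j)%N) a i j * xv x i * xv x j.

Definition Emin (n : nat) (a : nat -> nat -> R) : R :=
  finmin [ffun => true] (@Ham n a).

Definition tail_min (n l : nat) (a : nat -> nat -> R) : R :=
  finmin [ffun => true] (fun z : {ffun 'I_(n - l) -> bool} =>
    \sum_(i < n - l) \sum_(j < n - l | (i < j)%N)
       a (l + i)%N (l + j)%N * spin (z i) * spin (z j)).

Definition Bound (n : nat) (a : nat -> nat -> R) (l : nat)
    (x : {ffun 'I_l -> bool}) : R :=
  \sum_(i < l) \sum_(j < l | (i < j)%N) a i j * xv x i * xv x j
  - \sum_(l <= j < n) `| \sum_(i < l) a i j * xv x i |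
  + tail_min n l a.

Definition TA (n : nat) (a : nat -> nat -> R) : nat :=
  \sum_(l < n.+1) #|[set x : {ffun 'I_l -> bool} | (Bound n a x <= Emin n a)%R]|.

End SK.

Definition mutually_independent d (T : measurableType d) (R : realType)
    (P : probability T R) (I : finType) (S : {set I}) (X : I -> T -> R) : Prop :=
  forall (J : {set I}) (B : I -> set R),
    J \subset S -> (forall i, measurable (B i)) ->
    P (\big[setI/setT]_(i in J) (X i @^-1` B i)) =
    (\prod_(i in J) P (X i @^-1` B i))%E.

Definition SKmat (T : Type) (R : realType) (n : nat)
    (X : 'I_n -> 'I_n -> T -> R) (w : T) : nat -> nat -> R :=
  fun i j => match insub i, insub j with
             | Some i', Some j' => if (i < j)%N then X i' j' w else 0
             | _, _ => 0
             end.

(* Main.v *)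
Require Import Defs.
From HB Require Import structures.
From mathcomp Require Import all_boot all_order all_algebra.
From mathcomp Require Import all_classical all_reals all_analysis.
From mathcomp Require Import perm measurable_realfun ring lra.
Set Implicit Arguments. Unset Strict Implicit. Unset Printing Implicit Defensive.
Import Order.TTheory GRing.Theory Num.Theory.
Import numFieldNormedType.Exports.
Local Open Scope classical_set_scope.
Local Open Scope ring_scope.
From mathcomp Require Import measurable_realfun ring lra.

(** A node survives when its bound is at most the ground state energy, so the count is controlled by
    a first moment over nodes, once the two random minima in the condition are replaced by
    deterministic levels.

    Ground state. With high probability [Emin] is at most -0.72 n^(3/2) ([Emin_whp]), by a
    constructive argument. Give every site K independent Gaussian layers and let the spin be the
    sign of their sum. For a unit vector v, the part of an i.i.d. Gaussian matrix G revealed by its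
    symmetric action on v can be replaced by a fresh Gaussian vector without changing the law of G
    ([law_resample], [law_exposure]). Taking for v the normalised first-order increment, due to one
    layer, of the conditional mean of the spins, and for the fresh vector the next layer, one gets a
    matrix with the right law that is correlated with the spins by design ([law_expose]). The energy
    of the spins in it is a residual form of order n minus a sum of explicit gains ([quad_expose],
    [noise_whp]). The law of large numbers ([typical]) bounds the gain at layer uK below by about
    n^(3/2) (2/pi) (1/K) (1-u^2)^(-1/4). Their sum is a Riemann sum, and a Taylor polynomial below
    the integrand already yields 0.721 ([exists_energy]).

    Suffixes. A union bound over 2^m strings and the Gaussian tail show that the minimum over m free
    spins is at least -(5/6) m^(3/2), up to a small multiple of n^(3/2), simultaneously for all
    suffixes, because (5/6)^2 exceeds ln 2 ([tail_whp]).

    Counting. On both events a survivor of depth l has [Vp], its bound without the suffix minimum,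
    at most -[tau]. Depths up to 0.4505 n are counted by 2^l ([low_sum]). At greater depths the
    indicator is majorised by exp(-lam (Vp + tau)) with lam = 0.71/sqrt n. For fixed x the prefix
    energy is Gaussian and independent of the n-l absolute local fields, which are independent
    multiples of |N(0,1)|, so the exponential moment is explicit ([mean_level]). A numerical
    inequality in l/n ([rate_le]) makes the expected count exponentially smaller than 2^(0.451 n)
    ([mean_Wlev]). Markov's inequality and the failure probabilities of the two events add up to
    1/100 ([TA_whp]). *)

(** * Standard Gaussian vectors over a finite index type *)

Definition boxes (R : realType) (I : finType) : set (set (I -> R)) :=
  [set A | exists B : I -> set R, (forall i, measurable (B i)) /\
     A = [set g | forall i, B i (g i)]].

(** The function space carries the product sigma-algebra, generated by boxes. Using functions on any
    finite type makes restriction, pairing and relabelling of coordinates plain precomposition. *)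
Definition vec (R : realType) (I : finType) := g_sigma_algebraType (@boxes R I).

Definition box (R : realType) (I : finType) (B : I -> set R) : set (vec R I) :=
  [set g : vec R I | forall i, B i (g i)].

Definition N01 (R : realType) : probability (measurableTypeR R) R := normal_prob 0 1.

Definition law d d' (T : measurableType d) (T' : measurableType d')
    (R : realType) (P : probability T R) (X : T -> T') (Q : probability T' R) :=
  measurable_fun setT X /\ forall A, measurable A -> P (X @^-1` A) = Q A.

Section law.
Context {R : realType}.
Local Open Scope ereal_scope.

Lemma law_ge0 d d' (T : measurableType d) (T' : measurableType d')
    (P : probability T R) (X : T -> T') (Q : probability T' R) (f : T' -> \bar R) :
  law P X Q -> measurable_fun [set: T'] f -> (forall y, 0 <= f y) ->
  \int[Q]_y f y = \int[P]_x f (X x).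
Proof.
move=> [mX PQ] mf f0.
transitivity (\int[pushforward P X]_y f y); last first.
  by rewrite ge0_integral_pushforward.
rewrite /pushforward; apply: (@eq_measure_integral _ _ _ _ (distribution P (HB.pack X (isMeasurableFun.Build _ _ _ _ _ mX)))).
by move=> A mA _; exact/esym/PQ.
Qed.

Lemma law_integrable d d' (T : measurableType d) (T' : measurableType d')
    (P : probability T R) (X : T -> T') (Q : probability T' R) (f : T' -> \bar R) :
  law P X Q -> measurable_fun [set: T'] f ->
  P.-integrable setT (fun x => f (X x)) <-> Q.-integrable setT f.
Proof.
move=> lX mf; have [mX _] := lX.
split=> /integrableP[_ fi]; apply/integrableP; split => //.
- by rewrite (law_ge0 lX)//; exact: measurableT_comp.
- exact: measurableT_comp.
- by rewrite -(law_ge0 lX (f := fun y => `|f y|))//; exact: measurableT_comp.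
Qed.

Lemma law_integral d d' (T : measurableType d) (T' : measurableType d')
    (P : probability T R) (X : T -> T') (Q : probability T' R) (f : T' -> \bar R) :
  law P X Q -> measurable_fun [set: T'] f -> Q.-integrable setT f ->
  \int[Q]_y f y = \int[P]_x f (X x).
Proof.
move=> lX mf fi; rewrite [LHS]integralE [RHS]integralE; congr (_ - _).
- rewrite (law_ge0 lX (measurable_funepos mf) (funepos_ge0 f)).
  by apply: eq_integral => x _; rewrite !funeposE.
- rewrite (law_ge0 lX (measurable_funeneg mf) (funeneg_ge0 f)).
  by apply: eq_integral => x _; rewrite !funenegE.
Qed.

Lemma law_comp d d' d'' (T : measurableType d) (T' : measurableType d')
    (T'' : measurableType d'') (P : probability T R) (X : T -> T')
    (Q : probability T' R) (Y : T' -> T'') (Q' : probability T'' R) :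
  law P X Q -> law Q Y Q' -> law P (Y \o X) Q'.
Proof.
move=> [mX PX] [mY QY]; split; first exact: measurableT_comp.
move=> A mA; rewrite -QY// -PX// -[Y @^-1` A]setTI; exact: mY.
Qed.

End law.

Section vec.
Variable R : realType.

Lemma measurable_box (I : finType) (B : I -> set R) :
  (forall i, measurable (B i)) -> measurable (box B).
Proof. by move=> mB; apply: sub_sigma_algebra; exists B. Qed.

Lemma measurable_coord (I : finType) (i : I) :
  measurable_fun setT (fun g : vec R I => g i : R).
Proof.
move=> _ Y mY; rewrite setTI.
rewrite (_ : _ @^-1` Y = box (fun j => if j == i then Y else setT)).
  by apply: measurable_box => j; case: ifP.
apply/seteqP; split=> [g /= Yg j|g /= /(_ i)]; last by rewrite eqxx.
by case: eqP => [->|].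
Qed.

Lemma bigsetI_all (T : Type) (I : finType) (P : pred I) (F : I -> set T) t :
  (\big[setI/setT]_(i | P i) F i) t <-> forall i, P i -> F i t.
Proof.
rewrite -bigcap_seq_cond; split=> /= h i.
  by move=> Pi; apply: h => /=; rewrite mem_index_enum.
by move=> /andP[_]; exact: h.
Qed.

Lemma measurable_vec d (T : measurableType d) (I : finType) (f : T -> vec R I) :
  (forall i, measurable_fun setT (fun t => f t i : R)) -> measurable_fun setT f.
Proof.
move=> mf; apply: (@measurability _ _ T (vec R I) setT f (@boxes R I)) => //.
move=> _ [_ [B [mB ->]] <-].
rewrite setTI (_ : _ @^-1` _ = \big[setI/setT]_(i : I) ((fun t => f t i) @^-1` B i)).
  apply: bigsetI_measurable => i _; rewrite -[X in measurable X]setTI.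
  exact: mf.
apply/seteqP; split=> t /=.
  by move=> h; apply/bigsetI_all => i _; exact: h.
by move=> /bigsetI_all h i; exact: h.
Qed.

(** Boxes are closed under intersection, so they determine a probability measure on the
    sigma-algebra they generate. *)
Lemma vec_measure_unique (I : finType) (m1 m2 : probability (vec R I) R) :
  (forall B : I -> set R, (forall i, measurable (B i)) -> m1 (box B) = m2 (box B)) ->
  forall A, measurable A -> m1 A = m2 A.
Proof.
move=> h A mA; apply: (@measure_unique _ R (vec R I) (@boxes R I) (fun=> setT)) => //.
- move=> _ _ [B [mB ->]] [C [mC ->]]; exists (fun i => B i `&` C i); split.
    by move=> i; exact: measurableI.
  apply/seteqP; split=> g /=; first by move=> [? ?] i; split.
  by move=> h'; split=> i; have [] := h' i.
- move=> _; exists (fun=> setT); split=> //.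
  by apply/seteqP; split.
- by apply/seteqP; split=> // g _; exists 0%N.
- by move=> _ [B [mB ->]]; exact: h.
- by move=> _; rewrite (le_lt_trans (probability_le1 _ _)) ?ltry.
Qed.

Local Open Scope ereal_scope.

Definition vcons n (p : measurableTypeR R * vec R 'I_n) : vec R 'I_n.+1 :=
  fun i => if unlift ord0 i is Some j then p.2 j else p.1.

Lemma measurable_vcons n : measurable_fun setT (@vcons n).
Proof.
apply: measurable_vec => i; rewrite /vcons.
case: (unlift ord0 i) => [j|]; last exact: measurable_fst.
by apply: (measurableT_comp (measurable_coord j)); exact: measurable_snd.
Qed.

(** The n-fold product is built by iterating the binary product measure and transporting it along
    [vcons]. *)
Lemma gam_ord_exists n : exists g : probability (vec R 'I_n) R,
  forall B : 'I_n -> set R, (forall i, measurable (B i)) ->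
    g (box B) = \prod_i N01 R (B i).
Proof.
elim: n => [|n [g gE]].
  exists (\d_((fun=> 0%R) : vec R 'I_0)) => B mB.
  have -> : box B = setT by apply/seteqP; split=> // h _ [].
  by rewrite big_ord0 probability_setT.
have mc := @measurable_vcons n.
exists (distribution ((N01 R \x g) : probability _ R)
   (HB.pack (@vcons n) (isMeasurableFun.Build _ _ _ _ _ mc))) => B mB.
rewrite /distribution /pushforward/=.
have -> : @vcons n @^-1` box B = B ord0 `*` box (fun i : 'I_n => B (lift ord0 i)); last first.
  rewrite product_measure1E//; last exact: measurable_box.
    by rewrite big_ord_recl; congr (_ * _); exact: gE.
  exact: mB.
apply/seteqP; split=> [[t h] /= H|[t h] [/= H0 H] i].
  split; first by have := H ord0; rewrite /vcons unlift_none.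
  by move=> i; have := H (lift ord0 i); rewrite /vcons liftK.
by rewrite /vcons; case: unliftP => [j ->|->].
Qed.

Lemma gam_exists (I : finType) : exists g : probability (vec R I) R,
  forall B : I -> set R, (forall i, measurable (B i)) ->
    g (box B) = \prod_i N01 R (B i).
Proof.
have [g gE] := gam_ord_exists #|I|.
pose f (h : vec R 'I_#|I|) : vec R I := fun i => h (enum_rank i).
have mf : measurable_fun setT f by apply: measurable_vec => i; exact: measurable_coord.
exists (distribution g (HB.pack f (isMeasurableFun.Build _ _ _ _ _ mf))) => B mB.
rewrite /distribution /pushforward/=.
have fE : f @^-1` box B = box (fun i => B (enum_val i)).
  apply/seteqP; split=> h /= H i; first by have := H (enum_val i); rewrite /f enum_valK.
  by have := H (enum_rank i); rewrite enum_rankK.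
transitivity (g (box (fun i => B (enum_val i)))); first by rewrite -fE.
rewrite gE// [RHS](reindex (@enum_val I predT))//; exact: onW_bij (enum_val_bij I).
Qed.

(** Choice turns the existence statement into an actual measure; afterwards it is accessed through
    its values on boxes. *)
Lemma gam_sig (I : finType) : {g : probability (vec R I) R |
  forall B : I -> set R, (forall i, measurable (B i)) ->
    g (box B) = \prod_i N01 R (B i)}.
Proof. exact/cid/gam_exists. Qed.

Definition gam (I : finType) : probability (vec R I) R := sval (gam_sig I).

Lemma gam_box (I : finType) (B : I -> set R) : (forall i, measurable (B i)) ->
  gam I (box B) = \prod_i N01 R (B i).
Proof. exact: (svalP (gam_sig I)). Qed.

Lemma law_gam d (T : measurableType d) (P : probability T R) (I : finType)
    (X : T -> vec R I) :
  (forall i, measurable_fun setT (fun t => X t i : R)) ->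
  (forall B : I -> set R, (forall i, measurable (B i)) ->
    P [set t | forall i, B i (X t i)] = \prod_i N01 R (B i)) ->
  law P X (gam I).
Proof.
move=> mXi h; have mX : measurable_fun setT X by exact: measurable_vec.
split=> //.
apply: (@vec_measure_unique _ (distribution P (HB.pack X (isMeasurableFun.Build _ _ _ _ _ mX)))).
by move=> B mB; rewrite gam_box// -h.
Qed.

End vec.

From mathcomp Require Import measurable_realfun ring lra.

(** * Densities and the one-dimensional Gaussian shift *)

Section density.
Context d (T : measurableType d) {R : realType}.
Variables (mu nu : {measure set T -> \bar R}) (h : T -> R).
Hypothesis mh : measurable_fun setT h.
Hypothesis h0 : forall x, 0 <= h x.
Local Open Scope ereal_scope.
Hypothesis nuE : forall A, measurable A -> nu A = \int[mu]_(x in A) (h x)%:E.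

Import HBNNSimple.

(** True for indicators by hypothesis, then for simple functions by linearity, then in general by
    monotone convergence. *)
Lemma ge0_integral_density (f : T -> \bar R) : measurable_fun setT f ->
  (forall x, 0 <= f x) -> \int[nu]_x f x = \int[mu]_x (f x * (h x)%:E).
Proof.
move=> mf f0.
pose f_ := nnsfun_approx measurableT mf.
have mh' : measurable_fun setT (EFin \o h) by exact/measurable_EFinP.
transitivity (limn (fun n => \int[nu]_x (f_ n x)%:E)).
  rewrite -monotone_convergence//.
  - apply: eq_integral => y _; apply/esym/cvg_lim => //.
    by apply: cvg_nnsfun_approx.
  - by move=> n; exact/measurable_EFinP/measurable_funP.
  - by move=> n y _; rewrite lee_fin.
  - by move=> y _ m n mn; rewrite lee_fin; exact/lefP/nd_nnsfun_approx.
transitivity (limn (fun n => \int[mu]_x ((f_ n x)%:E * (h x)%:E))); last first.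
  rewrite -monotone_convergence//.
  - apply: eq_integral => y _; apply/cvg_lim => //.
    by apply: cvgeMr => //; exact: cvg_nnsfun_approx.
  - by move=> n; apply: emeasurable_funM => //; exact/measurable_EFinP/measurable_funP.
  - by move=> n y _; rewrite -EFinM lee_fin mulr_ge0.
  - move=> y _ m n mn; rewrite -!EFinM lee_fin ler_wpM2r//.
    exact/lefP/nd_nnsfun_approx.
congr (limn _); apply/funext => n.
rewrite integralT_nnsfun sintegralE.
under [RHS]eq_integral.
  move=> x _; rewrite fimfunE -fsumEFin// ge0_mule_fsuml; last first.
    by move=> r; rewrite EFinM nnfun_muleindic_ge0.
  over.
rewrite ge0_integral_fsum//; last 2 first.
- by move=> r; apply: emeasurable_funM => //; exact/measurable_EFinP/measurable_funM.
- by move=> r x _; apply: mule_ge0; [rewrite EFinM nnfun_muleindic_ge0|rewrite lee_fin].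
apply: eq_fsbigr => r /[!inE] -[y _ yr].
have r0 : (0 <= r)%R by rewrite -yr.
rewrite nuE// [in RHS](eq_integral (fun x => r%:E * ((h x)%:E * (\1_(f_ n @^-1` [set r]) x)%:E))); last first.
  by move=> x _; rewrite EFinM -muleA [X in _ * X]muleC.
rewrite ge0_integralZl//; last 2 first.
- by apply: emeasurable_funM => //; exact/measurable_EFinP.
- by move=> x _; rewrite -EFinM lee_fin mulr_ge0.
congr (_ * _); rewrite integral_mkcond; apply: eq_integral => x _.
by rewrite -EFinM indicE/= patchE; case: ifPn => _; rewrite ?mulr1 ?mulr0.
Qed.
End density.

Section one_dim.
Context {R : realType}.
Local Open Scope ereal_scope.
Local Notation mu := (@lebesgue_measure R).

Definition shiftR (c x : measurableTypeR R) : measurableTypeR R := (x + c)%R.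

Lemma measurable_shiftR c : measurable_fun setT (shiftR c).
Proof. by apply: measurable_funD => //; exact: measurable_cst. Qed.

Lemma lebesgue_measure_shift c (A : set (measurableTypeR R)) : measurable A ->
  mu (shiftR c @^-1` A) = mu A.
Proof.
move=> mA; apply/esym.
apply: (@lebesgue_measure_unique R (pushforward mu (HB.pack (shiftR c) (isMeasurableFun.Build _ _ _ _ _ (measurable_shiftR c)) : {mfun _ >-> _})))  => //.
move=> _ [[a b] _ <-]; rewrite /pushforward/=.
rewrite [X in _ = mu X](_ : _ = `](a - c)%R, (b - c)%R]%classic); last first.
  by apply/seteqP; split=> x /=; rewrite !in_itv /= /shiftR ltrBlDr lerBrDr.
rewrite !lebesgue_measure_itv /= !lte_fin ltrBlDr subrK.
by case: ifP => // _; rewrite -!EFinD; congr EFin; ring.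
Qed.

Lemma ge0_integral_shift c (f : measurableTypeR R -> \bar R) : measurable_fun setT f ->
  (forall x, 0 <= f x) -> \int[mu]_x f (x + c)%R = \int[mu]_x f x.
Proof.
move=> mf f0; have := @ge0_integral_pushforward _ _ _ _ _ _ (measurable_shiftR c) mu setT f measurableT mf (fun y _ => f0 y).
rewrite preimage_setT => <-; apply: eq_measure_integral.
  exact: measurable_shiftR.
by move=> mX A mA _; exact: (lebesgue_measure_shift c).
Qed.

Definition phi (x : R) : R := normal_pdf 0 1 x.

Lemma phiE x : phi x = ((Num.sqrt (2 * pi))^-1 * expR (- (x ^+ 2 / 2)))%R.
Proof.
rewrite /phi normal_pdfE ?oner_neq0// /normal_peak /normal_fun expr1n mul1r subr0.
by rewrite mulr_natl mulNr.
Qed.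

Lemma phi_shift (c x : R) :
  (expR (- (c * x) - c ^+ 2 / 2) * phi x = phi (x + c))%R.
Proof. rewrite !phiE mulrCA -expRD; congr (_ * expR _)%R; by field. Qed.

Lemma measurable_phi : measurable_fun [set: measurableTypeR R] phi.
Proof. exact: measurable_normal_pdf. Qed.

Lemma ge0_integral_N01 (f : measurableTypeR R -> \bar R) : measurable_fun setT f ->
  (forall x, 0 <= f x) -> \int[N01 R]_x f x = \int[mu]_x (f x * (phi x)%:E).
Proof.
move=> mf f0; apply: ge0_integral_density => //.
- exact: measurable_phi.
- by move=> x; exact: normal_pdf_ge0.
Qed.

(** One-dimensional Cameron-Martin formula: translation invariance of Lebesgue measure combined with
    completing the square in the density ([phi_shift]). *)
Lemma N01_shift c (f : measurableTypeR R -> \bar R) : measurable_fun setT f ->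
  (forall x, 0 <= f x) ->
  \int[N01 R]_x (f (x + c)%R * (expR (- (c * x) - c ^+ 2 / 2))%:E) = \int[N01 R]_x f x.
Proof.
move=> mf f0; rewrite !ge0_integral_N01//; last 2 first.
- apply: emeasurable_funM; first exact: (measurableT_comp mf (measurable_shiftR c)).
  apply/measurable_EFinP/measurableT_comp => //; apply: measurable_funB => //.
  by apply: measurableT_comp => //; exact: measurable_funM.
- by move=> x; rewrite mule_ge0// lee_fin expR_ge0.
rewrite -(ge0_integral_shift c (f := fun x => f x * (phi x)%:E)); last 2 first.
- by apply: emeasurable_funM => //; apply/measurable_EFinP; exact: measurable_phi.
- by move=> x; rewrite mule_ge0// lee_fin normal_pdf_ge0.
apply: eq_integral => x _; rewrite -muleA -EFinM; congr (_ * _%:E).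
by rewrite phi_shift.
Qed.
End one_dim.

(** * Marginals, independent blocks and products for Gaussian vectors *)

Section gam_laws.
Context {R : realType}.
Local Open Scope ereal_scope.

Lemma law_coord (I : finType) (i : I) :
  law (gam R I) (fun g => g i : measurableTypeR R) (N01 R).
Proof.
split; first exact: measurable_coord.
move=> A mA; have := @gam_box R I (fun j => if j == i then A else setT).
have -> : box (fun j => if j == i then A else setT) = (fun g : vec R I => g i) @^-1` A.
  apply/seteqP; split=> [g /= /(_ i)|g /= gA j]; first by rewrite eqxx.
  by case: eqP => [->|].
move=> ->; last by move=> j; case: ifP.
rewrite (bigD1 i)//= eqxx big1 ?mule1// => j /negbTE ->.
exact: probability_setT.
Qed.

(** Distinct coordinates of a standard Gaussian vector form a standard Gaussian vector: a box in the
    chosen coordinates is a box whose other sides are the whole line, each of mass one. *)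
Lemma law_inj (I J : finType) (h : J -> I) : injective h ->
  law (gam R I) (fun g => (fun j => g (h j)) : vec R J) (gam R J).
Proof.
move=> hI; apply: law_gam => [j|B mB]; first exact: measurable_coord.
pose C i := if [pick j | h j == i] is Some j then B j else setT.
have Ch j : C (h j) = B j.
  rewrite /C; case: pickP => [k /eqP/hI ->//|/(_ j)]; by rewrite eqxx.
have := @gam_box R I C.
have -> : box C = [set g | forall j, B j (g (h j))].
  apply/seteqP; split=> [g /= + j|g /= gB i]; first by move=> /(_ (h j)); rewrite Ch.
  by rewrite /C; case: pickP => // j /eqP <-; exact: gB.
move=> ->; last by move=> i; rewrite /C; case: pickP.
rewrite (bigID (fun i => i \in codom h))/= [X in _ * X]big1 ?mule1; last first.
  move=> i ih; rewrite /C; case: pickP => [j /eqP ji|_]; last exact: probability_setT.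
  by move: ih; rewrite -ji codom_f.
rewrite -big_uniq/=; last by rewrite map_inj_uniq ?enum_uniq.
by rewrite big_map big_enum/=; apply: eq_bigr => j _; rewrite Ch.
Qed.

Definition vsum (J1 J2 : finType) (p : vec R J1 * vec R J2) : vec R (J1 + J2)%type :=
  fun s => match s with inl j => p.1 j | inr j => p.2 j end.

Lemma law_vsum (J1 J2 : finType) :
  law (gam R J1 \x gam R J2 : probability _ R) (@vsum J1 J2) (gam R (J1 + J2)%type).
Proof.
apply: law_gam => [[j|j]|B mB].
- by apply: (measurableT_comp (measurable_coord j)); exact: measurable_fst.
- by apply: (measurableT_comp (measurable_coord j)); exact: measurable_snd.
have -> : [set t | forall i, B i (@vsum J1 J2 t i)] =
    box (fun j => B (inl j)) `*` box (fun j => B (inr j)).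
  apply/seteqP; split=> [[g h] /= H|[g h] [/= H1 H2] [j|j]] //=.
  by split=> j; [exact: (H (inl j))|exact: (H (inr j))].
rewrite /= product_measure1E; try exact: measurable_box.
rewrite big_sumType; congr (_ * _); exact: gam_box.
Qed.

Lemma law_vcons n :
  law (N01 R \x gam R 'I_n : probability _ R) (@vcons R n) (gam R 'I_n.+1).
Proof.
apply: law_gam => [i|B mB].
  by apply: (measurableT_comp (measurable_coord i)); exact: measurable_vcons.
have -> : [set t | forall i, B i (@vcons R n t i)] =
    B ord0 `*` box (fun i : 'I_n => B (lift ord0 i)).
  apply/seteqP; split=> [[t h] /= H|[t h] [/= H0 H] i].
    split; first by have := H ord0; rewrite /vcons unlift_none.
    by move=> i; have := H (lift ord0 i); rewrite /vcons liftK.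
  by rewrite /vcons; case: unliftP => [j ->|->].
rewrite /= product_measure1E//; last exact: measurable_box.
  by rewrite big_ord_recl; congr (_ * _); exact: gam_box.
exact: mB.
Qed.

Lemma law_pair (I J1 J2 : finType) (h1 : J1 -> I) (h2 : J2 -> I) :
  injective h1 -> injective h2 -> (forall j1 j2, h1 j1 != h2 j2) ->
  forall f : vec R J1 * vec R J2 -> \bar R, measurable_fun setT f -> (forall p, 0 <= f p) ->
  \int[gam R I]_g f (fun j => g (h1 j), fun j => g (h2 j)) =
  \int[gam R J1 \x gam R J2]_p f p.
Proof.
move=> h1I h2I h12 f mf f0.
pose h (s : J1 + J2) := match s with inl j => h1 j | inr j => h2 j end.
have hI : injective h.
  move=> [i|i] [j|j] /= ij; first by rewrite (h1I _ _ ij).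
  - by have := h12 i j; rewrite ij eqxx.
  - by have := h12 j i; rewrite ij eqxx.
  - by rewrite (h2I _ _ ij).
pose F (g : vec R (J1 + J2)%type) := f (fun j => g (inl j), fun j => g (inr j)).
have mF : measurable_fun setT F.
  apply: (measurableT_comp mf); apply: measurable_fun_pair;
  by apply: measurable_vec => j; exact: measurable_coord.
have F0 g : 0 <= F g by exact: f0.
transitivity (\int[gam R (J1 + J2)%type]_g F g); first by rewrite (law_ge0 (law_inj hI)).
rewrite (law_ge0 (law_vsum J1 J2))//.
by apply: eq_integral => -[g1 g2].
Qed.

Lemma ge0_integral_prod (I : finType) (f : I -> measurableTypeR R -> R) :
  (forall i, measurable_fun setT (f i)) -> (forall i x, (0 <= f i x)%R) ->
  \int[gam R I]_g (\prod_i f i (g i))%:E = \prod_i \int[N01 R]_x (f i x)%:E.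
Proof.
move=> mf f0.
have mI (J : finType) (k : J -> measurableTypeR R -> R) : (forall i, measurable_fun setT (k i)) ->
    measurable_fun setT (fun g : vec R J => (\prod_i k i (g i))%:E).
  move=> mk; apply/measurable_EFinP/measurable_prod => i _.
  by apply: (measurableT_comp (mk i)); exact: measurable_coord.
suff main n (k : 'I_n -> measurableTypeR R -> R) : (forall i, measurable_fun setT (k i)) ->
    (forall i x, (0 <= k i x)%R) ->
  \int[gam R 'I_n]_g (\prod_i k i (g i))%:E = \prod_i \int[N01 R]_x (k i x)%:E.
  have eI : injective (@enum_val I predT) by exact: enum_val_inj.
  rewrite (reindex (@enum_val I predT))/=; last exact: onW_bij (enum_val_bij I).
  rewrite -main// (law_ge0 (law_inj eI)); last 2 first.
  - by apply: (mI _ (fun i => f (enum_val i))) => i.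
  - by move=> g; rewrite lee_fin prodr_ge0.
  apply: eq_integral => g _; rewrite (reindex (@enum_val I predT))//=.
  exact: onW_bij (enum_val_bij I).
elim: n k => [|n IH] k mk k0.
  under eq_integral do rewrite big_ord0.
  by rewrite big_ord0 integral_cst// mul1e; exact: probability_setT.
rewrite (law_ge0 (law_vcons n)); last 2 first.
- exact: mI.
- by move=> g; rewrite lee_fin prodr_ge0.
rewrite fubini_tonelli1/=; last 2 first.
- exact: (measurableT_comp (mI _ k mk) (@measurable_vcons R n)).
- by move=> g; rewrite lee_fin prodr_ge0.
rewrite big_ord_recl -IH// -ge0_integralZr//; last 3 first.
- exact/measurable_EFinP.
- by move=> x _; rewrite lee_fin.
- by apply: integral_ge0 => g _; rewrite lee_fin prodr_ge0.
apply: eq_integral => x _; rewrite /fubini_F -ge0_integralZl//; last 3 first.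
- by apply: (mI _ (fun i => k (lift ord0 i))) => i.
- by move=> g _; rewrite lee_fin prodr_ge0.
- by rewrite lee_fin.
apply: eq_integral => g _; rewrite big_ord_recl EFinM /vcons unlift_none/=.
by under eq_bigr do rewrite liftK.
Qed.
End gam_laws.

From mathcomp Require Import measurable_realfun ring lra.
Lemma measurable_coord_comp d (T : measurableType d) (R : realType) (I : finType) (i : I)
    (f : T -> vec R I) : measurable_fun setT f ->
  measurable_fun setT (fun x => f x i : R).
Proof. by move=> mf; apply: (measurableT_comp (measurable_coord i)). Qed.

Ltac mfun := repeat first
  [ assumption | exact: measurable_cst | exact: measurable_fst | exact: measurable_snd
  | exact: measurable_coord | exact: measurable_id
  | apply: measurable_funD | apply: measurable_funB | apply: measurable_funM
  | apply: measurable_funX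
  | apply: measurable_sum => ?
  | match goal with |- measurable_fun _ (fun x => - _) => apply: measurableT_comp end
  | match goal with |- measurable_fun _ (fun x => expR _) => apply: measurableT_comp end
  | apply: measurable_coord_comp ].

(** * Cameron-Martin formula in finite dimension, and resampling along a subspace *)

Section shift.
Context {R : realType}.
Local Open Scope ereal_scope.

Definition vadd {I : finType} (g c : vec R I) : vec R I := fun i => (g i + c i)%R.

(** The Cameron-Martin density exp(-<c,g> - |c|^2/2), which compensates the translation of g by
    c. *)
Definition cm {I : finType} (c g : vec R I) : R :=
  expR (- \sum_i c i * g i - (\sum_i c i ^+ 2) / 2)%R.

Lemma measurable_vadd (I : finType) (c : vec R I) : measurable_fun setT (vadd ^~ c).
Proof. by apply: measurable_vec => i; mfun. Qed.

Lemma measurable_cm (I : finType) (c : vec R I) : measurable_fun setT (cm c).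
Proof. by rewrite /cm; mfun. Qed.

(** Induction on the dimension: [N01_shift] for the head coordinate, the induction hypothesis for
    the rest, Tonelli to join them. *)
Lemma gam_ord_shift n (c : vec R 'I_n) (F : vec R 'I_n -> \bar R) :
  measurable_fun setT F -> (forall g, 0 <= F g) ->
  \int[gam R 'I_n]_g (F (vadd g c) * (cm c g)%:E) = \int[gam R 'I_n]_g F g.
Proof.
elim: n c F => [|n IH] c F mF F0.
  apply: eq_integral => g _; rewrite /cm !big_ord0 mul0r subr0 oppr0 expR0 mule1.
  by congr F; apply/funext; case.
pose c' : vec R 'I_n := fun i => c (lift ord0 i).
have mFc : measurable_fun setT (F \o @vcons R n).
  exact: (measurableT_comp mF (@measurable_vcons R n)).
rewrite [RHS](law_ge0 (law_vcons n))// [LHS](law_ge0 (law_vcons n)); last 2 first.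
- apply: emeasurable_funM; first exact: (measurableT_comp mF (measurable_vadd c)).
  by apply/measurable_EFinP; exact: measurable_cm.
- by move=> g; rewrite mule_ge0// lee_fin expR_ge0.
pose f t := \int[gam R 'I_n]_h F (vcons (t, h)).
have mf : measurable_fun setT f.
  by apply: (measurable_fun_fubini_tonelli_F (m2 := gam R 'I_n) (F \o @vcons R n)) => // p; exact: F0.
rewrite fubini_tonelli1/=; last 2 first.
- apply: emeasurable_funM.
    exact: (measurableT_comp (measurableT_comp mF (measurable_vadd c)) (@measurable_vcons R n)).
  by apply/measurable_EFinP; exact: (measurableT_comp (measurable_cm c) (@measurable_vcons R n)).
- by move=> g; rewrite mule_ge0// lee_fin expR_ge0.
rewrite fubini_tonelli1/=; last 2 first.
- exact: mFc.
- by move=> g; exact: F0.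
rewrite -/f -(N01_shift (c ord0) mf); last first.
  by move=> t; apply: integral_ge0 => h _; exact: F0.
apply: eq_integral => t _; rewrite /fubini_F /f.
rewrite -(IH c' (fun h => F (vcons ((t + c ord0)%R, h)))); last 2 first.
- apply: (measurableT_comp mFc); apply: measurable_fun_pair => //.
- by move=> g; exact: F0.
rewrite -ge0_integralZr//; last 2 first.
- apply: emeasurable_funM.
    apply: (measurableT_comp mFc); apply: measurable_fun_pair => //.
    exact: measurable_vadd.
  by apply/measurable_EFinP; exact: measurable_cm.
- by move=> h _; rewrite mule_ge0// lee_fin expR_ge0.
apply: eq_integral => h _; rewrite -muleA -EFinM; congr (F _ * _%:E).
  apply/funext => i; rewrite /vadd /vcons; case: unliftP => [j ->|->]//.
rewrite /cm -expRD !big_ord_recl /vcons unlift_none/=; congr expR.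
under eq_bigr do rewrite liftK.
by rewrite /c'; field.
Qed.

Lemma gam_shift (I : finType) (c : vec R I) (F : vec R I -> \bar R) :
  measurable_fun setT F -> (forall g, 0 <= F g) ->
  \int[gam R I]_g (F (vadd g c) * (cm c g)%:E) = \int[gam R I]_g F g.
Proof.
move=> mF F0.
have eI : injective (@enum_rank I) by exact: enum_rank_inj.
pose h (g : vec R 'I_#|I|) : vec R I := fun i => g (enum_rank i).
have lh : law (gam R 'I_#|I|) h (gam R I) := law_inj eI.
rewrite !(law_ge0 lh)//; last 2 first.
- apply: emeasurable_funM; first exact: (measurableT_comp mF (measurable_vadd c)).
  by apply/measurable_EFinP; exact: measurable_cm.
- by move=> g; rewrite mule_ge0// lee_fin expR_ge0.
rewrite -(gam_ord_shift (fun k => c (enum_val k)) (F := F \o h)); last 2 first.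
- by apply: (measurableT_comp mF); exact: lh.1.
- by move=> g; exact: F0.
apply: eq_integral => g _; congr (F _ * (expR _)%:E).
  by apply/funext => i; rewrite /vadd/h enum_rankK.
congr (- _ - _ / 2)%R.
  rewrite (reindex (@enum_val I predT))/=; last exact: onW_bij (enum_val_bij I).
  by apply: eq_bigr => i _; rewrite /h enum_valK.
by rewrite (reindex (@enum_val I predT))/=; last exact: onW_bij (enum_val_bij I).
Qed.

Section resample.
Variables (I A : finType) (U : I -> A -> R).

Definition proj (g : vec R I) : vec R A := fun a => (\sum_j U j a * g j)%R.

Definition inj (d : vec R A) : vec R I := fun i => (\sum_a U i a * d a)%R.

(** With the columns of U orthonormal, [proj] is the transpose of U and [inj] is U, so this is g - U
    U^T g + U d: the component of g in the range of U is replaced by the one with coordinates d. *)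
Definition resample (p : vec R I * vec R A) : vec R I :=
  fun i => (p.1 i - inj (proj p.1) i + inj p.2 i)%R.

Lemma measurable_proj : measurable_fun setT proj.
Proof. by apply: measurable_vec => a; mfun. Qed.

Lemma measurable_inj : measurable_fun setT inj.
Proof. by apply: measurable_vec => a; mfun. Qed.

Lemma measurable_resample : measurable_fun setT resample.
Proof.
have := measurable_inj; have := measurable_proj => mp mi.
apply: measurable_vec => i; rewrite /resample.
apply: measurable_funD; first apply: measurable_funB.
- by mfun.
- exact: (measurable_coord_comp i (measurableT_comp mi (measurableT_comp mp measurable_fst))).
- exact: (measurable_coord_comp i (measurableT_comp mi measurable_snd)).
Qed.

Hypothesis isoU : forall a b, (\sum_i U i a * U i b = (a == b)%:R)%R.

Lemma proj_inj d : proj (inj d) = d.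
Proof.
apply/funext => a; rewrite /proj /inj.
under eq_bigr do rewrite mulr_sumr.
rewrite exchange_big/= (bigD1 a)//= [X in (_ + X)%R]big1 ?addr0.
  by under eq_bigr do rewrite mulrA; rewrite -mulr_suml isoU eqxx mul1r.
move=> b /negbTE ba; under eq_bigr do rewrite mulrA.
by rewrite -mulr_suml isoU eq_sym ba mul0r.
Qed.

Lemma inj_dot d (g : vec R I) : (\sum_i inj d i * g i = \sum_a d a * proj g a)%R.
Proof.
rewrite /inj /proj; under eq_bigr do rewrite mulr_suml.
rewrite exchange_big/=; apply: eq_bigr => a _; rewrite mulr_sumr.
by apply: eq_bigr => i _; ring.
Qed.

(** The proof needs no orthogonal change of variables: two Cameron-Martin shifts, one in d and one
    in g, reduce the claim to the fact that a Gaussian shift density integrates to one. *)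
Lemma law_resample : law (gam R I \x gam R A : probability _ R) resample (gam R I).
Proof.
split=> [|B mB]; first exact: measurable_resample.
pose F g : \bar R := (\1_B g)%:E.
have mF : measurable_fun setT F by apply/measurable_EFinP; exact: measurable_indic.
have F0 g : 0 <= F g by rewrite lee_fin.
have -> : gam R I B = \int[gam R I]_g F g by rewrite /F integral_indic// setIT.
have mr := measurable_resample.
have mrB : measurable (resample @^-1` B) by rewrite -[_ @^-1` _]setTI; exact: mr.
transitivity (\int[gam R I \x gam R A]_p F (resample p)).
  by have := integral_indic (gam R I \x gam R A)%E measurableT mrB; rewrite setIT => <-.
rewrite fubini_tonelli1; last 2 first.
- exact: (measurableT_comp mF mr).
- by move=> p; exact: F0.
pose K (p : vec R I * vec R A) : R := expR (- (\sum_a proj p.1 a * p.2 a) - (\sum_a proj p.1 a ^+ 2) / 2)%R.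
have mp : measurable_fun setT proj by exact: measurable_proj.
have mi : measurable_fun setT inj by exact: measurable_inj.
have mK : measurable_fun setT K.
  have ma a : measurable_fun setT (fun p : vec R I * vec R A => proj p.1 a).
    exact: (measurable_coord_comp a (measurableT_comp mp measurable_fst)).
  rewrite /K; apply: measurableT_comp => //; apply: measurable_funB.
    apply: measurableT_comp => //; apply: measurable_sum => a.
    by apply: measurable_funM => //; mfun.
  apply: measurable_funM => //; apply: measurable_sum => a.
  exact: measurable_funX.
have mFi : measurable_fun setT (fun p : vec R I * vec R A => F (vadd p.1 (inj p.2))).
  apply: (measurableT_comp mF); apply: measurable_vec => i.
  by apply: measurable_funD; [mfun|exact: (measurable_coord_comp i (measurableT_comp mi measurable_snd))].
transitivity (\int[gam R I]_g \int[gam R A]_d (F (vadd g (inj d)) * (K (g, d))%:E)).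
  apply: eq_integral => g _; rewrite /fubini_F.
  (* Shifting d by the old coordinates of g cancels the subtracted projection and leaves g + U d, at
     the price of the weight K. *)
  rewrite -(gam_shift (proj g) (F := fun d => F (resample (g, d)))); last 2 first.
  - by apply: (measurableT_comp mF); apply: (measurableT_comp mr); exact: measurable_pair1.
  - by move=> d; exact: F0.
  apply: eq_integral => d _; congr (F _ * _).
  apply/funext => i; rewrite /resample /vadd /=.
  have -> : inj (fun a => d a + proj g a)%R i = (inj d i + inj (proj g) i)%R.
    by rewrite /inj -big_split; apply: eq_bigr => a _; rewrite mulrDr.
  ring.
rewrite (fubini_tonelli (fun p : vec R I * vec R A => F (vadd p.1 (inj p.2)) * (K p)%:E)); last 2 first.
- by apply: emeasurable_funM => //; exact/measurable_EFinP.
- by move=> p; rewrite mule_ge0// lee_fin expR_ge0.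
(* L is the weight that turns into K when g is shifted by U d and multiplied by the corresponding
   density. *)
pose L (p : vec R I * vec R A) : R := expR (\sum_a proj p.1 a * p.2 a - (\sum_a proj p.1 a ^+ 2) / 2)%R.
have mL : measurable_fun setT L.
  have ma a : measurable_fun setT (fun p : vec R I * vec R A => proj p.1 a).
    exact: (measurable_coord_comp a (measurableT_comp mp measurable_fst)).
  rewrite /L; apply: measurableT_comp => //; apply: measurable_funB.
    apply: measurable_sum => a.
    by apply: measurable_funM => //; mfun.
  apply: measurable_funM => //; apply: measurable_sum => a.
  exact: measurable_funX.
transitivity (\int[gam R A]_d \int[gam R I]_g (F g * (L (g, d))%:E)).
  apply: eq_integral => d _.
  rewrite -(gam_shift (inj d) (F := fun g => F g * (L (g, d))%:E)); last 2 first.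
  - apply: emeasurable_funM => //; apply/measurable_EFinP.
    by apply: (measurableT_comp mL); exact: measurable_pair2.
  - by move=> g; rewrite mule_ge0// lee_fin expR_ge0.
  apply: eq_integral => g _; rewrite -muleA -EFinM; congr (F _ * _%:E) => //.
  rewrite /K /L /cm /= -expRD; congr expR.
  have -> : proj (vadd g (inj d)) = (fun a => proj g a + d a)%R.
    apply/funext => a; rewrite -[in RHS](proj_inj d) /proj -big_split.
    by apply: eq_bigr => i _; rewrite mulrDr.
  rewrite inj_dot.
  have -> : (\sum_i inj d i ^+ 2 = \sum_a d a ^+ 2)%R.
    under eq_bigr do rewrite expr2.
    by rewrite inj_dot; apply: eq_bigr => a _; rewrite proj_inj.
  rewrite -!mulNr -!sumrN !mulr_suml -!big_split/=.
  by apply: eq_bigr => a _; field.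
rewrite -(fubini_tonelli (fun p : vec R I * vec R A => F p.1 * (L p)%:E)); last 2 first.
- apply: emeasurable_funM; last exact/measurable_EFinP.
  by apply: (measurableT_comp mF); exact: measurable_fst.
- by move=> p; rewrite mule_ge0// lee_fin expR_ge0.
apply: eq_integral => g _; rewrite /= ge0_integralZl//; last 2 first.
- by apply/measurable_EFinP; apply: (measurableT_comp mL); exact: measurable_pair1.
- by move=> d _; rewrite lee_fin expR_ge0.
(* For fixed g, L is the shift density for the vector minus the projection of g, hence has integral
   one in d. *)
rewrite [X in _ * X](_ : _ = 1) ?mule1//.
have := gam_shift (fun a => (- proj g a)%R) (F := cst 1).
rewrite integral_cst// mul1e => h.
rewrite -[RHS](@probability_setT _ _ _ (gam R A)) -h//.
apply: eq_integral => d _; rewrite mul1e /L /cm; congr (expR _)%:E => /=.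
congr (_ - _ / 2)%R; first by rewrite -sumrN; apply: eq_bigr => a _; rewrite mulNr opprK.
by apply: eq_bigr => a _; rewrite sqrrN.
Qed.

End resample.
End shift.

From mathcomp Require Import measurable_realfun ring lra.

(** * Laws of orthonormal projections *)

Section proj_law.
Context {R : realType}.
Local Open Scope ereal_scope.

Lemma law_fst d1 d2 (T1 : measurableType d1) (T2 : measurableType d2)
    (P : probability T1 R) (Q : probability T2 R) :
  law (P \x Q : probability _ R) fst P.
Proof.
split=> [|A mA]; first exact: measurable_fst.
have -> : fst @^-1` A = A `*` [set: T2] by apply/seteqP; split=> [[]|[? ?] []].
rewrite /= product_measure1E// -[RHS]mule1; congr (_ * _).
exact: probability_setT.
Qed.

Lemma law_snd d1 d2 (T1 : measurableType d1) (T2 : measurableType d2)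
    (P : probability T1 R) (Q : probability T2 R) :
  law (P \x Q : probability _ R) snd Q.
Proof.
split=> [|A mA]; first exact: measurable_snd.
have -> : snd @^-1` A = [set: T1] `*` A by apply/seteqP; split=> [[]|[? ?] []].
rewrite /= product_measure1E// -[RHS]mul1e; congr (_ * _).
exact: probability_setT.
Qed.

Lemma proj_resample (I A : finType) (U : I -> A -> R) p :
  (forall a b, (\sum_i U i a * U i b = (a == b)%:R)%R) ->
  proj U (resample U p) = p.2.
Proof.
move=> isoU; apply/funext => a.
have projD (g h k : vec R I) :
    (proj U (fun i => g i - h i + k i) a = proj U g a - proj U h a + proj U k a)%R.
  by rewrite /proj -sumrB -big_split; apply: eq_bigr => i _; rewrite mulrDr mulrBr.
by rewrite /resample projD !proj_inj// subrr add0r.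
Qed.

(** Resampling does not change the law of g, and the projection of the resampled vector is the fresh
    vector itself. *)
Lemma law_proj (I A : finType) (U : I -> A -> R) :
  (forall a b, (\sum_i U i a * U i b = (a == b)%:R)%R) ->
  law (gam R I) (proj U) (gam R A).
Proof.
move=> isoU; have mp := @measurable_proj R I A U; split=> // B mB.
have mpB : measurable (proj U @^-1` B) by rewrite -[_ @^-1` _]setTI; exact: mp.
have [_ <-//] := law_resample isoU.
have [_ <-//] := law_snd (gam R I) (gam R A).
by congr (_ _); apply/seteqP; split=> p /=; rewrite proj_resample.
Qed.

Lemma law_dot (I : finType) (w : I -> R) : (\sum_i w i ^+ 2 = 1)%R ->
  law (gam R I) (fun g => (\sum_i w i * g i)%R : measurableTypeR R) (N01 R).
Proof.
move=> w1; have iso (a b : unit) : (\sum_i w i * w i = (a == b)%:R)%R.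
  by case: a; case: b; rewrite eqxx -w1; apply: eq_bigr => i _; rewrite expr2.
exact: (law_comp (law_proj (U := fun i _ => w i) iso) (law_coord tt)).
Qed.
End proj_law.

(** * Exposing the symmetric action of a Gaussian matrix on a vector *)

Section exposure.
Context {R : realType} {n : nat}.
Implicit Types (v x y z : 'I_n -> R) (G : vec R ('I_n * 'I_n)%type).

Definition dot x y : R := \sum_i x i * y i.

Definition bil G x y : R := \sum_p G p * x p.1 * y p.2.

Definition rsq2 : R := (Num.sqrt 2)^-1.

Lemma rsq2_sqr : rsq2 * rsq2 = 2^-1.
Proof. by rewrite -invfM -expr2 sqr_sqrtr// ler0n. Qed.

(** The factor 1/sqrt 2 makes each off-diagonal coupling (G_ij + G_ji)/sqrt 2 standard normal. *)
Definition quad G x : R := rsq2 * bil G x x.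

Definition rej v y : 'I_n -> R := fun i => y i - dot v y * v i.

Lemma dotC x y : dot x y = dot y x.
Proof. by apply: eq_bigr => i _; rewrite mulrC. Qed.

Lemma dot_lin a b x y z : dot z (fun i => a * x i + b * y i) = a * dot z x + b * dot z y.
Proof.
by rewrite /dot !mulr_sumr -big_split; apply: eq_bigr => i _ /=; ring.
Qed.

Lemma bil_linr a b x y z G :
  bil G z (fun i => a * x i + b * y i) = a * bil G z x + b * bil G z y.
Proof.
by rewrite /bil !mulr_sumr -big_split; apply: eq_bigr => i _ /=; ring.
Qed.

Lemma bil_linl a b x y z G :
  bil G (fun i => a * x i + b * y i) z = a * bil G x z + b * bil G y z.
Proof.
by rewrite /bil !mulr_sumr -big_split; apply: eq_bigr => i _ /=; ring.
Qed.

(* [V v] maps z to minus the symmetric matrix that acts on v as z acts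
   (up to the isometric normalisation); its range is what a symmetric matrix
   reveals when its image of v is read off. *)
Definition V v (p : 'I_n * 'I_n) (a : 'I_n) : R :=
  - (rsq2 * (v p.1 * ((p.2 == a)%:R - v p.2 * v a) + ((p.1 == a)%:R - v p.1 * v a) * v p.2)
     + v a * v p.1 * v p.2).

Lemma sum_delta (a : 'I_n) (f : 'I_n -> R) : \sum_i (i == a)%:R * f i = f a.
Proof.
rewrite (bigD1 a)//= eqxx mul1r big1 ?addr0// => i /negbTE ->.
by rewrite mul0r.
Qed.

Lemma sum_pair (f g : 'I_n -> R) : \sum_(p : 'I_n * 'I_n) f p.1 * g p.2 = (\sum_i f i) * \sum_i g i.
Proof.
by rewrite -(pair_bigA _ (fun i j => f i * g j))/= mulr_suml; apply: eq_bigr => i _; rewrite mulr_sumr.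
Qed.

(** Up to sign, column a is (v (x) q_a + q_a (x) v)/sqrt 2 + v_a v (x) v, where q_a is the basis
    vector e_a minus its projection on v. Since q_a is orthogonal to v, only the products <q_a,q_b>
    and v_a v_b survive. *)
Lemma V_iso v : dot v v = 1 ->
  forall a b, \sum_p V v p a * V v p b = (a == b)%:R.
Proof.
move=> v1 a b.
pose q (a i : 'I_n) : R := (i == a)%:R - v i * v a.
have vq c : \sum_i v i * q c i = 0.
  rewrite /q; under eq_bigr do rewrite mulrBr mulrC.
  rewrite sumrB sum_delta; under eq_bigr do rewrite mulrA.
  by rewrite -mulr_suml -/(dot v v) v1 mul1r subrr.
have qq : \sum_i q a i * q b i = (a == b)%:R - v a * v b.
  rewrite {1}/q; under eq_bigr do rewrite mulrBl.
  rewrite sumrB sum_delta; under [X in _ - X]eq_bigr do rewrite -mulrA mulrCA.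
  by rewrite -mulr_sumr vq mulr0 subr0 /q mulrC.
(* Every term is a function of the row index times a function of the column index, so its sum over
   pairs factors. *)
have E p : V v p a * V v p b = rsq2 * rsq2 *
   ((v p.1 * v p.1) * (q a p.2 * q b p.2) + (v p.1 * q b p.1) * (v p.2 * q a p.2)
   + (v p.1 * q a p.1) * (v p.2 * q b p.2) + (q a p.1 * q b p.1) * (v p.2 * v p.2))
   + rsq2 * (v b * ((v p.1 * v p.1) * (v p.2 * q a p.2) + (v p.1 * q a p.1) * (v p.2 * v p.2))
       + v a * ((v p.1 * v p.1) * (v p.2 * q b p.2) + (v p.1 * q b p.1) * (v p.2 * v p.2)))
   + v a * v b * ((v p.1 * v p.1) * (v p.2 * v p.2)).
  by rewrite /V /q; ring.
have v1' : \sum_i v i * v i = 1 by [].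
have S1 : \sum_(p : 'I_n * 'I_n) (v p.1 * v p.1) * (q a p.2 * q b p.2) = (a == b)%:R - v a * v b.
  by rewrite (sum_pair (fun i => v i * v i) (fun i => q a i * q b i)) v1' qq mul1r.
have S2 : \sum_(p : 'I_n * 'I_n) (q a p.1 * q b p.1) * (v p.2 * v p.2) = (a == b)%:R - v a * v b.
  by rewrite (sum_pair (fun i => q a i * q b i) (fun i => v i * v i)) v1' qq mulr1.
have S3 c d : \sum_(p : 'I_n * 'I_n) (v p.1 * q c p.1) * (v p.2 * q d p.2) = 0.
  by rewrite (sum_pair (fun i => v i * q c i) (fun i => v i * q d i)) !vq mul0r.
have S4 c : \sum_(p : 'I_n * 'I_n) (v p.1 * v p.1) * (v p.2 * q c p.2) = 0.
  by rewrite (sum_pair (fun i => v i * v i) (fun i => v i * q c i)) vq mulr0.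
have S5 c : \sum_(p : 'I_n * 'I_n) (v p.1 * q c p.1) * (v p.2 * v p.2) = 0.
  by rewrite (sum_pair (fun i => v i * q c i) (fun i => v i * v i)) vq mul0r.
have S6 : \sum_(p : 'I_n * 'I_n) (v p.1 * v p.1) * (v p.2 * v p.2) = 1.
  by rewrite (sum_pair (fun i => v i * v i) (fun i => v i * v i)) v1' mulr1.
rewrite (eq_bigr _ (fun p _ => E p)) !big_split/= -!mulr_sumr !big_split/= -!mulr_sumr !big_split/=.
rewrite S1 S2 !S3 !S4 !S5 S6 rsq2_sqr.
by field.
Qed.

Lemma inj_V v z p : inj (V v) z p =
  - (rsq2 * (v p.1 * rej v z p.2 + rej v z p.1 * v p.2) + dot v z * v p.1 * v p.2).
Proof.
have E a : V v p a * z a = - (rsq2 * (v p.1 * ((a == p.2)%:R * z a) - v p.1 * v p.2 * (v a * z a)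
   + v p.2 * ((a == p.1)%:R * z a) - v p.1 * v p.2 * (v a * z a)) + v p.1 * v p.2 * (v a * z a)).
  by rewrite /V (eq_sym a) (eq_sym a); ring.
rewrite /inj (eq_bigr _ (fun p _ => E p)) sumrN big_split /= -!mulr_sumr !(sumrB, big_split)/=.
rewrite -!mulr_sumr !sum_delta /rej -/(dot v z); ring.
Qed.

Lemma bil_outer (f g x y : 'I_n -> R) :
  \sum_p (f p.1 * g p.2) * x p.1 * y p.2 = dot f x * dot g y.
Proof.
rewrite -(sum_pair (fun i => f i * x i) (fun i => g i * y i)).
by apply: eq_bigr => p _ /=; ring.
Qed.

Lemma quad_inj_V v z y : quad (inj (V v) z) y =
  - (dot v y * dot (rej v z) y + rsq2 * dot v z * dot v y ^+ 2).
Proof.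
have E p : inj (V v) z p * y p.1 * y p.2 = - (rsq2 * ((v p.1 * rej v z p.2) * y p.1 * y p.2 +
    (rej v z p.1 * v p.2) * y p.1 * y p.2) + dot v z * ((v p.1 * v p.2) * y p.1 * y p.2)).
  by rewrite inj_V; ring.
rewrite /quad /bil (eq_bigr _ (fun p _ => E p)) sumrN big_split/= -!mulr_sumr big_split/=.
rewrite !bil_outer (_ : _ * _ = - ((rsq2 * rsq2) * 2 * (dot v y * dot (rej v z) y)
   + rsq2 * dot v z * dot v y ^+ 2)); last by ring.
by rewrite rsq2_sqr mulVf ?mul1r// pnatr_eq0.
Qed.

Definition eb (a : 'I_n) : 'I_n -> R := fun i => (i == a)%:R.

Lemma sum_bil_l G x y : \sum_a bil G (eb a) x * y a = bil G y x.
Proof.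
rewrite /bil; under eq_bigr do rewrite mulr_suml.
rewrite exchange_big/=; apply: eq_bigr => p _.
rewrite (eq_bigr (fun a => (a == p.1)%:R * (G p * y a * x p.2))) ?sum_delta//.
by move=> a _; rewrite /eb eq_sym; ring.
Qed.

Lemma sum_bil_r G x y : \sum_a bil G x (eb a) * y a = bil G x y.
Proof.
rewrite /bil; under eq_bigr do rewrite mulr_suml.
rewrite exchange_big/=; apply: eq_bigr => p _.
rewrite (eq_bigr (fun a => (a == p.2)%:R * (G p * x p.1 * y a))) ?sum_delta//.
by move=> a _; rewrite /eb eq_sym; ring.
Qed.

Lemma proj_V v G a : proj (V v) G a =
  - (rsq2 * (bil G v (eb a) + bil G (eb a) v - v a * bil G v v *+ 2) + v a * bil G v v).
Proof.
have E p : V v p a * G p = - (rsq2 * (G p * v p.1 * eb a p.2 + G p * eb a p.1 * v p.2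
    - v a *+ 2 * (G p * v p.1 * v p.2)) + v a * (G p * v p.1 * v p.2)).
  by rewrite /V /eb; ring.
rewrite /proj (eq_bigr _ (fun p _ => E p)) sumrN big_split/= -!mulr_sumr sumrB big_split/=.
by rewrite -!mulr_sumr -mulrnAl.
Qed.

Lemma dot_proj_V v G y : dot v v = 1 -> dot (proj (V v) G) y =
  - (rsq2 * (bil G v y + bil G y v - (dot v y * bil G v v) *+ 2) + dot v y * bil G v v).
Proof.
move=> v1; have E a : proj (V v) G a * y a = - (rsq2 * (bil G v (eb a) * y a + bil G (eb a) v * y a
   - (bil G v v *+ 2) * (v a * y a)) + bil G v v * (v a * y a)).
  by rewrite proj_V; ring.
rewrite {1}/dot (eq_bigr _ (fun p _ => E p)) sumrN big_split/= -!mulr_sumr sumrB big_split/=.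
by rewrite -!mulr_sumr sum_bil_l sum_bil_r -/(dot v y); ring.
Qed.

Lemma quad_resample v G z y : dot v v = 1 \/ v = (fun=> 0) ->
  quad (resample (V v) (G, z)) y =
  quad G (rej v y) - (dot v y * dot (rej v z) y + rsq2 * dot v z * dot v y ^+ 2).
Proof.
have quadD (g h k : vec R ('I_n * 'I_n)%type) : quad (fun p => g p - h p + k p) y = quad g y - quad h y + quad k y.
  rewrite /quad -mulrBr -mulrDr /bil -sumrB -big_split; congr (_ * _).
  by apply: eq_bigr => p _ /=; ring.
rewrite /resample quadD !quad_inj_V/=.
have rejE (u w : 'I_n -> R) : rej u w = (fun i => 1 * w i + (- dot u w) * u i).
  by apply/funext => i; rewrite /rej; ring.
case=> [v1|->]; last first.
  have d0 x : dot (fun=> 0) x = 0 by rewrite /dot big1// => i _; rewrite mul0r.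
  have r0 x : rej (fun=> 0) x = x by apply/funext => i; rewrite /rej mulr0 subr0.
  by rewrite !d0 !r0; ring.
rewrite [in X in X - _ + _ = _]/quad.
have -> : dot (rej v (proj (V v) G)) y =
    - (rsq2 * (bil G v y + bil G y v - (dot v y * bil G v v) *+ 2)).
  rewrite (dotC _ y) rejE dot_lin (dotC y) dot_proj_V// [dot v (proj _ _)]dotC dot_proj_V// v1.
  by rewrite (dotC y v); ring.
rewrite [dot v (proj _ _)]dotC dot_proj_V// v1.
rewrite [in RHS]/quad (rejE v y) bil_linl !bil_linr.
by ring.
Qed.

Lemma law_exposure v : dot v v = 1 \/ v = (fun=> 0) ->
  law (gam R ('I_n * 'I_n)%type \x gam R 'I_n : probability _ R)%E
    (resample (V v)) (gam R ('I_n * 'I_n)%type).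
Proof.
case=> [v1|->]; first exact: (law_resample (V_iso v1)).
rewrite (_ : resample _ = fst); first exact: law_fst.
have V0 p a : V (fun=> 0) p a = 0 by rewrite /V; ring.
apply/funext => -[G z]; apply/funext => p; rewrite /resample /inj /=.
rewrite [X in _ - X]big1 => [|a _]; last by rewrite V0 mul0r.
by rewrite big1 ?subr0 ?addr0// => a _; rewrite V0 mul0r.
Qed.

End exposure.

From mathcomp Require Import measurable_realfun ring lra.

(** * Expectations as a relation: integrability together with the value *)

Section mean.
Context {R : realType}.
Local Open Scope ereal_scope.

(** Bundling integrability with a real value keeps expectations out of the extended reals and lets
    linearity, transfer of laws and domination compose. *)
Definition mean d (T : measurableType d) (P : probability T R) (f : T -> R) (c : R) :=
  P.-integrable setT (EFin \o f) /\ \int[P]_x (f x)%:E = c%:E.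

Section mean_basic.
Context d (T : measurableType d) (P : probability T R).

Lemma mean_measurable f c : mean P f c -> measurable_fun setT f.
Proof. by move=> [/integrableP[mf _] _]; exact/measurable_EFinP. Qed.

Lemma mean_cst c : mean P (cst c) c.
Proof.
split; last first.
  transitivity (c%:E * P setT); last by rewrite probability_setT mule1.
  by rewrite -(integral_cst P measurableT) ; apply: eq_integral => x _.
exact: finite_measure_integrable_cst.
Qed.

Lemma meanD f g a b : mean P f a -> mean P g b -> mean P (fun x => f x + g x)%R (a + b)%R.
Proof.
move=> [fi fE] [gi gE]; split; first by apply: (integrableD _ fi gi).
by under eq_integral do rewrite EFinD; rewrite integralD//= fE gE.
Qed.

Lemma meanZ k f a : mean P f a -> mean P (fun x => k * f x)%R (k * a)%R.
Proof.
move=> [fi fE]; split; first by apply: (integrableZl _ _ fi).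
by under eq_integral do rewrite EFinM; rewrite integralZl//= fE.
Qed.

Lemma meanB f g a b : mean P f a -> mean P g b -> mean P (fun x => f x - g x)%R (a - b)%R.
Proof.
move=> fa gb; have := meanD fa (meanZ (-1) gb).
rewrite mulN1r; congr mean; apply/funext => x; by rewrite mulN1r.
Qed.

Lemma mean_sum (I : Type) (s : seq I) (Q : pred I) (f : I -> T -> R) (a : I -> R) :
  (forall i, Q i -> mean P (f i) (a i)) ->
  mean P (fun x => \sum_(i <- s | Q i) f i x)%R (\sum_(i <- s | Q i) a i)%R.
Proof.
move=> fa; elim: s => [|i s IH].
  rewrite big_nil (_ : (fun _ => _) = cst 0%R); first exact: mean_cst.
  by apply/funext => x; rewrite big_nil.
rewrite big_cons (_ : (fun x => _) = (fun x => (if Q i then f i x else 0) + \sum_(i <- s | Q i) f i x)%R).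
  case: ifPn => Qi; last by under eq_fun do rewrite add0r.
  by apply: meanD => //; exact: fa.
by apply/funext => x; rewrite big_cons; case: ifP; rewrite ?add0r.
Qed.

Lemma mean_unique f a b : mean P f a -> mean P f b -> a = b.
Proof. by move=> [_ +] [_ fb]; rewrite fb => -[->]. Qed.

Lemma mean_le f g a b : mean P f a -> mean P g b -> (forall x, (f x <= g x)%R) -> (a <= b)%R.
Proof.
move=> [fi fE] [gi gE] fg; rewrite -lee_fin -fE -gE; apply: le_integral => //.
by move=> x _; rewrite lee_fin.
Qed.

Lemma mean_ge0 (f : T -> R) c : measurable_fun setT f -> (forall x, (0 <= f x)%R) ->
  \int[P]_x (f x)%:E = c%:E -> mean P f c.
Proof.
move=> mf f0 fE; split=> //; apply/integrableP; split; first exact/measurable_EFinP.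
under eq_integral do rewrite /= ger0_norm//.
by rewrite fE ltry.
Qed.

Lemma mean_dominated (f g : T -> R) b : measurable_fun setT f -> mean P g b ->
  (forall x, (`|f x| <= g x)%R) -> exists c, mean P f c /\ (`|c| <= b)%R.
Proof.
move=> mf [gi gE] fg.
have fi : P.-integrable setT (EFin \o f).
  apply: (le_integrable _ _ _ gi) => //; first exact/measurable_EFinP.
  by move=> x _ /=; rewrite lee_fin (le_trans (fg x))// ler_norm.
have ff : \int[P]_x (f x)%:E \is a fin_num by exact: integrable_fin_num.
have m : mean P f (fine (\int[P]_x (f x)%:E)) by split=> //; rewrite fineK.
exists (fine (\int[P]_x (f x)%:E)); split=> //; rewrite ler_norml; apply/andP; split.
- have := mean_le (meanZ (-1) (conj gi gE)) m; rewrite mulN1r; apply=> x.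
  by rewrite mulN1r; have := fg x; rewrite ler_norml => /andP[].
- by apply: (mean_le m (conj gi gE)) => x; have := fg x; rewrite ler_norml => /andP[].
Qed.

Lemma mean_markov f c e : mean P f c -> (forall x, (0 <= f x)%R) -> (0 < e)%R ->
  P [set x | (e <= f x)%R] <= (c / e)%:E.
Proof.
move=> mfc f0 e0; have mf := mean_measurable mfc; have [fi fE] := mfc.
have mA : measurable [set x | (e <= f x)%R].
  by rewrite -[X in measurable X]setTI; exact: measurable_fun_le.
rewrite -(@lee_pmul2l _ e%:E)// -EFinM mulrC divfK ?gt_eqF// -fE.
rewrite -[in leLHS](setIT [set x | _]) -integral_indic// -ge0_integralZl//; last 2 first.
- by apply/measurable_EFinP; exact: measurable_indic.
- by rewrite lee_fin ltW.
apply: ge0_le_integral => //.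
- by move=> x _; rewrite -EFinM lee_fin mulr_ge0// ltW.
- by apply/measurable_EFinP/measurable_funM => //; exact: measurable_indic.
- by apply/measurable_EFinP.
- move=> x _; rewrite -EFinM lee_fin indicE; case: (boolP (x \in _)); rewrite ?inE/=.
    by rewrite mulr1.
  by rewrite mulr0.
Qed.
End mean_basic.

Lemma mean_law d d' (T : measurableType d) (T' : measurableType d')
    (P : probability T R) (X : T -> T') (Q : probability T' R) (f : T' -> R) c :
  law P X Q -> measurable_fun setT f -> mean P (fun x => f (X x)) c <-> mean Q f c.
Proof.
move=> lX mf; have mf' : measurable_fun setT (EFin \o f) by exact/measurable_EFinP.
split=> -[fi fE].
- have fi' : Q.-integrable setT (EFin \o f) by exact/(law_integrable lX mf').
  by split=> //; rewrite (law_integral lX mf' fi').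
- have fi' := (law_integrable lX mf').2 fi.
  by split=> //; rewrite -(law_integral lX mf' fi).
Qed.

Lemma mean_prod d d' (T : measurableType d) (T' : measurableType d')
    (P : probability T R) (Q : probability T' R) f g a b :
  mean P f a -> mean Q g b -> mean (P \x Q : probability _ R) (fun p => f p.1 * g p.2)%R (a * b)%R.
Proof.
move=> mfa mgb; have mf := mean_measurable mfa; have mg := mean_measurable mgb.
have [[fi fE] [gi gE]] := (mfa, mgb).
have mfg : measurable_fun setT (fun p : T * T' => f p.1 * g p.2)%R.
  by apply: measurable_funM;
   [exact: (measurableT_comp mf measurable_fst)|exact: (measurableT_comp mg measurable_snd)].
have fgi : (P \x Q).-integrable setT (EFin \o (fun p : T * T' => f p.1 * g p.2)%R).
  apply/integrableP; split; first exact/measurable_EFinP.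
  rewrite fubini_tonelli1; last 2 first.
  - by apply: measurableT_comp => //; exact/measurable_EFinP.
  - by move=> p; exact: abse_ge0.
  rewrite /fubini_F /=.
  under eq_integral => x _.
    under eq_integral do rewrite normrM EFinM.
    rewrite ge0_integralZl//; last first.
      by apply/measurable_EFinP; exact: measurableT_comp.
    over.
  rewrite ge0_integralZr//; last 2 first.
  - by apply/measurable_EFinP; exact: measurableT_comp.
  - by apply: integral_ge0.
  apply: lte_mul_pinfty.
  - exact: integral_ge0.
  - move/integrableP: fi => [_ fi]; rewrite ge0_fin_numE//; exact: integral_ge0.
  - by move/integrableP: gi => [_].
split=> //; rewrite -integral12_prod_meas1// /fubini_F/=.
under eq_integral => x _.
  under eq_integral do rewrite EFinM.
  rewrite integralZl// gE; over.
by rewrite integralZr//= fE.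
Qed.

End mean.

From mathcomp Require Import measurable_realfun ring lra.

(** * One-dimensional Gaussian moments *)

Section gauss1d.
Context {R : realType}.
Local Open Scope ereal_scope.
Local Notation mu := (@lebesgue_measure R).

(** The integrand times the density is s times the density of a centred normal variable of variance
    s^2 = 1/(1+2l). *)
Lemma mean_gauss_sq (l : R) : (- (1/2) < l)%R ->
  mean (N01 R) (fun t => expR (- (l * t ^+ 2))) (Num.sqrt (1 + 2 * l))^-1%R.
Proof.
move=> l12; have s0 : (0 < 1 + 2 * l)%R by lra.
apply: mean_ge0.
- apply: measurableT_comp => //; apply: measurableT_comp => //.
  by apply: measurable_funM => //; exact: measurable_funX.
- by move=> x; rewrite expR_ge0.
set s := (Num.sqrt (1 + 2 * l))^-1%R.
have s_gt0 : (0 < s)%R by rewrite invr_gt0 sqrtr_gt0.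
have s2 : (s ^+ 2 = (1 + 2 * l)^-1)%R by rewrite exprVn sqr_sqrtr// ltW.
have me : measurable_fun setT (fun t : measurableTypeR R => expR (- (l * t ^+ 2))).
  apply: measurableT_comp => //; apply: measurableT_comp => //.
  by apply: measurable_funM => //; exact: measurable_funX.
rewrite ge0_integral_N01//; last by apply/measurable_EFinP.
under eq_integral => t _.
  have -> : (expR (- (l * t ^+ 2)))%:E * (phi t)%:E = s%:E * (normal_pdf 0 s t)%:E.
    rewrite -!EFinM; congr EFin.
    rewrite phiE normal_pdfE ?gt_eqF// /normal_peak /normal_fun subr0.
    rewrite mulrCA -expRD [RHS]mulrA; congr (_ * expR _)%R.
      have -> : (s ^+ 2 * pi *+ 2 = s ^+ 2 * (2 * pi))%R by ring.
      by rewrite [in RHS]sqrtrM ?sqr_ge0// sqrtr_sqr gtr0_norm// invfM mulrA divff ?gt_eqF// mul1r.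
    by rewrite s2; field; rewrite gt_eqF.
  over.
rewrite ge0_integralZl//; last 3 first.
- by apply/measurable_EFinP; exact: measurable_normal_pdf.
- by move=> t _; rewrite lee_fin normal_pdf_ge0.
- by rewrite lee_fin ltW.
by rewrite integral_normal_pdf mule1.
Qed.

Lemma N01_opp : law (N01 R) (-%R : measurableTypeR R -> measurableTypeR R) (N01 R).
Proof.
split=> [|A mA]; first exact: oppr_measurable.
have mN : measurable ((-%R : measurableTypeR R -> measurableTypeR R) @^-1` A).
  by rewrite -[_ @^-1` _]setTI; exact: oppr_measurable.
have w1 : (\sum_(i : unit) (-1) ^+ 2 = 1 :> R)%R.
  by rewrite (bigD1 tt)//= sqrrN expr1n big1 ?addr0// => -[].
rewrite -((@law_coord R unit tt).2 _ mN) -((law_dot w1).2 _ mA).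
by congr (_ _); apply/seteqP; split=> g /=; rewrite (bigD1 tt)//= mulN1r big1 ?addr0// => -[].
Qed.

(** The bound exp u >= 1 + u^2/2 at u = t^2/4 gives t^4 <= 32 exp(t^2/4), which is integrable
    because 1/4 < 1/2. *)
Lemma mean_fourth : exists m4 : R, mean (N01 R) (fun t => t ^+ 4)%R m4.
Proof.
have l12 : (- (1/2) < - (1/4) :> R)%R by lra.
have m := meanZ 32 (mean_gauss_sq l12).
have [||c [mc _]] := mean_dominated _ m (f := (fun t : R => t ^+ 4)%R : measurableTypeR R -> R); last by exists c.
  exact: measurable_funX.
move=> t; rewrite ger0_norm ?exprn_even_ge0//.
have t0 : (0 <= t ^+ 2 / 4)%R by rewrite divr_ge0// sqr_ge0.
rewrite (_ : - (- (1 / 4) * t ^+ 2) = t ^+ 2 / 4)%R; last by field.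
have := expR_ge1Dxn 1%N t0; rewrite (_ : 2`! = 2)%N//.
have -> : (t ^+ 4 = 32 * ((t ^+ 2 / 4) ^+ 2 / 2))%R by field.
by move: (expR _) ((_ ^+ 2 / 2)%R) => e u h; lra.
Qed.

(** Both bounds compare 1 + l t^2 with exp(l t^2), whose mean is known: l = -1 gives positivity,
    small positive l gives the upper bound. *)
Lemma mean_second : exists m2 : R, mean (N01 R) (fun t => t ^+ 2)%R m2 /\ (0 < m2 <= 1)%R.
Proof.
have [m4 mm4] := mean_fourth.
have m := meanD (mean_cst (N01 R) 1%R) mm4.
have [||m2 [mm2 _]] := mean_dominated _ m (f := (fun t : R => t ^+ 2)%R : measurableTypeR R -> R).
- exact: measurable_funX.
- move=> t; rewrite ger0_norm ?sqr_ge0// /=.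
  have := sqr_ge0 (t ^+ 2 - 1/2)%R; rewrite (_ : t ^+ 4 = (t ^+ 2) ^+ 2)%R; last by rewrite -exprM.
  by move: (t ^+ 2)%R => u; nra.
exists m2; split=> //; apply/andP; split.
- have l12 : (- (1/2) < 1 :> R)%R by lra.
  have h := mean_le (meanB (mean_cst (N01 R) 1%R) mm2) (mean_gauss_sq l12).
  have {h} : (1 - m2 <= (Num.sqrt (1 + 2 * 1))^-1)%R.
    by apply: h => t /=; rewrite mul1r; exact: expR_ge1Dx.
  have : ((Num.sqrt (1 + 2 * 1))^-1 < 1 :> R)%R.
    have s0 : (0 < Num.sqrt (1 + 2 * 1 : R))%R by rewrite sqrtr_gt0; lra.
    have s2 : (Num.sqrt (1 + 2 * 1 : R) ^+ 2 = 1 + 2 * 1)%R by rewrite sqr_sqrtr//; lra.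
    by rewrite invf_lt1//; nra.
  by lra.
- rewrite leNgt; apply/negP => m21.
  (* If m2 > 1, a small l with 1 + 4l < m2 would give (1 + l + 4l^2)^2 (1 - 2l) < 1, whereas the
     expansion starts with 1 + 5 l^2. *)
  have [l [l0 l8 lm]] : exists l : R, [/\ 0 < l, l <= 1/8 & 1 + 4 * l < m2]%R.
    have [h|h] := leP ((m2 - 1) / 8)%R (1/8)%R.
      by exists ((m2 - 1) / 8)%R; split; lra.
    by exists (1/8)%R; split; lra.
  have l12 : (- (1/2) < - l :> R)%R by lra.
  have h := mean_le (meanD (mean_cst (N01 R) 1%R) (meanZ l mm2)) (mean_gauss_sq l12).
  have {h} : (1 + l * m2 <= (Num.sqrt (1 + 2 * - l))^-1)%R.
    by apply: h => t /=; rewrite mulNr opprK; exact: expR_ge1Dx.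
  have s0 : (0 < Num.sqrt (1 + 2 * - l))%R by rewrite sqrtr_gt0; lra.
  have s2 : (Num.sqrt (1 + 2 * - l) ^+ 2 = 1 + 2 * - l)%R by rewrite sqr_sqrtr//; lra.
  move: s0 s2; set s := Num.sqrt _ => s0 s2.
  rewrite -div1r ler_pdivlMr// => h1.
  have h2 : ((1 + l * (1 + 4 * l)) * s < 1)%R.
    by apply: lt_le_trans h1; rewrite ltr_pM2r//; nra.
  have h3 : ((1 + l * (1 + 4 * l)) ^+ 2 * (1 + 2 * - l) < 1)%R.
    by rewrite -s2 -exprMn expr_lt1// mulr_ge0 ?ltW//; nra.
  move: h3; rewrite ltNge => /negP; apply.
  rewrite -subr_ge0 (_ : _ - 1 = l ^+ 2 * (5 - 10 * l + 16 * l * l * (1 - 2 * l) - 8 * l * (2 * l) ))%R; last by ring.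
  by rewrite mulr_ge0 ?sqr_ge0//; nra.
Qed.
End gauss1d.

From mathcomp Require Import measurable_realfun ring lra.

(** * Truncated absolute moment of a normal variable *)

Section half_line.
Context {R : realType}.
Local Open Scope ereal_scope.
Local Notation mu := (@lebesgue_measure R).

Lemma phi_ge0 (x : R) : (0 <= phi x)%R.
Proof. exact: normal_pdf_ge0. Qed.

Lemma phiN (x : R) : phi (- x)%R = phi x.
Proof. by rewrite !phiE sqrrN. Qed.

Lemma derive_phi (x : R) : is_derive x 1%R (fun x : R => phi x) (- (x * phi x))%R.
Proof.
have -> : (fun x : R => phi x) = (fun x : R => (Num.sqrt (2 * pi))^-1 * expR (- (x ^+ 2 / 2)))%R.
  by apply/funext => y; rewrite phiE.
apply: is_derive_eq.
rewrite phiE /GRing.scale/=; field.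
by rewrite sqrtr_eq0 -ltNge mulr_gt0// pi_gt0.
Qed.

Lemma cvg_phi : phi x @[x --> +oo%R] --> (0%R : R).
Proof.
have -> : (fun x : R => phi x) = (fun x : R => (Num.sqrt (2 * pi))^-1 * expR (- (x ^+ 2 / 2)))%R.
  by apply/funext => y; rewrite phiE.
rewrite -[X in _ --> X](mulr0 (Num.sqrt (2 * pi))^-1%R).
apply: cvgM; first exact: cvg_cst.
apply: (cvg_comp (fun x => x ^+ 2 / 2)%R (fun x => expR (- x))); last exact: cvgr_expR.
by apply: gt0_cvgMly; [rewrite invr_gt0|exact: cvgr_expr2].
Qed.

Lemma phi_measurable : measurable_fun [set: measurableTypeR R] (fun x => phi x).
Proof. exact: measurable_phi. Qed.

(** The function -phi is a primitive of x phi(x) and vanishes at infinity. *)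
Lemma integral_half_line (d : R) : (0 <= d)%R ->
  \int[mu]_(x in `]d, +oo[) (x * phi x)%:E = (phi d)%:E.
Proof.
move=> d0.
have cphi : continuous (fun x : R => phi x).
  by apply: continuous_normal_pdf; rewrite oner_neq0.
have cf : continuous (fun x : R => x * phi x)%R.
  by move=> x; apply: cvgM; [exact: cvg_id|exact: cphi].
rewrite integral_itv_obnd_cbnd; last first.
  by apply/measurable_EFinP/measurable_funM => //; apply: measurable_funTS; exact: measurable_phi.
rewrite (@ge0_continuous_FTC2y _ (fun x => x * phi x)%R (fun x => - phi x)%R d 0%R).
- by rewrite -EFinB sub0r opprK.
- by move=> x dx; rewrite mulr_ge0 ?phi_ge0// (le_trans d0).
- exact: continuous_subspaceT.
- by rewrite -oppr0; apply: cvgN; exact: cvg_phi.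
- by move=> x _; apply/derivableN; have [] := derive_phi x.
- by apply: cvg_at_right_filter; apply: cvgN; exact: cphi.
- move=> x _; rewrite derive1E deriveN; last by have [] := derive_phi x.
  by have [_ ->] := derive_phi x; rewrite opprK.
Qed.

Lemma mean_half_abs (d : R) : (0 <= d)%R ->
  mean (N01 R) (fun t => if (d < `|t|)%R then `|t|%R else 0%R) (2 * phi d)%R.
Proof.
move=> d0.
pose g (t : measurableTypeR R) : R := (if (d < t) then t else 0)%R.
have mg : measurable_fun setT g.
  apply: measurable_fun_ifT => //; exact: measurable_fun_ltr.
have mgm : mean (N01 R) g (phi d).
  apply: mean_ge0 => //.
    by move=> t; rewrite /g; case: ifP => // /ltW; exact: le_trans.
  rewrite ge0_integral_N01//; last 2 first.
  - by apply/measurable_EFinP.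
  - by move=> t; rewrite lee_fin /g; case: ifP => // /ltW; exact: le_trans.
  rewrite -integral_half_line// [RHS]integral_mkcond; apply: eq_integral => t _.
  rewrite patchE mem_setE in_itv/= andbT /g; case: ifP => _; first by rewrite -EFinM.
  by rewrite mul0e.
have mgN := (mean_law (phi d) N01_opp mg).2 mgm.
have := meanD mgm mgN; rewrite (_ : phi d + phi d = 2 * phi d)%R; last by ring.
congr mean; apply/funext => t; rewrite /g.
have [t0|t0] := leP 0%R t.
  rewrite ger0_norm// [X in (_ + X)%R](_ : _ = 0%R) ?addr0//.
  by rewrite ltNge (le_trans _ d0)// oppr_le0.
rewrite ltr0_norm// [X in (X + _)%R](_ : _ = 0%R) ?add0r//.
by rewrite ltNge (le_trans (ltW t0) d0).
Qed.

End half_line.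

From mathcomp Require Import measurable_realfun ring lra.

(** * Correlation of a Gaussian with the sign of a sum *)

Section sign_means.
Context {R : realType}.
Local Open Scope ereal_scope.

Definition sgn (u : R) : R := @spin R (0 <= u)%R.

Lemma sgn_norm u : (`|sgn u| = 1)%R.
Proof. by rewrite /sgn /spin; case: ifP; rewrite ?normrN1 ?normr1. Qed.

Lemma measurable_sgn : measurable_fun setT sgn.
Proof.
rewrite /sgn /spin; apply: measurable_fun_ifT => //.
exact: measurable_fun_ler.
Qed.

(** After antisymmetrising in q, the sign of u + q correlates with q only where |q| exceeds |u|; the
    inequality covers ties, where the convention sgn 0 = 1 matters. *)
Lemma sgn_antisym (u q : R) :
  ((if `|u| < `|q| then `|q| else 0) *+ 2 <= q * sgn (u + q) - q * sgn (u - q))%R.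
Proof.
rewrite /sgn /spin.
have [u0|u0] := leP 0%R u; have [q0|q0] := leP 0%R q;
rewrite ?(ger0_norm u0) ?(ltr0_norm u0) ?(ger0_norm q0) ?(ltr0_norm q0);
by case: (leP 0%R (u + q)%R) => h1; case: (leP 0%R (u - q)%R) => h2; case: ltP => h3;
rewrite ?mulr2n; lra.
Qed.

Definition negsnd (p : measurableTypeR R * measurableTypeR R) :
  measurableTypeR R * measurableTypeR R := (p.1, (- (p.2 : R))%R).

Lemma N01_pair_opp : law (N01 R \x N01 R : probability _ R) negsnd
  (N01 R \x N01 R : probability _ R).
Proof.
have mr : measurable_fun setT negsnd.
  apply: measurable_fun_pair; first exact: measurable_fst.
  exact: (measurableT_comp N01_opp.1 measurable_snd).
split=> // A mA.
pose P := [the probability _ R of distribution (N01 R \x N01 R : probability _ R) (HB.pack negsnd (isMeasurableFun.Build _ _ _ _ _ mr))].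
apply/esym; apply: (@product_measure_unique _ _ _ _ R (N01 R) (N01 R) P) => // B C mB mC.
rewrite /P /= /distribution /pushforward.
have mN : measurable ((-%R : measurableTypeR R -> measurableTypeR R) @^-1` C).
  by rewrite -[_ @^-1` _]setTI; exact: N01_opp.1.
transitivity ((N01 R \x N01 R)%E (B `*` ((-%R : measurableTypeR R -> measurableTypeR R) @^-1` C))) => //.
by rewrite product_measure1E//; congr (_ * _); exact: N01_opp.2.
Qed.

(** Symmetrising in the second variable q reduces to E|q| restricted to |q| > k|p|, which is 2
    phi(k|p|) by [mean_half_abs]. What remains is a Gaussian integral in p with exponent c +
    k^2/2. *)
Lemma mean_sign_pair (c k : R) : (0 <= c)%R -> (0 <= k)%R ->
  exists m, mean (N01 R \x N01 R : probability _ R)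
    (fun p => p.2 * (expR (- (c * p.1 ^+ 2)) * sgn (k * p.1 + p.2)))%R m /\
   (2 * (Num.sqrt (2 * pi))^-1 * (Num.sqrt (1 + 2 * c + k ^+ 2))^-1 <= m)%R.
Proof.
move=> c0 k0.
pose e (p : measurableTypeR R) : R := expR (- (c * p ^+ 2)).
have me : measurable_fun setT e by rewrite /e; mfun.
have e1 p : (0 <= e p <= 1)%R.
  by rewrite expR_ge0/= -expR0 ler_expR oppr_le0 mulr_ge0// sqr_ge0.
pose f (p : measurableTypeR R * measurableTypeR R) : R := (p.2 * (e p.1 * sgn (k * p.1 + p.2)))%R.
have mep : measurable_fun setT (fun p : measurableTypeR R * measurableTypeR R => e p.1).
  exact: (measurableT_comp me measurable_fst).
have mf : measurable_fun setT f.
  apply: measurable_funM; first by mfun.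
  apply: measurable_funM => //.
  by apply: (measurableT_comp measurable_sgn); mfun.
have [m2 [mm2 _]] := @mean_second R.
have mb : mean (N01 R \x N01 R : probability _ R) (fun p => 1 * (1 + p.2 ^+ 2))%R (1 * (1 + m2))%R.
  exact: (mean_prod (mean_cst (N01 R) 1%R) (meanD (mean_cst (N01 R) 1%R) mm2)).
have [|m [mm _]] := mean_dominated mf mb.
  move=> p; have /andP[h0 h1] := e1 p.1.
  rewrite /f !normrM sgn_norm mulr1 (ger0_norm h0) mul1r.
  have -> : (p.2 ^+ 2 = `|p.2| ^+ 2)%R by rewrite real_normK ?num_real.
  have := normr_ge0 p.2; move: (`|p.2|)%R (e p.1) h0 h1 => a b h0 h1 a0.
  by apply: (@le_trans _ _ a); nra.
exists m; split=> //.
pose h (t s : R) : R := (if (t < `|s|)%R then `|s|%R else 0%R).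
pose g (p : measurableTypeR R * measurableTypeR R) : R := (e p.1 * h (k * `|p.1|) p.2)%R.
have mg : measurable_fun setT g.
  apply: measurable_funM => //; apply: measurable_fun_ifT => //.
    apply: measurable_fun_ltr; last by apply: measurableT_comp => //; mfun.
    by apply: measurable_funM => //; apply: measurableT_comp => //; mfun.
  by apply: measurableT_comp => //; mfun.
have h0 t s : (0 <= h t s)%R by rewrite /h; case: ifP.
have mgm : mean (N01 R \x N01 R : probability _ R) g
    (2 * (Num.sqrt (2 * pi))^-1 * (Num.sqrt (1 + 2 * c + k ^+ 2))^-1)%R.
  apply: mean_ge0 => //.
    by move=> p; rewrite mulr_ge0//; have /andP[] := e1 p.1.
  rewrite fubini_tonelli1/=; last 2 first.
  - by apply/measurable_EFinP.
  - by move=> p; rewrite lee_fin mulr_ge0//; have /andP[] := e1 p.1.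
  have l12 : (- (1 / 2) < c + k ^+ 2 / 2)%R.
    by have := sqr_ge0 k; move: (k ^+ 2)%R => u; lra.
  have [_] := meanZ (2 * (Num.sqrt (2 * pi))^-1) (mean_gauss_sq l12).
  rewrite (_ : 1 + 2 * (c + k ^+ 2 / 2) = 1 + 2 * c + k ^+ 2)%R; last by field.
  move=> <-; apply: eq_integral => p _; rewrite /fubini_F /g/=.
  under eq_integral do rewrite EFinM.
  have kp : (0 <= k * `|p|)%R by rewrite mulr_ge0.
  have [hi hE] := mean_half_abs kp.
  rewrite integralZl//= hE -EFinM; congr EFin.
  have -> : expR (- ((c + k ^+ 2 / 2) * p ^+ 2)) =
      (expR (- (c * p ^+ 2)) * expR (- ((k * `|p|) ^+ 2 / 2)))%R.
    by rewrite -expRD exprMn real_normK ?num_real//; congr expR; field.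
  by rewrite phiE /e; ring.
have mN := (mean_law m N01_pair_opp mf).2 mm.
suff : (2 * (2 * (Num.sqrt (2 * pi))^-1 * (Num.sqrt (1 + 2 * c + k ^+ 2))^-1) <= m + m)%R by lra.
apply: (mean_le (meanZ 2 mgm) (meanD mm mN)) => -[p q]; rewrite /f /g /h /=.
have /andP[e0 _] := e1 p; move: (e p) e0 => E E0.
have := sgn_antisym (k * p) q; rewrite normrM (ger0_norm k0).
move: (sgn _) (sgn _) (if _ then _ else _) => s2 s1 H HE.
have : (E * (H *+ 2) <= E * (q * s1 - q * s2))%R by apply: ler_wpM2l.
by rewrite mulr2n; lra.
Qed.
End sign_means.

From mathcomp Require Import measurable_realfun ring lra.

(** * Weak law of large numbers over independent sites *)

Section lln.
Context {R : realType}.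
Local Open Scope ereal_scope.

Lemma law_pairs (I J1 J2 : finType) (h1 : J1 -> I) (h2 : J2 -> I) :
  injective h1 -> injective h2 -> (forall j1 j2, h1 j1 != h2 j2) ->
  law (gam R I) (fun g => ((fun j => g (h1 j)) : vec R J1, (fun j => g (h2 j)) : vec R J2))
    (gam R J1 \x gam R J2 : probability _ R).
Proof.
move=> h1I h2I h12.
have mX : measurable_fun setT (fun g : vec R I =>
    ((fun j => g (h1 j)) : vec R J1, (fun j => g (h2 j)) : vec R J2)).
  by apply: measurable_fun_pair; apply: measurable_vec => j; exact: measurable_coord.
split=> // A mA.
have mXA : measurable ((fun g : vec R I =>
    ((fun j => g (h1 j)) : vec R J1, (fun j => g (h2 j)) : vec R J2)) @^-1` A).
  by rewrite -[_ @^-1` _]setTI; exact: mX.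
have := law_pair h1I h2I h12 (f := fun p => (\1_A p)%:E).
have := integral_indic (gam R J1 \x gam R J2)%E measurableT mA; rewrite setIT => ->.
have := integral_indic (gam R I) measurableT mXA; rewrite setIT => <- <-//.
by apply/measurable_EFinP; exact: measurable_indic.
Qed.

Lemma law_prod_unique d d1 d2 (T : measurableType d) (T1 : measurableType d1)
    (T2 : measurableType d2) (P : probability T R) (Q1 : probability T1 R)
    (Q2 : probability T2 R) (X : T -> T1 * T2) : measurable_fun setT X ->
  (forall B C, measurable B -> measurable C -> P (X @^-1` (B `*` C)) = Q1 B * Q2 C) ->
  law P X (Q1 \x Q2 : probability _ R).
Proof.
move=> mX h; split=> // A mA.
pose D := [the probability _ R of distribution P (HB.pack X (isMeasurableFun.Build _ _ _ _ _ mX))].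
by apply/esym; exact: (@product_measure_unique _ _ _ _ R Q1 Q2 D).
Qed.

Lemma law_coord2 (I : finType) (i j : I) : i != j ->
  law (gam R I) (fun g => (g i : measurableTypeR R, g j : measurableTypeR R))
    (N01 R \x N01 R : probability _ R).
Proof.
move=> ij; apply: law_prod_unique.
  by apply: measurable_fun_pair; exact: measurable_coord.
move=> B C mB mC.
pose D k : set R := if k == i then B else if k == j then C else setT.
have := @gam_box R I D.
have -> : box D = [set g | B (g i) /\ C (g j)].
  apply/seteqP; split=> [g /= h|g /= [hi hj] k].
    by split; [have := h i|have := h j]; rewrite /D eqxx// eq_sym (negbTE ij).
  by rewrite /D; have [->|_] := eqVneq k i => //; have [->|_] := eqVneq k j.
move=> ->; last by move=> k; rewrite /D; case: ifP => // _; case: ifP.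
rewrite (bigD1 i)//= (bigD1 j)/=; last by rewrite eq_sym.
rewrite /D !eqxx eq_sym (negbTE ij) big1 ?mule1// => k /andP[/negbTE -> /negbTE ->].
exact: probability_setT.
Qed.

Section sites.
Variables (L : finType) (n : nat).

(** The array Z is indexed by layer and position; its columns, read by [site], are independent
    Gaussian vectors with one entry per layer. *)
Definition site (i : 'I_n) (Z : vec R (L * 'I_n)%type) : vec R L := fun l => Z (l, i).

Lemma law_site i : law (gam R (L * 'I_n)%type) (site i) (gam R L).
Proof. by apply: (law_inj (h := fun l => (l, i))) => l m []. Qed.

(** Distinct sites are independent, so the off-diagonal terms of the expanded square of the centred
    sum have mean zero. *)
Lemma mean_site_square (phi : vec R L -> R) m s :
  mean (gam R L) phi m -> mean (gam R L) (fun w => phi w ^+ 2)%R s ->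
  mean (gam R (L * 'I_n)%type) (fun Z => (\sum_i phi (site i Z) - n%:R * m) ^+ 2)%R
    (n%:R * (s - m ^+ 2))%R.
Proof.
move=> mphi mphi2.
have mc := meanB mphi (mean_cst _ m).
have mpsi : measurable_fun setT (fun w => phi w - m)%R by exact: mean_measurable mc.
have mc2 : mean (gam R L) (fun w => (phi w - m) ^+ 2)%R (s - m ^+ 2)%R.
  have := meanD (meanB mphi2 (meanZ (2 * m) mphi)) (mean_cst _ (m ^+ 2)%R).
  rewrite (_ : s - 2 * m * m + m ^+ 2 = s - m ^+ 2)%R; last by ring.
  by congr mean; apply/funext => w /=; ring.
have E (Z : vec R (L * 'I_n)%type) : ((\sum_i phi (site i Z) - n%:R * m) ^+ 2 =
    \sum_i \sum_j (phi (site i Z) - m) * (phi (site j Z) - m))%R.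
  under [RHS]eq_bigr do rewrite -mulr_sumr.
  rewrite -mulr_suml expr2; congr (_ * _)%R;
  by rewrite sumrB sumr_const card_ord mulr_natl.
rewrite (funext E).
rewrite (_ : n%:R * (s - m ^+ 2) = \sum_(i < n) \sum_(j < n) (if i == j then s - m ^+ 2 else 0))%R; last first.
  rewrite (eq_bigr (fun=> s - m ^+ 2)%R) => [|i _]; last first.
    rewrite (bigD1 i)//= eqxx big1 ?addr0// => j; rewrite eq_sym => /negbTE ->//.
  by rewrite sumr_const card_ord mulr_natl.
apply: mean_sum => i _; apply: mean_sum => j _.
have [<-|ij] := eqVneq i j.
  have := (mean_law _ (law_site i) (mean_measurable mc2)).2 mc2.
  by congr mean; apply/funext => Z; rewrite expr2.
have := mean_prod mc mc; rewrite subrr mulr0.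
have lij : law (gam R (L * 'I_n)%type) (fun Z => (site i Z, site j Z)) (gam R L \x gam R L : probability _ R).
  apply: (law_pairs (h1 := fun l => (l, i)) (h2 := fun l => (l, j))).
  - by move=> l k [].
  - by move=> l k [].
  - by move=> l k; apply: contra ij => /eqP[_ ->].
by move=> h; apply: (mean_law _ lij (mean_measurable h)).2.
Qed.

Lemma weak_lln (phi : vec R L -> R) m s (e : R) : (0 < n)%N -> (0 < e)%R ->
  mean (gam R L) phi m -> mean (gam R L) (fun w => phi w ^+ 2)%R s ->
  gam R (L * 'I_n)%type [set Z | e * n%:R <= `|\sum_i phi (site i Z) - n%:R * m|]%R
    <= (s / (e ^+ 2 * n%:R))%:E.
Proof.
move=> n0 e0 mphi mphi2; have n0' : (0 < n%:R :> R)%R by rewrite ltr0n.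
have h := mean_markov (mean_site_square mphi mphi2) (fun Z => sqr_ge0 _)
  (exprn_gt0 2 (mulr_gt0 e0 n0')).
have -> : [set Z | e * n%:R <= `|\sum_i phi (site i Z) - n%:R * m|]%R =
    [set Z | (e * n%:R) ^+ 2 <= (\sum_i phi (site i Z) - n%:R * m) ^+ 2]%R.
  apply/seteqP; split=> Z /=;
  by rewrite -[((\sum_i _ - _) ^+ 2)%R]real_normK ?num_real// ler_pXn2r// nnegrE mulr_ge0// ltW.
apply: (le_trans h); rewrite lee_fin exprMn [(n%:R ^+ 2)%R]expr2.
rewrite ler_pdivrMr ?mulr_gt0 ?exprn_gt0//.
rewrite (_ : s / (e ^+ 2 * n%:R) * (e ^+ 2 * (n%:R * n%:R)) = n%:R * s)%R; last first.
  by field; rewrite !gt_eqF.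
by rewrite ler_wpM2l ?ler0n// lerBlDr lerDl sqr_ge0.
Qed.
End sites.
End lln.

From mathcomp Require Import measurable_realfun ring lra.

(** * Block sums, symmetries and domination for functions of one site *)

Section site_means.
Context {R : realType}.

Definition block (I : finType) (P : pred I) (g : vec R I) : R :=
  (Num.sqrt #|P|%:R)^-1 * \sum_(i | P i) g i.

Lemma sum_block (I : finType) (P : pred I) (g : vec R I) : (0 < #|P|)%N ->
  \sum_(i | P i) g i = Num.sqrt #|P|%:R * block P g.
Proof. by move=> P0; rewrite mulVKf// gt_eqF// sqrtr_gt0 ltr0n. Qed.

Lemma block_norm (I : finType) (P : pred I) : (0 < #|P|)%N ->
  \sum_i ((Num.sqrt #|P|%:R)^-1 * (P i)%:R) ^+ 2 = 1 :> R.
Proof.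
move=> P0; under eq_bigr do rewrite exprMn exprVn sqr_sqrtr ?ler0n//.
rewrite -mulr_sumr (eq_bigr (fun i => if P i then 1 else 0)); last first.
  by move=> i _; case: (P i); rewrite ?expr1n ?expr0n.
by rewrite -big_mkcond sumr_const mulVf// pnatr_eq0 -lt0n.
Qed.

Lemma blockE (I : finType) (P : pred I) (g : vec R I) :
  block P g = \sum_i ((Num.sqrt #|P|%:R)^-1 * (P i)%:R) * g i.
Proof.
rewrite /block mulr_sumr big_mkcond; apply: eq_bigr => i _.
by case: (P i); rewrite ?mulr1// mulr0 mul0r.
Qed.

Lemma law_block (I : finType) (P : pred I) : (0 < #|P|)%N ->
  law (gam R I) (fun g => block P g : measurableTypeR R) (N01 R).
Proof.
move=> P0; rewrite (funext (blockE P)).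
exact: (law_dot (block_norm P0)).
Qed.

(** The normalised indicator vectors of two disjoint nonempty sets are orthonormal. *)
Lemma law_block2 (I : finType) (P Q : pred I) : (0 < #|P|)%N -> (0 < #|Q|)%N ->
  (forall i, P i -> ~~ Q i) ->
  law (gam R I) (fun g => (block P g : measurableTypeR R, block Q g : measurableTypeR R))
    (N01 R \x N01 R : probability _ R)%E.
Proof.
move=> P0 Q0 PQ.
pose U (i : I) (b : bool) : R := let S := if b then P else Q in (Num.sqrt #|S|%:R)^-1 * (S i)%:R.
have iso a b : \sum_i U i a * U i b = (a == b)%:R.
  have PQ0 : \sum_i U i true * U i false = 0.
    rewrite big1// => i _; rewrite /U; have [/PQ/negbTE ->|_] := boolP (P i).
      by rewrite !mulr0.
    by rewrite mulr0 mul0r.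
  case: a; case: b; rewrite ?eqxx//=.
  - by rewrite -[RHS](block_norm P0); apply: eq_bigr => i _; rewrite expr2.
  - by rewrite -[RHS]PQ0; apply: eq_bigr => i _; rewrite mulrC.
  - by rewrite -[RHS](block_norm Q0); apply: eq_bigr => i _; rewrite expr2.
have := law_comp (law_proj iso) (law_coord2 (isT : true != false)).
by congr law; apply/funext => g; rewrite /= !blockE.
Qed.

Lemma law_perm (I : finType) (h : I -> I) : injective h ->
  law (gam R I) (fun g => (fun i => g (h i)) : vec R I) (gam R I).
Proof. exact: law_inj. Qed.

Definition flip (I : finType) (k : I) (g : vec R I) : vec R I :=
  fun i => (if i == k then -1 else 1) * g i.

Lemma law_flip (I : finType) (k : I) : law (gam R I) (flip k) (gam R I).
Proof.
pose U (i a : I) : R := if i == a then (if i == k then -1 else 1) else 0.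
have iso a b : \sum_i U i a * U i b = (a == b)%:R.
  rewrite (bigD1 a)//= big1 => [|i /negbTE ia]; last by rewrite /U ia mul0r.
  rewrite /U eqxx addr0; have [->|ab] := eqVneq a b; last by rewrite mulr0.
  by case: ifP; rewrite ?mulrNN mulr1.
have := law_proj iso; congr law; apply/funext => g; apply/funext => a.
rewrite /proj (bigD1 a)//= big1 ?addr0 => [|i /negbTE ia]; last by rewrite /U ia mul0r.
by rewrite /U eqxx.
Qed.

(* An odd function of one coordinate has mean zero. *)
Lemma mean_odd (I : finType) (k : I) (f : vec R I -> R) c : mean (gam R I) f c ->
  (forall g, f (flip k g) = - f g) -> c = 0.
Proof.
move=> fc fN; have := (mean_law c (law_flip k) (mean_measurable fc)).2 fc.
rewrite (_ : (fun x => _) = (fun x => -1 * f x)); last first.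
  by apply/funext => x; rewrite fN mulN1r.
by move=> /(mean_unique (meanZ (-1) fc)); lra.
Qed.

Definition dom (I : finType) (g : vec R I) : R := 1 + \sum_i g i ^+ 2.

(** Quadratic growth suffices for a finite second moment, as fourth moments are finite. The bound s
    depends on I only, so one bound serves a whole family of functions. *)
Lemma dom_dominated (I : finType) : exists s, forall f : vec R I -> R,
  measurable_fun setT f -> (forall g, `|f g| <= dom g) ->
  exists m s', [/\ mean (gam R I) f m, mean (gam R I) (fun g => f g ^+ 2) s' & s' <= s].
Proof.
have [m4 mm4] := @mean_fourth R.
have mm4i (i : I) : mean (gam R I) (fun g => g i ^+ 4) m4.
  exact: (mean_law m4 (law_coord i) (mean_measurable mm4)).2.
pose s := (#|I|.+1%:R) * (1 + \sum_(i : I) m4).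
have md : mean (gam R I) (fun g => #|I|.+1%:R * (1 + \sum_i g i ^+ 4)) s.
  by apply: meanZ; apply: meanD; [exact: mean_cst|apply: mean_sum].
have dom2 (g : vec R I) : dom g ^+ 2 <= #|I|.+1%:R * (1 + \sum_i g i ^+ 4).
  rewrite /dom.
  have CS (J : finType) (x : J -> R) : (\sum_i x i) ^+ 2 <= #|J|%:R * \sum_i x i ^+ 2.
    have : 0 <= \sum_i \sum_j (x i - x j) ^+ 2.
      by apply: sumr_ge0 => i _; apply: sumr_ge0 => j _; exact: sqr_ge0.
    rewrite (eq_bigr (fun i => #|J|%:R * x i ^+ 2 - 2 * (\sum_j x j) * x i + \sum_j x j ^+ 2)); last first.
      move=> i _; rewrite (eq_bigr (fun j => x i ^+ 2 - (2 * x i) * x j + x j ^+ 2)).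
        rewrite big_split/= sumrB sumr_const -mulr_sumr -mulr_natl; ring.
      by move=> j _; ring.
    rewrite big_split/= sumrB -!mulr_sumr sumr_const -mulr_natl expr2; nra.
  (* Cauchy-Schwarz for the |I|+1 summands of [dom], with [None] standing for the constant 1. *)
  have := CS (option I) (fun o => if o is Some i then g i ^+ 2 else 1).
  rewrite card_option.
  have E (F : option I -> R) : \sum_o F o = F None + \sum_i F (Some i).
    by rewrite (bigD1 None)//= (reindex_omap Some id) => [|[]]//=; congr (_ + _); apply: eq_bigl => i; rewrite eqxx.
  rewrite !E expr1n; under [X in _ <= _ * (_ + X)]eq_bigr do rewrite -exprM.
  by [].
exists s => f mf fd.
have mf2 : measurable_fun setT (fun g => f g ^+ 2) by exact: measurable_funX.
have f2 g : f g ^+ 2 <= #|I|.+1%:R * (1 + \sum_i g i ^+ 4).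
  apply: le_trans (dom2 g); rewrite -[leLHS]real_normK ?num_real//.
  by rewrite ler_pXn2r// nnegrE ?(le_trans _ (fd g)).
have [|s' [ms' s's]] := mean_dominated mf2 md.
  by move=> g; rewrite ger0_norm ?sqr_ge0.
have [|m [mm _]] := mean_dominated mf (meanD (mean_cst _ 1) md).
  move=> g /=; apply: le_trans (lerD (lexx 1) (f2 g)).
  have := sqr_ge0 (`|f g| - 1/2); rewrite -[X in _ <= _ + X]real_normK ?num_real//.
  by move: `|f g| => u; nra.
by exists m, s'; split=> //; apply: le_trans (ler_norm _) s's.
Qed.
End site_means.


(** * The sign of a sum of K Gaussian layers and its increments *)

Section layers.
Context {R : realType} (K : nat).
Implicit Types (w : vec R 'I_K) (l j : 'I_K).

Definition partial (l : nat) w : R := \sum_(j < K | (j < l)%N) w j.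

(** Given the layers below l, the remaining sum is N(0, K-l). The conditional mean of the sign is
    thus a function of [partial l], and [damp] is its derivative up to a constant factor. Hence
    [fl l] is, up to scale, the first-order change of that mean when layer l is revealed. *)
Definition damp l w : R := expR (- (partial l w ^+ 2 / (2 * (K - l)%:R))).

Definition fl l w : R := w l * damp l w.

Definition xs w : R := sgn (\sum_j w j).

Lemma measurable_partial l : measurable_fun setT (partial l).
Proof.
rewrite (_ : partial l = fun w => \sum_(j < K) if (j < l)%N then w j else 0).
  by apply: measurable_sum => j; case: (j < l)%N; [exact: measurable_coord|exact: measurable_cst].
by apply/funext => w; rewrite /partial big_mkcond.
Qed.

Lemma measurable_fl l : measurable_fun setT (fl l).
Proof.
apply: measurable_funM; first by mfun.
apply: measurableT_comp => //; apply: measurableT_comp => //.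
by apply: measurable_funM => //; apply: measurable_funX; exact: measurable_partial.
Qed.

Lemma measurable_xs : measurable_fun setT xs.
Proof. by apply: (measurableT_comp measurable_sgn); mfun. Qed.

Lemma damp01 l w : 0 <= damp l w <= 1.
Proof.
rewrite expR_ge0/= -expR0 ler_expR oppr_le0 mulr_ge0 ?sqr_ge0// invr_ge0 mulr_ge0//.
Qed.

Lemma fl_le l w : `|fl l w| <= `|w l|.
Proof.
have /andP[b0 b1] := damp01 l w.
by rewrite normrM (ger0_norm b0) ler_piMr.
Qed.

Lemma dom_coord l w : `|w l| <= dom w.
Proof.
rewrite /dom (bigD1 l)//= addrA -[leLHS]addr0 lerD ?sumr_ge0// => [|i _]; last exact: sqr_ge0.
rewrite -[X in _ <= _ + X]real_normK ?num_real//; have := sqr_ge0 (`|w l| - 1/2).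
by move: `|w l| => u; nra.
Qed.

Lemma dom_coord2 l j w : `|w l| * `|w j| <= dom w.
Proof.
have wd i : `|w i| ^+ 2 <= dom w.
  rewrite real_normK ?num_real// /dom (bigD1 i)//= addrCA -[leLHS]addr0 lerD//.
  by rewrite addr_ge0// sumr_ge0// => k _; exact: sqr_ge0.
have := sqr_ge0 (`|w l| - `|w j|); have := wd l; have := wd j.
by move: `|w l| `|w j| => u v; nra.
Qed.

Definition ratio l : R := l%:R / (K - l)%:R.

Lemma ratio_gt0 l : (0 < l)%N -> 0 < ratio l.
Proof. by move=> l0; rewrite divr_gt0// ltr0n// subn_gt0. Qed.

Lemma card_below l : #|[pred j : 'I_K | (j < l)%N]| = l :> nat.
Proof.
by rewrite -sum1_card -(big_ord_widen K (fun=> 1%N) (ltnW (ltn_ord l))) sum1_card card_ord.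
Qed.

Lemma card_above l : #|[pred j : 'I_K | (l <= j)%N]| = (K - l)%N :> nat.
Proof.
have := cardC [pred j : 'I_K | (j < l)%N]; rewrite card_below card_ord.
rewrite (_ : #|[predC _]| = #|[pred j : 'I_K | (l <= j)%N]|).
  by move=> h; apply/eqP; rewrite -(eqn_add2l l) subnKC ?h// ltnW.
by apply: eq_card => j; rewrite !inE -leqNgt.
Qed.

Lemma partialE l w : (0 < l)%N ->
  partial l w = Num.sqrt l%:R * block [pred j : 'I_K | (j < l)%N] w.
Proof.
move=> l0; have := sum_block (P := [pred j : 'I_K | (j < l)%N]) w.
by rewrite card_below => <-.
Qed.

(** Layer l is independent of the block below it, so the mean is m2 times a Gaussian integral, with
    m2 the second moment bounded by 1. *)
Lemma mean_fl_sq l : (0 < l)%N -> exists b, mean (gam R 'I_K) (fun w => fl l w ^+ 2) b /\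
  0 < b <= (Num.sqrt (1 + 2 * ratio l))^-1.
Proof.
move=> l0; have [m2 [mm2 /andP[m20 m21]]] := @mean_second R.
have r0 := ratio_gt0 l0.
have l12 : - (1/2) < ratio l by lra.
have mF := mean_prod (mean_gauss_sq l12) mm2.
have c0 : (0 < #|[pred j : 'I_K | (j < l)%N]|)%N by rewrite card_below.
have c1 : (0 < #|pred1 l|)%N by rewrite card1.
have jl (j : 'I_K) : [pred j : 'I_K | (j < l)%N] j -> ~~ pred1 l j.
  by move=> /= jl; apply/eqP => e; rewrite e ltnn in jl.
have lw := law_block2 (R := R) c0 c1 jl.
exists ((Num.sqrt (1 + 2 * ratio l))^-1 * m2); split; last first.
  have s0 : 0 < (Num.sqrt (1 + 2 * ratio l))^-1 by rewrite invr_gt0 sqrtr_gt0; lra.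
  by rewrite mulr_gt0//= ler_piMr// ltW.
have := (mean_law _ lw (mean_measurable mF)).2 mF; congr mean; apply/funext => w /=.
have -> : block (pred1 l) w = w l.
  by rewrite /block big_pred1_eq card1 sqrtr1 invr1 mul1r.
rewrite /fl [RHS]exprMn mulrC; congr (_ * _).
rewrite /damp -expRM_natl mulrN partialE//; move: (block _ w) => q.
rewrite exprMn sqr_sqrtr// /ratio; congr (expR (- _)).
have Kl : (K - l)%:R != 0 :> R by rewrite pnatr_eq0 subn_eq0 -ltnNge.
by field.
Qed.

Lemma measurable_damp l : measurable_fun setT (damp l).
Proof.
apply: measurableT_comp => //; apply: measurableT_comp => //.
by apply: measurable_funM => //; apply: measurable_funX; exact: measurable_partial.
Qed.

(** By exchangeability the K-l layers from l on all have the same correlation with [damp l] times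
    the sign. Their sum and the sum below l are independent normals after scaling, and
    [mean_sign_pair] applies with c = [ratio l]/2 and k^2 = [ratio l]. *)
Lemma mean_fl_xs l : (0 < l)%N -> exists a, mean (gam R 'I_K) (fun w => fl l w * xs w) a /\
  2 * (Num.sqrt (2 * pi))^-1 * (Num.sqrt (1 + 2 * ratio l))^-1 / Num.sqrt (K - l)%:R <= a.
Proof.
move=> l0; have r0 := ratio_gt0 l0.
have Kl : 0 < (K - l)%:R :> R by rewrite ltr0n subn_gt0.
have c0 : (0 < #|[pred j : 'I_K | (j < l)%N]|)%N by rewrite card_below.
have c1 : (0 < #|[pred j : 'I_K | (l <= j)%N]|)%N by rewrite card_above subn_gt0.
have jl (j : 'I_K) : [pred j : 'I_K | (j < l)%N] j -> ~~ [pred j : 'I_K | (l <= j)%N] j.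
  by rewrite /= -ltnNge.
have lw := law_block2 (R := R) c0 c1 jl.
have mxs := measurable_xs; have mb := measurable_damp l.
pose h w := damp l w * xs w.
have mh : measurable_fun setT h by exact: measurable_funM.
have [s sP] := @dom_dominated R 'I_K.
have h1 w : `|h w| <= 1.
  have /andP[b0 b1] := damp01 l w.
  by rewrite normrM sgn_norm mulr1 ger0_norm.
have [||a [_ [ma _ _]]] := sP (fun w => w l * h w).
- by apply: measurable_funM => //; mfun.
- move=> w; rewrite normrM; apply: le_trans (dom_coord l w).
  by rewrite ler_piMr.
(* Swapping layers l and j preserves the law, the total sum, and the partial sum below l, which
   contains neither. *)
have maj j : (l <= j)%N -> mean (gam R 'I_K) (fun w => w j * h w) a.
  move=> lj; pose t := tperm l j.
  have := (mean_law a (law_perm (@perm_inj _ t)) (mean_measurable ma)).2 ma.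
  congr mean; apply/funext => w; rewrite tpermL; congr (_ * _).
  have pE : partial l (fun j => w (t j)) = partial l w.
    apply: eq_bigr => i il; rewrite tpermD//.
      by apply/eqP => e; rewrite e ltnn in il.
    by apply/eqP => e; rewrite -e ltnNge lj in il.
  have sE : \sum_j w (t j) = \sum_j w j by rewrite [RHS](reindex_inj (@perm_inj _ t)).
  by rewrite /h /damp /xs pE sE.
have mS : mean (gam R 'I_K) (fun w => \sum_(j < K | (l <= j)%N) w j * h w) ((K - l)%:R * a).
  have := @mean_sum R _ _ (gam R 'I_K) _ (index_enum 'I_K) (fun j => (l <= j)%N) (fun j w => w j * h w) (fun=> a) (fun j lj => maj j lj).
  by rewrite sumr_const card_above mulr_natl.
exists a; split; first by move: ma; congr mean; apply/funext => w; rewrite /h mulrA.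
pose k : R := Num.sqrt (ratio l).
have k2 : k ^+ 2 = ratio l by rewrite sqr_sqrtr// ltW.
have [m [mm ml]] := mean_sign_pair (divr_ge0 (ltW r0) (ler0n R 2)) (sqrtr_ge0 (ratio l)).
have sKl : 0 < Num.sqrt (K - l)%:R :> R by rewrite sqrtr_gt0.
have sKl2 : Num.sqrt (K - l)%:R ^+ 2 = (K - l)%:R :> R by rewrite sqr_sqrtr// ltW.
have mm' : mean (gam R 'I_K) (fun w => \sum_(j < K | (l <= j)%N) w j * h w) (Num.sqrt (K - l)%:R * m).
  have := meanZ (Num.sqrt (K - l)%:R) ((mean_law _ lw (mean_measurable mm)).2 mm).
  congr mean; apply/funext => w /=.
  have hd : damp l w = expR (- (ratio l / 2 * block [pred j : 'I_K | (j < l)%N] w ^+ 2)).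
    rewrite /damp partialE//; move: (block _ w) => q.
    by rewrite exprMn sqr_sqrtr// /ratio; congr (expR (- _)); field; rewrite gt_eqF.
  have hx : xs w = sgn (k * block [pred j : 'I_K | (j < l)%N] w + block [pred j : 'I_K | (l <= j)%N] w).
    rewrite /xs.
    have -> : \sum_j w j = Num.sqrt (K - l)%:R * (k * block [pred j : 'I_K | (j < l)%N] w
        + block [pred j : 'I_K | (l <= j)%N] w).
      have sk : Num.sqrt (K - l)%:R * k = Num.sqrt l%:R.
        by rewrite /k -sqrtrM ?ler0n// /ratio mulrCA divff ?mulr1// gt_eqF.
      rewrite mulrDr mulrA sk.
      have := sum_block w c0; rewrite card_below => <-.
      have := sum_block w c1; rewrite card_above => <-.
      rewrite (bigID (fun j : 'I_K => (j < l)%N))/=; congr (_ + _).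
      by apply: eq_bigl => j; rewrite -leqNgt.
    by rewrite /sgn pmulr_rge0.
  rewrite -mulr_suml; have := sum_block w c1; rewrite card_above => ->.
  by rewrite /h hd hx /k mulrA.
have e := mean_unique mS mm'.
have -> : a = m / Num.sqrt (K - l)%:R.
  by apply: (mulfI (lt0r_neq0 Kl)); rewrite e -{2}sKl2; field; rewrite gt_eqF.
rewrite ler_pM2r ?invr_gt0//; apply: le_trans ml.
by rewrite sqr_sqrtr ?(ltW r0)// (_ : 1 + 2 * ratio l = 1 + 2 * (ratio l / 2) + ratio l)//; field.
Qed.

(** By symmetry K times the mean equals the expected absolute value of the sum of all layers. *)
Lemma mean_coord_xs l : exists a, mean (gam R 'I_K) (fun w => w l * xs w) a /\
  2 * (Num.sqrt (2 * pi))^-1 / Num.sqrt K%:R <= a.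
Proof.
have K0 : (0 < K)%N by apply: leq_trans (ltn_ord l).
have cT : #|predT : pred 'I_K| = K by rewrite cardT size_enum_ord.
have cT0 : (0 < #|predT : pred 'I_K|)%N by rewrite cT.
have lw := law_block (R := R) cT0.
have [s sP] := @dom_dominated R 'I_K.
have mxs := measurable_xs.
have [||a [_ [ma _ _]]] := sP (fun w => w l * xs w).
- by apply: measurable_funM => //; mfun.
- by move=> w; rewrite normrM sgn_norm mulr1 dom_coord.
have maj j : mean (gam R 'I_K) (fun w => w j * xs w) a.
  pose t := tperm l j.
  have := (mean_law a (law_perm (@perm_inj _ t)) (mean_measurable ma)).2 ma.
  congr mean; apply/funext => w; rewrite tpermL.
  by rewrite /xs [in RHS](reindex_inj (@perm_inj _ t)).
have mS : mean (gam R 'I_K) (fun w => \sum_j w j * xs w) (K%:R * a).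
  have := @mean_sum R _ _ (gam R 'I_K) _ (index_enum 'I_K) predT (fun j w => w j * xs w) (fun=> a) (fun j _ => maj j).
  by rewrite sumr_const cT mulr_natl.
exists a; split=> //.
have sK : 0 < Num.sqrt K%:R :> R by rewrite sqrtr_gt0 ltr0n.
have sK2 : Num.sqrt K%:R ^+ 2 = K%:R :> R by rewrite sqr_sqrtr ?ler0n.
have mh := mean_half_abs (lexx (0 : R)).
have mm' : mean (gam R 'I_K) (fun w => \sum_j w j * xs w) (Num.sqrt K%:R * (2 * phi 0)).
  have := meanZ (Num.sqrt K%:R) ((mean_law _ lw (mean_measurable mh)).2 mh).
  congr mean; apply/funext => w /=.
  have := sum_block w cT0; rewrite cT /= => sE.
  rewrite -mulr_suml /xs sE -mulrA; congr (_ * _).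
  rewrite /sgn /spin pmulr_rge0//; move: (block _ w) => q.
  have [q0|q0] := leP 0 q; first by rewrite ger0_norm// mulr1; case: ltP => // q0'; apply/eqP; rewrite eq_le q0 q0'.
  by rewrite ltr0_norm// oppr_gt0 q0 mulrN1.
have e := mean_unique mS mm'.
have -> : a = 2 * phi 0 / Num.sqrt K%:R.
  by apply: (mulfI (lt0r_neq0 (_ : 0 < K%:R :> R))); rewrite ?ltr0n// e -{2}sK2; field; rewrite gt_eqF.
rewrite ler_pM2r ?invr_gt0// phiE expr0n /= mul0r oppr0 expR0 mulr1//.
Qed.

(** [fl j] and [damp l] depend only on layers below l, so the product is odd in layer l. *)
Lemma mean_fl_fl j l : (j < l)%N -> mean (gam R 'I_K) (fun w => fl j w * fl l w) 0.
Proof.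
move=> jl; have [s sP] := @dom_dominated R 'I_K.
have [||a [_ [ma _ _]]] := sP (fun w => fl j w * fl l w).
- by apply: measurable_funM; exact: measurable_fl.
- by move=> w; rewrite normrM; apply: le_trans (dom_coord2 j l w); rewrite ler_pM// fl_le.
suff <- : a = 0 by [].
apply: (mean_odd (k := l) ma) => w.
have pf (i : 'I_K) : (i <= l)%N -> partial i (flip l w) = partial i w.
  move=> il; apply: eq_bigr => k ki; rewrite /flip (_ : k == l = false) ?mul1r//.
  by apply/eqP => e; rewrite e ltnNge il in ki.
rewrite /fl /damp !pf// ?(ltnW jl)// /flip eqxx (_ : j == l = false); last first.
  by apply/eqP => e; rewrite e ltnn in jl.
ring.
Qed.

Lemma mean_coord_fl j l : (j < l)%N -> mean (gam R 'I_K) (fun w => w l * fl j w) 0.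
Proof.
move=> jl; have [s sP] := @dom_dominated R 'I_K.
have [||a [_ [ma _ _]]] := sP (fun w => w l * fl j w).
- by apply: measurable_funM; [mfun|exact: measurable_fl].
- by move=> w; rewrite normrM; apply: le_trans (dom_coord2 l j w); rewrite ler_pM// fl_le.
suff <- : a = 0 by [].
apply: (mean_odd (k := l) ma) => w.
have pf (i : 'I_K) : (i <= l)%N -> partial i (flip l w) = partial i w.
  move=> il; apply: eq_bigr => k ki; rewrite /flip (_ : k == l = false) ?mul1r//.
  by apply/eqP => e; rewrite e ltnNge il in ki.
rewrite /fl /damp !pf// ?(ltnW jl)// /flip eqxx (_ : j == l = false); last first.
  by apply/eqP => e; rewrite e ltnn in jl.
ring.
Qed.

End layers.


(** * Iterated exposure of the matrix along directions built from the layers *)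

Section iteration.
Context {R : realType} (n k : nat).
Local Notation K := k.+2.
Local Notation Zs := (vec R ('I_K * 'I_n)%type).
Local Notation Gs := (vec R ('I_n * 'I_n)%type).
Implicit Types (Z : Zs) (G : Gs) (l : 'I_K).

Definition lay l Z : vec R 'I_n := fun i => Z (l, i).

Definition dir l Z : 'I_n -> R := fun i => fl l (site i Z).

Definition udir l Z : 'I_n -> R := fun i => (Num.sqrt (dot (dir l Z) (dir l Z)))^-1 * dir l Z i.

(** Direction m is built from layers up to m and is answered by layer m+1. Directions run from 1 to
    k and answers from 2 to k+1, whence K = k+2. The highest direction is treated first, so that the
    remaining steps never see the layer just consumed. *)
Fixpoint expose (m : nat) Z G : Gs :=
  if m is m'.+1 then
    expose m' Z (resample (V (udir (inord m) Z)) (G, lay (inord m.+1) Z))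
  else G.

Lemma dot_ge0 (x : 'I_n -> R) : 0 <= dot x x.
Proof. by apply: sumr_ge0 => i _; rewrite -expr2 sqr_ge0. Qed.

Lemma udir_unit l Z : dot (udir l Z) (udir l Z) = 1 \/ udir l Z = (fun=> 0).
Proof.
have [d0|d0] := eqVneq (dot (dir l Z) (dir l Z)) 0.
  by right; apply/funext => i; rewrite /udir d0 sqrtr0 invr0 mul0r.
left; have d_gt0 : 0 < dot (dir l Z) (dir l Z) by rewrite lt_neqAle eq_sym d0 dot_ge0.
rewrite {1}/dot (eq_bigr (fun i => (Num.sqrt (dot (dir l Z) (dir l Z)))^-1 ^+ 2 * (dir l Z i * dir l Z i))).
  by rewrite -mulr_sumr -/(dot _ _) exprVn sqr_sqrtr ?dot_ge0// mulVf.
by move=> i _; rewrite /udir; ring.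
Qed.

Definition agree (l : nat) Z Z' := forall (j : 'I_K) i, (j <= l)%N -> Z (j, i) = Z' (j, i).

Lemma agree_le (p q : nat) Z Z' : (p <= q)%N -> agree q Z Z' -> agree p Z Z'.
Proof. by move=> lm h j i jl; apply: h; exact: leq_trans jl lm. Qed.

Lemma udir_agree l Z Z' : agree l Z Z' -> udir l Z = udir l Z'.
Proof.
move=> h; have dE : dir l Z = dir l Z'.
  apply/funext => i.
  have pE : partial l (site i Z) = partial l (site i Z').
    by apply: eq_bigr => j jl; rewrite /site h// ltnW.
  by rewrite /dir /fl /damp pE /site h.
by rewrite /udir dE.
Qed.

Lemma expose_agree m Z Z' G : (m <= k)%N -> agree m.+1 Z Z' -> expose m Z G = expose m Z' G.
Proof.
elim: m G => [//|m IH] G mk h /=.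
rewrite (udir_agree (Z' := Z')); last first.
  by apply: agree_le h; rewrite inordK// !ltnS ltnW.
have -> : lay (inord m.+2) Z = lay (inord m.+2) Z'.
  by apply/funext => i; apply: h; rewrite inordK// !ltnS.
by apply: IH; [exact: ltnW|exact: (agree_le (leqnSn _) h)].
Qed.

Lemma measurable_dir l i : measurable_fun setT (fun Z => dir l Z i).
Proof.
have [ms _] := @law_site R 'I_K n i.
exact: (measurableT_comp (measurable_fl l) ms).
Qed.

Lemma measurable_udir l i : measurable_fun setT (fun Z => udir l Z i).
Proof.
apply: measurable_funM; last exact: measurable_dir.
(* The inverse square root is rewritten as the power -1/2, which is measurable and agrees with it at
   zero. *)
rewrite (_ : (fun Z => _) = (fun Z => dot (dir l Z) (dir l Z) `^ (- 2^-1))); last first.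
  by apply/funext => Z; rewrite powRN powR12_sqrt// dot_ge0.
apply: (measurableT_comp (measurable_powR (- 2^-1))).
by apply: measurable_sum => j; apply: measurable_funM; exact: measurable_dir.
Qed.

Lemma measurable_V l p a : measurable_fun setT (fun Z => V (udir l Z) p a).
Proof.
have h i := measurable_udir l i.
rewrite /V; apply: measurableT_comp => //; apply: measurable_funD.
  apply: measurable_funM; first exact: measurable_cst.
  apply: measurable_funD; apply: measurable_funM => //;
  by apply: measurable_funB; [exact: measurable_cst|apply: measurable_funM].
by apply: measurable_funM => //; apply: measurable_funM.
Qed.

Lemma measurable_expose m :
  measurable_fun setT (fun p : Zs * Gs => expose m p.1 p.2).
Proof.
elim: m => [|m IH] /=; first exact: measurable_snd.
pose f (p : Zs * Gs) : Zs * Gs :=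
  (p.1, resample (V (udir (inord m.+1) p.1)) (p.2, lay (inord m.+2) p.1)).
suff mf : measurable_fun setT f by exact: (measurableT_comp IH mf).
apply: measurable_fun_pair; first exact: measurable_fst.
have mV p a : measurable_fun setT (fun q : Zs * Gs => V (udir (inord m.+1) q.1) p a).
  exact: (measurableT_comp (measurable_V _ p a) measurable_fst).
apply: measurable_vec => p; apply: measurable_funD; first apply: measurable_funB.
- by mfun.
- apply: measurable_sum => a; apply: measurable_funM => //.
  by apply: measurable_sum => q; apply: measurable_funM => //; mfun.
- apply: measurable_sum => a; apply: measurable_funM => //.
  by rewrite /lay /=; mfun.
Qed.

Definition upd l (p : Zs * vec R 'I_n) : Zs := fun q => if q.1 == l then p.2 q.2 else p.1 q.

(** Replacing one layer by an independent copy is resampling along the coordinate vectors of that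
    layer. *)
Lemma law_upd l : law (gam R ('I_K * 'I_n)%type \x gam R 'I_n : probability _ R)%E
  (upd l) (gam R ('I_K * 'I_n)%type).
Proof.
pose U (q : 'I_K * 'I_n) (a : 'I_n) : R := ((q.1 == l) && (q.2 == a))%:R.
have iso a b : \sum_q U q a * U q b = (a == b)%:R.
  rewrite (bigD1 (l, a))//= big1 => [|[j i] /= ne]; last first.
    rewrite /U /=; case: eqVneq => [jl|_] /=; last by rewrite mul0r.
    by case: eqVneq => [ia|_]; rewrite ?mul0r//; rewrite jl ia eqxx in ne.
  by rewrite /U /= !eqxx mul1r addr0.
have projE Z : proj U Z = lay l Z.
  apply/funext => a; rewrite /proj (bigD1 (l, a))//= big1 => [|[j i] /= ne]; last first.
    rewrite /U /=; case: eqVneq => [jl|_] /=; last by rewrite mul0r.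
    by case: eqVneq => [ia|_]; rewrite ?mul0r//; rewrite jl ia eqxx in ne.
  by rewrite /U /= !eqxx mul1r addr0.
have injE z (q : 'I_K * 'I_n) : inj U z q = if q.1 == l then z q.2 else 0.
  rewrite /inj (bigD1 q.2)//= big1 => [|a ne]; last first.
    by rewrite /U [q.2 == _]eq_sym (negbTE ne) andbF mul0r.
  by rewrite /U eqxx andbT addr0; case: eqP; rewrite ?mul1r ?mul0r.
have := law_resample iso; congr law; apply/funext => -[Z z]; apply/funext => -[j i].
rewrite /resample /upd /= projE !injE /=; case: eqVneq => [->|_].
  by rewrite /lay subrr add0r.
by rewrite subr0 addr0.
Qed.

Lemma upd_agree l Z z (m : nat) : (m < l)%N -> agree m (upd l (Z, z)) Z.
Proof.
move=> ml j i jm; rewrite /upd /=; case: eqP => // jl.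
by move: ml; rewrite -jl ltnNge jm.
Qed.

Local Open Scope ereal_scope.

(** Induction on m. Replace layer m+2 by an independent copy; direction m+1 and the m remaining
    steps do not depend on it. With Z fixed it is therefore a fresh Gaussian vector, and
    [law_exposure] removes one step. *)
Lemma integral_expose m (F : Gs -> \bar R) : (m <= k)%N ->
  measurable_fun setT F -> (forall G, 0 <= F G) ->
  \int[gam R ('I_K * 'I_n)%type]_Z \int[gam R ('I_n * 'I_n)%type]_G F (expose m Z G) =
  \int[gam R ('I_n * 'I_n)%type]_G F G.
Proof.
move=> + mF F0; elim: m => [_|m IH mk].
  rewrite -[RHS]mule1 -(@probability_setT _ _ _ (gam R ('I_K * 'I_n)%type)).
  by rewrite -integral_cst.
rewrite -IH; last exact: ltnW.
have mFe j : measurable_fun setT (fun p : Zs * Gs => F (expose j p.1 p.2)).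
  exact: (measurableT_comp mF (measurable_expose j)).
pose H Z := \int[gam R ('I_n * 'I_n)%type]_G F (expose m.+1 Z G).
have mH : measurable_fun setT H.
  by apply: (measurable_fun_fubini_tonelli_F (m2 := gam R ('I_n * 'I_n)%type) _ (mFe m.+1)).
have H0 Z : 0 <= H Z by apply: integral_ge0.
rewrite -/(H _) (law_ge0 (law_upd (inord m.+2)) mH H0).
rewrite fubini_tonelli1/=; last 2 first.
- exact: (measurableT_comp mH (law_upd _).1).
- by move=> p; exact: H0.
apply: eq_integral => Z _; rewrite /fubini_F.
have m2 : nat_of_ord (inord m.+2 : 'I_K) = m.+2 by rewrite inordK// !ltnS.
have m1 : nat_of_ord (inord m.+1 : 'I_K) = m.+1 by rewrite inordK// !ltnS ltnW// ltnW.
have lE := law_exposure (udir_unit (inord m.+1) Z).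
have mFZ : measurable_fun setT (fun G : Gs => F (expose m Z G)).
  exact: (measurableT_comp (mFe m) (measurable_pair1 Z)).
rewrite (law_ge0 lE mFZ)//.
rewrite fubini_tonelli2; last 2 first.
- exact: (measurableT_comp mFZ lE.1).
- by move=> p; exact: F0.
apply: eq_integral => z _; rewrite /H /fubini_G; apply: eq_integral => G _ /=.
have ag : agree m.+1 (upd (inord m.+2) (Z, z)) Z by apply: upd_agree; rewrite m2.
rewrite (udir_agree (Z' := Z)); last by rewrite m1.
rewrite (expose_agree _ _ ag); last exact: ltnW.
congr (F (expose m Z (resample _ (G, _)))).
by apply/funext => i; rewrite /lay /upd /= eqxx.
Qed.

Lemma law_expose m : (m <= k)%N ->
  law (gam R ('I_K * 'I_n)%type \x gam R ('I_n * 'I_n)%type : probability _ R)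
    (fun p : Zs * Gs => expose m p.1 p.2) (gam R ('I_n * 'I_n)%type).
Proof.
move=> mk; have me := measurable_expose m; split=> // B mB.
have meB : measurable ((fun p : Zs * Gs => expose m p.1 p.2) @^-1` B).
  by rewrite -[_ @^-1` _]setTI; exact: me.
have mBi : measurable_fun setT (fun G : Gs => (\1_B G)%:E : \bar R).
  by apply/measurable_EFinP; exact: measurable_indic.
have /(_ _)/= := @integral_expose m (fun G => (\1_B G)%:E) mk mBi; move=> /(_ (fun G => _)).
have := integral_indic (gam R ('I_n * 'I_n)%type) measurableT mB; rewrite setIT => -> h.
have := integral_indic (gam R ('I_K * 'I_n)%type \x gam R ('I_n * 'I_n)%type)%E measurableT meB; rewrite setIT => <-.
rewrite fubini_tonelli1/=; last 2 first.
- by apply/measurable_EFinP; exact: measurable_indic.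
- by move=> p; rewrite lee_fin.
by rewrite -h.
Qed.

End iteration.

(** * Deterministic energy accounting for the exposed matrix *)

Section energy.
Context {R : realType} {n : nat}.
Implicit Types (x y u : 'I_n -> R) (v z : nat -> 'I_n -> R) (G : vec R ('I_n * 'I_n)%type).

Fixpoint reject v x (m : nat) : 'I_n -> R :=
  if m is m'.+1 then rej (v m') (reject v x m') else x.

(** The energy removed at step i according to [quad_resample], evaluated at the vector left after
    the directions of smaller index have been rejected. *)
Definition gain v z x (i : nat) : R :=
  dot (v i) (reject v x i) * dot (rej (v i) (z i)) (reject v x i)
  + rsq2 * dot (v i) (z i) * dot (v i) (reject v x i) ^+ 2.

Lemma dot_rej u x y : dot u (rej x y) = dot u y - dot x y * dot u x.
Proof.
have -> : rej x y = (fun i => 1 * y i + (- dot x y) * x i).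
  by apply/funext => i; rewrite /rej; ring.
by rewrite dot_lin; ring.
Qed.

Lemma dot0 u : dot u (fun=> 0) = 0.
Proof. by rewrite /dot big1// => i _; rewrite mulr0. Qed.

Lemma rej_norm x y : dot x x = 1 \/ x = (fun=> 0) ->
  dot (rej x y) (rej x y) = dot y y - dot x y ^+ 2.
Proof.
rewrite dot_rej [dot (rej x y) y]dotC dot_rej [dot (rej x y) x]dotC dot_rej (dotC y x).
case=> [->|->]; first by ring.
by rewrite !(dotC (fun=> 0)) !dot0; ring.
Qed.

Section bounds.
Variables (m : nat) (v z : nat -> 'I_n -> R) (x : 'I_n -> R) (s e b : R) (a : nat -> R).
Hypothesis s0 : 0 < s.
Hypothesis e0 : 0 <= e.
Hypothesis xx : dot x x = s ^+ 2.
Hypothesis v1 : forall i, (i < m)%N -> dot (v i) (v i) = 1 \/ v i = (fun=> 0).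
Hypothesis vx : forall i, (i < m)%N -> (a i - e) * s <= dot (v i) x.
Hypothesis zx : forall i, (i < m)%N -> (b - e) * s ^+ 2 <= dot (z i) x.
Hypothesis vv : forall i j, (j < i)%N -> (i < m)%N -> `|dot (v i) (v j)| <= e.
Hypothesis zv : forall i j, (j <= i)%N -> (i < m)%N -> `|dot (z i) (v j)| <= e * s.
Hypothesis da : forall i, (i < m)%N -> m.+1%:R * e <= a i.
Hypothesis db : m.+1%:R * e <= b.

Lemma reject_norm i : (i <= m)%N -> dot (reject v x i) (reject v x i) <= s ^+ 2.
Proof.
elim: i => [_|i IH im] /=; first by rewrite xx.
by rewrite rej_norm; [rewrite lerBlDr (le_trans (IH (ltnW im)))// lerDl sqr_ge0|exact: v1].
Qed.

Lemma coef_le i : (i < m)%N -> `|dot (v i) (reject v x i)| <= s.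
Proof.
move=> im; rewrite -(@ler_pXn2r _ 2)// ?nnegrE ?(ltW s0)// real_normK ?num_real//.
apply: le_trans (reject_norm (ltnW im)).
by rewrite -subr_ge0 -rej_norm ?dot_ge0//; exact: v1.
Qed.

Lemma dot_reject u i : dot u (reject v x i) =
  dot u x - \sum_(j < i) dot (v j) (reject v x j) * dot u (v j).
Proof.
elim: i => [|i IH] /=; first by rewrite big_ord0 subr0.
by rewrite dot_rej IH big_ord_recr/=; ring.
Qed.

Lemma dot_reject_ge u i t : (i <= m)%N -> 0 <= t ->
  (forall j, (j < i)%N -> `|dot u (v j)| <= t) ->
  dot u x - m%:R * (s * t) <= dot u (reject v x i).
Proof.
move=> im t0 ut; rewrite dot_reject lerB//.
apply: (@le_trans _ _ (\sum_(j < i) s * t)).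
  apply: ler_sum => j _; apply: le_trans (ler_norm _) _; rewrite normrM ler_pM//.
    by apply: coef_le; exact: leq_trans (ltn_ord j) im.
  exact: ut.
rewrite sumr_const card_ord -[leLHS]mulr_natl ler_wpM2r ?mulr_ge0 ?(ltW s0)//.
by rewrite ler_nat.
Qed.

(** Here s stands for sqrt n, [a i] and b for normalised overlaps, and e for a tolerance. Near
    orthogonality of the directions lets x replace its rejections, at cost e per direction plus e
    for the overlap itself, hence the factor m+1. The last e pays for the overlap of z_i with
    v_i. *)
Lemma gain_ge i : (i < m)%N ->
  s ^+ 3 * ((a i - m.+1%:R * e) * (b - m.+1%:R * e) - e) <= gain v z x i.
Proof.
move=> im.
have h1 : (a i - m.+1%:R * e) * s <= dot (v i) (reject v x i).
  apply: le_trans (dot_reject_ge (ltnW im) e0 _); last by move=> j ji; exact: vv.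
  by apply: le_trans (lerB (vx im) (lexx _)); rewrite -natr1; lra.
have h2 : (b - m.+1%:R * e) * s ^+ 2 <= dot (z i) (reject v x i).
  apply: le_trans (dot_reject_ge (ltnW im) (mulr_ge0 e0 (ltW s0)) _); last first.
    by move=> j ji; apply: zv => //; exact: ltnW.
  by apply: le_trans (lerB (zx im) (lexx _)); rewrite -natr1; lra.
have h3 := coef_le im.
have h4 : `|dot (z i) (v i)| <= e * s by exact: zv.
have -> : gain v z x i = dot (v i) (reject v x i) * dot (z i) (reject v x i)
    - dot (z i) (v i) * dot (v i) (reject v x i) ^+ 2 * (1 - rsq2).
  rewrite /gain [dot (rej _ _) _]dotC dot_rej !(dotC (reject v x i)) (dotC (v i) (z i)).
  by ring.
set c := dot (v i) (reject v x i) in h1 h3 *.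
set d := dot (z i) (reject v x i) in h2 *.
set w := dot (z i) (v i) in h4 *.
have r01 : 0 <= (rsq2 : R) <= 1.
  rewrite invr_ge0 sqrtr_ge0/= invf_le1 ?sqrtr_gt0//.
  by rewrite -[leLHS]sqrtr1 ler_sqrt// ler1n.
have /andP[r0 r1] := r01.
have h5 : `|w * c ^+ 2 * (1 - rsq2)| <= e * s ^+ 3.
  rewrite normrM [`|w * _|]normrM normrX (ger0_norm (_ : 0 <= 1 - rsq2)) ?subr_ge0//.
  have c2 : `|c| ^+ 2 <= s ^+ 2 by rewrite ler_pXn2r// nnegrE ltW.
  rewrite -[leRHS]mulr1 ler_pM ?mulr_ge0 ?exprn_ge0 ?subr_ge0//; last by rewrite lerBlDr lerDl.
  by rewrite (_ : e * s ^+ 3 = e * s * s ^+ 2) ?ler_pM ?exprn_ge0//; ring.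
have h6 : s ^+ 3 * ((a i - m.+1%:R * e) * (b - m.+1%:R * e)) <= c * d.
  rewrite (_ : s ^+ 3 * _ = ((a i - m.+1%:R * e) * s) * ((b - m.+1%:R * e) * s ^+ 2)); last by ring.
  by rewrite ler_pM// ?mulr_ge0 ?subr_ge0 ?db ?da ?exprn_ge0 ?(ltW s0).
have := le_trans (ler_norm _) h5.
by move=> h7; rewrite mulrBr; lra.
Qed.

Lemma sum_gain_ge : s ^+ 3 * \sum_(i < m) ((a i - m.+1%:R * e) * (b - m.+1%:R * e) - e) <=
  \sum_(i < m) gain v z x i.
Proof. by rewrite mulr_sumr; apply: ler_sum => i _; exact: gain_ge. Qed.
End bounds.

End energy.

Section energy_expose.
Context {R : realType} (n k : nat).

Definition vdir (Z : vec R ('I_k.+2 * 'I_n)%type) (m : nat) : 'I_n -> R := udir (inord m.+1) Z.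

Definition vlay (Z : vec R ('I_k.+2 * 'I_n)%type) (m : nat) : 'I_n -> R := lay (inord m.+2) Z.

(** One application of [quad_resample] per step: what is left of G acts on the vector with all
    directions rejected. *)
Lemma quad_expose m Z G (x : 'I_n -> R) : quad (expose m Z G) x =
  quad G (reject (vdir Z) x m) - \sum_(i < m) gain (vdir Z) (vlay Z) x i.
Proof.
elim: m G => [|m IH] G /=; first by rewrite big_ord0 subr0.
by rewrite IH quad_resample ?big_ord_recr/= /gain; [rewrite /vdir/vlay; ring|exact: udir_unit].
Qed.
End energy_expose.

(** * Chebyshev bounds and simultaneous laws of large numbers *)

Section whp.
Context {R : realType}.

Lemma mean_linear_sq (I : finType) (w : I -> R) :
  exists c, mean (gam R I) (fun g => (\sum_i w i * g i) ^+ 2) c /\ c <= \sum_i w i ^+ 2.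
Proof.
have [m2 [mm2 /andP[m20 m21]]] := @mean_second R.
have S0 : 0 <= \sum_i w i ^+ 2 by apply: sumr_ge0 => i _; exact: sqr_ge0.
have [S00|Sne] := eqVneq (\sum_i w i ^+ 2) 0.
  exists 0; rewrite S00; split=> //.
  have w0 i : w i = 0.
    move/psumr_eq0P : S00 => /(_ (fun i _ => sqr_ge0 (w i)) i isT) /eqP.
    by rewrite sqrf_eq0 => /eqP.
  have := mean_cst (gam R I) 0; congr mean; apply/funext => g.
  by rewrite big1 ?expr0n// => i _; rewrite w0 mul0r.
set S := \sum_i _ in S0 Sne *.
have S_gt0 : 0 < S by rewrite lt_neqAle eq_sym Sne.
have sS0 : 0 < Num.sqrt S by rewrite sqrtr_gt0.
have sS2 : Num.sqrt S ^+ 2 = S by rewrite sqr_sqrtr.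
have w1 : \sum_i ((Num.sqrt S)^-1 * w i) ^+ 2 = 1.
  under eq_bigr do rewrite exprMn.
  by rewrite -mulr_sumr -/S exprVn sS2 mulVf.
exists (S * m2); split; last by rewrite ler_piMr.
have := meanZ S ((mean_law m2 (law_dot w1) (mean_measurable mm2)).2 mm2).
congr mean; apply/funext => g /=.
under [in LHS]eq_bigr do rewrite -mulrA.
by rewrite -mulr_sumr exprMn exprVn sS2 mulrA divff// mul1r.
Qed.

(** For fixed y the form is linear in G with squared coefficients summing to |y|^4/2; the tail bound
    is Chebyshev's inequality. *)
Lemma quad_tail n (y : 'I_n -> R) (t : R) : 0 < t ->
  (gam R ('I_n * 'I_n)%type [set G | (t <= `|quad G y|)%R] <= (dot y y ^+ 2 / t ^+ 2)%:E)%E.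
Proof.
move=> t0; have [c [mc cS]] := mean_linear_sq (fun p : 'I_n * 'I_n => rsq2 * (y p.1 * y p.2)).
have -> : [set G | (t <= `|quad G y|)%R] =
    [set G : vec R ('I_n * 'I_n)%type | (t ^+ 2 <= (\sum_p rsq2 * (y p.1 * y p.2) * G p) ^+ 2)%R].
  have qE (G : vec R ('I_n * 'I_n)%type) : \sum_p rsq2 * (y p.1 * y p.2) * G p = quad G y.
    by rewrite /quad /bil mulr_sumr; apply: eq_bigr => p _; ring.
  apply/seteqP; split=> G /=; rewrite qE -[(quad G y ^+ 2)]real_normK ?num_real// ler_pXn2r//;
  by rewrite nnegrE ltW.
apply: le_trans (mean_markov mc (fun G => sqr_ge0 _) (exprn_gt0 2 t0)) _.
rewrite lee_fin ler_pM2r ?invr_gt0 ?exprn_gt0//; apply: le_trans cS _.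
under eq_bigr do rewrite exprMn.
rewrite -mulr_sumr expr2 rsq2_sqr.
have -> : \sum_(p : 'I_n * 'I_n) (y p.1 * y p.2) ^+ 2 = dot y y ^+ 2.
  rewrite [dot y y ^+ 2]expr2 -(sum_pair (fun i => y i * y i) (fun i => y i * y i)).
  by apply: eq_bigr => p _; ring.
by rewrite ler_piMl ?sqr_ge0//; lra.
Qed.

Lemma exists_lower (J : finType) (c : J -> R) : (forall j, 0 < c j) ->
  exists e, 0 < e /\ forall j, e <= c j.
Proof.
move=> c0; suff [e [e0 H]] : exists e, 0 < e /\ forall j, j \in enum J -> e <= c j.
  by exists e; split=> // j; apply: H; rewrite mem_enum.
elim: (enum J) => [|j s [e [e0 H]]]; first by exists 1; split.
exists (Num.min e (c j)); split; first by rewrite lt_min e0 c0.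
move=> i; rewrite inE => /predU1P[->|/H ei]; first by rewrite ge_min lexx orbT.
by rewrite ge_min ei.
Qed.

(** Union bound over a finite family by induction on a list, half of the allowed failure probability
    going to the new member. Domination by [dom] bounds all second moments by the same s. *)
Lemma lln_family (K : nat) (J : finType) (f : J -> vec R 'I_K -> R) (m : J -> R) :
  (forall j, measurable_fun setT (f j)) -> (forall j g, `|f j g| <= dom g) ->
  (forall j, mean (gam R 'I_K) (f j) (m j)) ->
  forall e t : R, 0 < e -> 0 < t -> exists N, forall n, (N <= n)%N -> (0 < n)%N ->
  exists B : set (vec R ('I_K * 'I_n)%type), [/\ measurable B,
    (gam R ('I_K * 'I_n)%type B <= t%:E)%E &
    forall Z, ~ B Z -> forall j, `|\sum_i f j (site i Z) - n%:R * m j| <= e * n%:R].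
Proof.
move=> mf fd mm e t e0 t0.
have [s sP] := @dom_dominated R 'I_K.
suff H (js : seq J) : forall t : R, 0 < t -> exists N, forall n, (N <= n)%N -> (0 < n)%N ->
  exists B : set (vec R ('I_K * 'I_n)%type), [/\ measurable B,
    (gam R ('I_K * 'I_n)%type B <= t%:E)%E &
    forall Z, ~ B Z -> forall j, j \in js -> `|\sum_i f j (site i Z) - n%:R * m j| <= e * n%:R].
  have [N HN] := H (enum J) t t0; exists N => n Nn n0.
  have [B [mB Bt HB]] := HN n Nn n0; exists B; split=> // Z BZ j.
  by apply: HB => //; rewrite mem_enum.
elim: js {t t0} => [|j js IH] t t0.
  by exists 0%N => n _ _; exists set0; split=> //; rewrite measure0 lee_fin ltW.
have t20 : 0 < t / 2 by rewrite divr_gt0.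
have [N HN] := IH (t / 2) t20.
have [m' [s' [mm' ms' s's]]] := sP (f j) (mf j) (fd j).
have em : m j = m' by exact: mean_unique (mm j) mm'.
pose N' := (Num.truncn (`|s| / (e ^+ 2 * (t / 2)))).+1.
exists (maxn N N') => n; rewrite geq_max => /andP[Nn N'n] n0.
have [B [mB Bt HB]] := HN n Nn n0.
pose C := [set Z : vec R ('I_K * 'I_n)%type | e * n%:R <= `|\sum_i f j (site i Z) - n%:R * m j|].
have mS : measurable_fun setT (fun Z : vec R ('I_K * 'I_n)%type => `|\sum_i f j (site i Z) - n%:R * m j|).
  apply: measurableT_comp => //; apply: measurable_funB => //; apply: measurable_sum => i.
  by have [ms _] := @law_site R 'I_K n i; exact: (measurableT_comp (mf j) ms).
have mC : measurable C by rewrite -[C]setTI; exact: measurable_fun_le.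
have Ct : (gam R ('I_K * 'I_n)%type C <= (t / 2)%:E)%E.
  apply: le_trans (weak_lln n0 e0 (mm j) ms') _; rewrite lee_fin.
  have n0' : 0 < n%:R :> R by rewrite ltr0n.
  rewrite ler_pdivrMr ?mulr_gt0 ?exprn_gt0//; apply: le_trans s's _; apply: le_trans (ler_norm _) _.
  have : `|s| / (e ^+ 2 * (t / 2)) <= n%:R.
    apply: ltW; apply: lt_le_trans (Num.Theory.truncnS_gt _) _; by rewrite ler_nat.
  by rewrite ler_pdivrMr ?mulr_gt0 ?exprn_gt0// => h; apply: le_trans h _; rewrite le_eqVlt; apply/orP; left; apply/eqP; ring.
exists (B `|` C); split; first exact: measurableU.
- apply: le_trans (measureU2 _ mB mC) _.
  by rewrite [t]splitr EFinD; exact: leeD.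
- move=> Z BC i; rewrite inE => /predU1P[->|ijs].
    by rewrite leNgt; apply/negP => h; apply: BC; right; rewrite /C /=; exact: ltW.
  by apply: HB => // BZ; apply: BC; left.
Qed.
End whp.

(** * Typical overlaps between directions, layers and spins *)

Section typical.
Context {R : realType} (k : nat).
Local Notation K := k.+2.

(** This is sqrt(2/pi), the mean of |N(0,1)|. *)
Definition kap : R := 2 * (Num.sqrt (2 * pi))^-1.

Definition beta (i : nat) : R := (Num.sqrt (1 + 2 * @ratio R K (inord i.+1)))^-1.

Definition align (i : nat) : R := kap * beta i / Num.sqrt (K - i.+1)%:R.

(** Guaranteed overlap, per sqrt n, of the spins with the unit direction i+1: [align] bounds from
    below the mean overlap with the unnormalised direction, and [beta] bounds its mean square norm
    from above, both per site. *)
Definition aval (i : nat) : R := align i / Num.sqrt (beta i).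

Definition bval : R := kap / Num.sqrt K%:R.

Lemma kap_gt0 : 0 < kap.
Proof. by rewrite mulr_gt0// invr_gt0 sqrtr_gt0 mulr_gt0// pi_gt0. Qed.

Lemma inordS (i : nat) : (i < k)%N -> (inord i.+1 : 'I_K) = i.+1 :> nat.
Proof. by move=> ik; rewrite inordK// ltnS ltnW// ltnS. Qed.

Lemma inordSS (i : nat) : (i < k)%N -> (inord i.+2 : 'I_K) = i.+2 :> nat.
Proof. by move=> ik; rewrite inordK// !ltnS. Qed.

Lemma beta_gt0 i : (i < k)%N -> 0 < beta i.
Proof.
move=> ik; rewrite invr_gt0 sqrtr_gt0 addr_gt0// mulr_gt0// ratio_gt0//.
by rewrite inordS.
Qed.

Lemma align_gt0 i : (i < k)%N -> 0 < align i.
Proof.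
move=> ik; apply: divr_gt0; first exact: mulr_gt0 kap_gt0 (beta_gt0 ik).
by rewrite sqrtr_gt0 ltr0n subn_gt0 !ltnS ltnW.
Qed.

Lemma aval_gt0 i : (i < k)%N -> 0 < aval i.
Proof. by move=> ik; apply: divr_gt0; [exact: align_gt0|rewrite sqrtr_gt0 beta_gt0]. Qed.

Lemma bval_gt0 : 0 < bval.
Proof. by apply: divr_gt0; [exact: kap_gt0|rewrite sqrtr_gt0 ltr0n]. Qed.

Lemma xs_norm (w : vec R 'I_K) : `|xs w| = 1.
Proof. exact: sgn_norm. Qed.

Definition spins n (Z : vec R ('I_K * 'I_n)%type) : 'I_n -> R := fun i => xs (site i Z).

Lemma udir_dot n l (Z : vec R ('I_K * 'I_n)%type) (y : 'I_n -> R) :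
  dot (udir l Z) y = dot (dir l Z) y / Num.sqrt (dot (dir l Z) (dir l Z)).
Proof.
rewrite /dot mulr_suml; apply: eq_bigr => i _.
by rewrite /udir /dot; ring.
Qed.

Lemma typical (e t : R) : 0 < e <= 1 -> (forall i, (i < k)%N -> e <= aval i) -> 0 < t ->
  exists N, forall n, (N <= n)%N -> (0 < n)%N ->
  exists B : set (vec R ('I_K * 'I_n)%type), [/\ measurable B,
    (gam R ('I_K * 'I_n)%type B <= t%:E)%E &
    forall Z, ~ B Z ->
    [/\ forall i, (i < k)%N -> (aval i - e) * Num.sqrt n%:R <= dot (vdir Z i) (spins Z),
        forall i, (i < k)%N -> (bval - e) * Num.sqrt n%:R ^+ 2 <= dot (vlay Z i) (spins Z),
        forall i j, (j < i)%N -> (i < k)%N -> `|dot (vdir Z i) (vdir Z j)| <= e &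
        forall i j, (j <= i)%N -> (i < k)%N -> `|dot (vlay Z i) (vdir Z j)| <= e * Num.sqrt n%:R]].
Proof.
move=> /andP[e0 e1] ea t0.
pose lo (i : 'I_k) : 'I_K := inord i.+1; pose hi (i : 'I_k) : 'I_K := inord i.+2.
have loE i : lo i = i.+1 :> nat by exact: inordS.
have hiE i : hi i = i.+2 :> nat by exact: inordSS.
have /choice[b Hb] : forall i : 'I_k, exists b, mean (gam R 'I_K) (fun w => fl (lo i) w ^+ 2) b /\
  0 < b <= beta i by move=> i; apply: mean_fl_sq; rewrite loE.
have /choice[al Hal] : forall i : 'I_k, exists a, mean (gam R 'I_K) (fun w => fl (lo i) w * xs w) a /\
  align i <= a.
  by move=> i; have := @mean_fl_xs R _ (lo i); rewrite loE; exact.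
have /choice[bb Hbb] : forall i : 'I_k, exists a, mean (gam R 'I_K) (fun w => w (hi i) * xs w) a /\
  bval <= a by move=> i; exact: mean_coord_xs.
have [bm [bm0 bmP]] := exists_lower (c := b) (fun i => (andP (Hb i).2).1).
(* A tolerance for which (aval - e) sqrt(beta + e3) stays below align - e3 whenever e3 <= e2. *)
have [e2 [e20 e2P]] := exists_lower
  (c := fun i : 'I_k => e * Num.sqrt (beta i) / (aval i / Num.sqrt (beta i) + 1)) (fun i =>
  divr_gt0 (mulr_gt0 e0 (etrans (sqrtr_gt0 _) (beta_gt0 (ltn_ord i))))
    (addr_gt0 (divr_gt0 (aval_gt0 (ltn_ord i)) (etrans (sqrtr_gt0 _) (beta_gt0 (ltn_ord i)))) ltr01)).
pose bn := Num.min bm 1.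
have bn0 : 0 < bn by rewrite lt_min bm0 ltr01.
have bn1 : bn <= 1 by rewrite ge_min lexx orbT.
have bnP i : bn <= b i by rewrite ge_min bmP.
(* The second bound serves near orthogonality: squared norms of directions are at least n bn/2, by
   which unnormalised overlaps get divided. *)
pose e3 := Num.min e2 (e * (bn / 2)).
have e30 : 0 < e3 by rewrite lt_min e20 mulr_gt0// divr_gt0.
have t50 : 0 < t / 5 by rewrite divr_gt0.
have xsdom (w : vec R 'I_K) (y : R) : `|y| <= dom w -> `|y * xs w| <= dom w.
  by rewrite normrM xs_norm mulr1.
have fldom2 (l j : 'I_K) (w : vec R 'I_K) : `|fl j w * fl l w| <= dom w.
  by rewrite normrM; apply: le_trans (dom_coord2 j l w); rewrite ler_pM// fl_le.
have dom0 (w : vec R 'I_K) : 0 <= dom w by apply: le_trans (dom_coord ord0 w).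
(* Five laws of large numbers, each with failure probability t/5: squared norms of the directions,
   directions against spins, layers against spins, pairs of directions, and layers against earlier
   directions. *)
have [N1 L1] := lln_family (f := fun (i : 'I_k) w => fl (lo i) w ^+ 2) (m := b)
  (fun i => measurable_funX 2 (measurable_fl (lo i))) (fun i w => fldom2 (lo i) (lo i) w)
  (fun i => (Hb i).1) e30 t50.
have [||j|N2 L2] := lln_family (f := fun (i : 'I_k) w => fl (lo i) w * xs w) (m := al)
  _ _ _ e30 t50.
- by move=> i; apply: measurable_funM; [exact: measurable_fl|exact: measurable_xs].
- by move=> i w; apply: xsdom; exact: le_trans (fl_le (lo i) w) (dom_coord (lo i) w).
- exact: (Hal j).1.
have [||j|N3 L3] := lln_family (f := fun (i : 'I_k) (w : vec R 'I_K) => w (hi i) * xs w) (m := bb)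
  _ _ _ e30 t50.
- by move=> i; apply: measurable_funM; [exact: measurable_coord|exact: measurable_xs].
- by move=> i w; apply: xsdom; exact: dom_coord.
- exact: (Hbb j).1.
have [||j|N4 L4] := lln_family (f := fun (p : 'I_k * 'I_k) (w : vec R 'I_K) =>
    if (p.2 < p.1)%N then fl (lo p.2) w * fl (lo p.1) w else 0) (m := fun=> 0) _ _ _ e30 t50.
- move=> p; case: (p.2 < p.1)%N; last exact: measurable_cst.
  by apply: measurable_funM; exact: measurable_fl.
- by move=> p w; case: (p.2 < p.1)%N; [exact: fldom2|rewrite normr0].
- case j21 : (j.2 < j.1)%N; last exact: mean_cst.
  by apply: mean_fl_fl; rewrite !loE.
have [||j|N5 L5] := lln_family (f := fun (p : 'I_k * 'I_k) (w : vec R 'I_K) =>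
    if (p.2 <= p.1)%N then w (hi p.1) * fl (lo p.2) w else 0) (m := fun=> 0) _ _ _ e30 t50.
- move=> p; case: (p.2 <= p.1)%N; last exact: measurable_cst.
  by apply: measurable_funM; [exact: measurable_coord|exact: measurable_fl].
- move=> p w; case: (p.2 <= p.1)%N; last by rewrite normr0.
  by rewrite normrM; apply: le_trans (dom_coord2 (hi p.1) (lo p.2) w); rewrite ler_pM// fl_le.
- case j21 : (j.2 <= j.1)%N; last exact: mean_cst.
  by apply: mean_coord_fl; rewrite loE hiE !ltnS.
exists (maxn N1 (maxn N2 (maxn N3 (maxn N4 N5)))) => n.
rewrite !geq_max => /andP[n1 /andP[n2 /andP[n3 /andP[n4 n5]]]] n0.
have [B1 [mB1 PB1 {}L1]] := L1 n n1 n0.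
have [B2 [mB2 PB2 {}L2]] := L2 n n2 n0.
have [B3 [mB3 PB3 {}L3]] := L3 n n3 n0.
have [B4 [mB4 PB4 {}L4]] := L4 n n4 n0.
have [B5 [mB5 PB5 {}L5]] := L5 n n5 n0.
have mB45 := measurableU _ _ mB4 mB5; have mB345 := measurableU _ _ mB3 mB45.
have mB25 := measurableU _ _ mB2 mB345.
exists (B1 `|` (B2 `|` (B3 `|` (B4 `|` B5)))); split; first exact: measurableU.
  rewrite (_ : t = t / 5 + (t / 5 + (t / 5 + (t / 5 + t / 5)))); last by field.
  rewrite !EFinD.
  by do 4 (apply: le_trans (measureU2 _ _ _) _ => //; apply: leeD => //).
move=> Z /not_orP[/L1{}L1 /not_orP[/L2{}L2 /not_orP[/L3{}L3 /not_orP[/L4{}L4 /L5{}L5]]]].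
have n0' : 0 < n%:R :> R by rewrite ltr0n.
set S := Num.sqrt n%:R; have S0 : 0 < S by rewrite sqrtr_gt0.
have S2 : S ^+ 2 = n%:R by rewrite sqr_sqrtr// ltW.
pose D (i : 'I_k) := dot (dir (lo i) Z) (dir (lo i) Z).
have e3b : e3 <= e * (bn / 2) by rewrite ge_min lexx orbT.
have e3e2 : e3 <= e2 by rewrite ge_min lexx.
have e3e : e3 <= e.
  by apply: le_trans e3b _; rewrite ler_piMr ?(ltW e0)//; lra.
have Dlo i : n%:R * (bn / 2) <= D i.
  have := L1 i; rewrite ler_distl => /andP[+ _].
  have -> : \sum_i0 fl (lo i) (site i0 Z) ^+ 2 = D i.
    by apply: eq_bigr => i0 _; rewrite expr2.
  apply: le_trans; rewrite [e3 * _]mulrC -mulrBr ler_pM2l//.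
  have := bnP i; have : e3 <= bn / 2; last by lra.
  by apply: le_trans e3b _; rewrite ler_piMl// divr_ge0// ltW.
have Dup i : D i <= n%:R * (beta i + e3).
  have := L1 i; rewrite ler_distl => /andP[_].
  have -> : \sum_i0 fl (lo i) (site i0 Z) ^+ 2 = D i.
    by apply: eq_bigr => i0 _; rewrite expr2.
  move/le_trans; apply; rewrite [e3 * _]mulrC -mulrDr ler_pM2l// lerD2r.
  by have [_ /andP[]] := Hb i.
pose r := Num.sqrt (bn / 2).
have bn20 : 0 < bn / 2 by rewrite divr_gt0.
have r0 : 0 < r by rewrite sqrtr_gt0.
have r2 : r ^+ 2 = bn / 2 by rewrite sqr_sqrtr// ltW.
have rb : bn / 2 <= r by rewrite -r2 expr2 ler_piMl ?(ltW r0)// -[leRHS]sqrtr1 ler_wsqrtr//; lra.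
have sDlo i : S * r <= Num.sqrt (D i).
  by rewrite -sqrtrM ?ler_wsqrtr// ltW.
have sD0 i : 0 < Num.sqrt (D i) by apply: lt_le_trans (sDlo i); exact: mulr_gt0.
split.
- move=> i ik; pose i' := Ordinal ik.
  rewrite /vdir udir_dot -/(D i') ler_pdivlMr ?(sD0 i')//.
  have X : n%:R * (align i - e3) <= dot (dir (inord i.+1) Z) (spins Z).
    have := L2 i'; rewrite ler_distl => /andP[+ _].
    apply: le_trans; rewrite mulrBr [e3 * _]mulrC lerB// ler_pM2l//.
    by have [_] := Hal i'.
  apply: le_trans X; have b0 := beta_gt0 ik.
  set q := Num.sqrt (beta i); have q0 : 0 < q by rewrite sqrtr_gt0.
  have q2 : q ^+ 2 = beta i by rewrite sqr_sqrtr// ltW.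
  have aq : align i = aval i * q by rewrite /aval -/q divfK// gt_eqF.
  have a0 := aval_gt0 ik; have ae := ea i ik.
  have sD : Num.sqrt (D i') <= S * Num.sqrt (beta i + e3).
    by rewrite -sqrtrM ?(ltW n0')// ler_wsqrtr// (Dup i').
  set p := Num.sqrt (beta i + e3) in sD.
  have be0 : 0 <= beta i + e3 by rewrite addr_ge0 ?ltW.
  have qp : q <= p by rewrite ler_wsqrtr// lerDl ltW.
  have pq : p <= q + e3 / q.
    rewrite -(@ler_pXn2r _ 2)// ?nnegrE ?sqrtr_ge0 ?addr_ge0 ?divr_ge0 ?ltW//.
    rewrite sqr_sqrtr// sqrrD q2 mulrCA divff ?gt_eqF// mulr1.
    by have := sqr_ge0 (e3 / q); rewrite mulr2n; lra.
  have key : (aval i - e) * p <= align i - e3.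
    have aq0 : 0 < aval i / q + 1 by exact: addr_gt0 (divr_gt0 a0 q0) ltr01.
    have := e2P i'; rewrite /= -/q (ler_pdivlMr _ _ aq0) => h.
    have h1 : e3 * (aval i / q + 1) <= e * q.
      by apply: le_trans h; exact: ler_wpM2r (ltW aq0) _ _ e3e2.
    have h2 : aval i * p <= aval i * (q + e3 / q) by rewrite ler_wpM2l// ltW.
    have h3 : e * q <= e * p by rewrite ler_wpM2l// ltW.
    rewrite aq; move: h1 h2 h3; rewrite (_ : e3 * (aval i / q + 1) = aval i * (e3 / q) + e3); last by ring.
    by lra.
  apply: (@le_trans _ _ ((aval i - e) * S * (S * p))).
    by rewrite ler_wpM2l// mulr_ge0 ?subr_ge0// ltW.
  have -> : (aval i - e) * S * (S * p) = n%:R * ((aval i - e) * p) by rewrite -S2; ring.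
  by rewrite ler_pM2l.
- move=> i ik; pose i' := Ordinal ik; rewrite S2.
  have := L3 i'; rewrite ler_distl => /andP[+ _].
  apply: le_trans; have [_] := Hbb i' => h.
  rewrite mulrBl; apply: lerB; first by rewrite mulrC ler_pM2l.
  by rewrite ler_pM2r.
- move=> i j ji ik; pose i' := Ordinal ik; pose j' := Ordinal (ltn_trans ji ik).
  rewrite /vdir udir_dot dotC udir_dot -/(D i') -/(D j') !normrM !normfV.
  rewrite !(@ger0_norm _ (Num.sqrt _)) ?sqrtr_ge0// !ler_pdivrMr ?(sD0 i') ?(sD0 j')//.
  have := L4 (i', j'); rewrite /= ji mulr0 subr0 => h; apply: le_trans h _.
  rewrite -mulrA; apply: (@le_trans _ _ (e * ((S * r) * (S * r)))).
    by rewrite mulrACA -!expr2 S2 r2 mulrCA mulrC ler_pM2l.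
  rewrite ler_pM2l//; have Sr := ltW (mulr_gt0 S0 r0).
  exact: (ler_pM Sr Sr (sDlo _) (sDlo _)).
- move=> i j ji ik; pose i' := Ordinal ik; pose j' := Ordinal (leq_ltn_trans ji ik).
  rewrite /vdir dotC udir_dot -/(D j') normrM normfV.
  rewrite (@ger0_norm _ (Num.sqrt _)) ?sqrtr_ge0// ler_pdivrMr ?(sD0 j')//.
  have := L5 (i', j'); rewrite /= ji mulr0 subr0.
  have -> : dot (dir (inord j.+1) Z) (vlay Z i) = \sum_(i0 < n) site i0 Z (hi i') * fl (lo j') (site i0 Z).
    by apply: eq_bigr => i0 _; rewrite mulrC.
  move=> h; apply: le_trans h _.
  apply: (@le_trans _ _ (e * S * (S * r))).
    have -> : e * S * (S * r) = n%:R * (e * r) by rewrite -S2; ring.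
    by rewrite mulrC ler_pM2l//; apply: le_trans e3b _; rewrite ler_pM2l.
  by rewrite ler_pM2l ?mulr_gt0.
Qed.
End typical.

(** * Low energy of the constructed spins with high probability *)

Section energy_whp.
Context {R : realType} (k : nat).
Local Notation K := k.+2.

Lemma prod_measure_le d1 d2 (T1 : measurableType d1) (T2 : measurableType d2)
    (P : probability T1 R) (Q : probability T2 R) (C : set (T1 * T2)) (c : R) :
  measurable C -> (forall x, (Q [set y | C (x, y)] <= c%:E)%E) ->
  ((P \x Q)%E C <= c%:E)%E.
Proof.
move=> mC h.
apply: (@le_trans _ _ (\int[P]_x c%:E)%E); last first.
  by have [_ ->] := mean_cst P c.
apply: ge0_le_integral => //.
- exact: measurable_fun_xsection.
- move=> x _ /=; apply: le_trans (h x).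
  rewrite le_eqVlt; apply/orP; left; apply/eqP; congr (Q _).
  by apply/seteqP; split=> y; rewrite /xsection/= inE.
Qed.

Definition Ek : R := \sum_(i < k) @aval R k i * @bval R k.

Lemma spins_dot n (Z : vec R ('I_K * 'I_n)%type) :
  dot (spins Z) (spins Z) = Num.sqrt n%:R ^+ 2.
Proof.
rewrite sqr_sqrtr// /dot (eq_bigr (fun=> 1)) ?sumr_const ?card_ord// => i _.
by rewrite -expr2 -real_normK ?num_real// xs_norm expr1n.
Qed.

Lemma measurable_reject n m i :
  measurable_fun setT (fun Z : vec R ('I_K * 'I_n)%type => reject (vdir Z) (spins Z) m i).
Proof.
elim: m i => [|m IH] i /=.
  by have [ms _] := @law_site R 'I_K n i; have mx := @measurable_xs R K; exact: (measurableT_comp mx ms).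
have mv j : measurable_fun setT (fun Z : vec R ('I_K * 'I_n)%type => vdir Z m j).
  exact: measurable_udir.
apply: measurable_funB; first exact: IH.
apply: measurable_funM => //; apply: measurable_sum => j; exact: measurable_funM.
Qed.

(** The residual vector depends on Z alone and has squared norm at most n, so for fixed Z the form
    in the independent G has second moment at most n^2, against the threshold t n^(3/2). *)
Lemma noise_whp n (t : R) : 0 < t -> (0 < n)%N ->
  let C := [set p : vec R ('I_K * 'I_n)%type * vec R ('I_n * 'I_n)%type |
    t * Num.sqrt n%:R ^+ 3 <= `|quad p.2 (reject (vdir p.1) (spins p.1) k)|] in
  measurable C /\
  ((gam R ('I_K * 'I_n)%type \x gam R ('I_n * 'I_n)%type)%E C <= (t ^- 2 / n%:R)%:E)%E.
Proof.
move=> t0 n0 C; have n0' : 0 < n%:R :> R by rewrite ltr0n.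
set S := Num.sqrt n%:R in C *; have S0 : 0 < S by rewrite sqrtr_gt0.
have mC : measurable C.
  have mq : measurable_fun setT (fun p : vec R ('I_K * 'I_n)%type * vec R ('I_n * 'I_n)%type =>
      `|quad p.2 (reject (vdir p.1) (spins p.1) k)|).
    apply: measurableT_comp => //; apply: measurable_funM => //.
    have mr i : measurable_fun setT (fun p : vec R ('I_K * 'I_n)%type * vec R ('I_n * 'I_n)%type =>
        reject (vdir p.1) (spins p.1) k i).
      exact: (measurableT_comp (@measurable_reject n k i) measurable_fst).
    apply: measurable_sum => q; apply: measurable_funM => //; apply: measurable_funM => //.
    exact: (measurableT_comp (measurable_coord q) measurable_snd).
  by rewrite -[C]setTI; exact: measurable_fun_le.
split=> //; apply: prod_measure_le => // Z.
apply: le_trans (quad_tail (reject (vdir Z) (spins Z) k) (mulr_gt0 t0 (exprn_gt0 3 S0))) _; rewrite lee_fin.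
have := @reject_norm R n k (vdir Z) (spins Z) S (spins_dot Z) (fun i _ => udir_unit _ Z) k (leqnn k).
set y := dot _ _ => yS.
rewrite exprMn invfM mulrCA -exprVn ler_wpM2l ?exprn_ge0 ?invr_ge0 ?(ltW t0)//.
rewrite ler_pdivrMr ?exprn_gt0//.
have -> : n%:R^-1 * (S ^+ 3) ^+ 2 = (S ^+ 2) ^+ 2.
  have S2 : S ^+ 2 = n%:R by rewrite sqr_sqrtr// ltW.
  by rewrite -exprM (_ : 3 * 2 = 2 + (2 * 2))%N// exprD S2 mulrA mulVf ?mul1r ?gt_eqF// exprM S2.
by rewrite ler_pXn2r// nnegrE ?dot_ge0 ?exprn_ge0 ?(ltW S0).
Qed.

Lemma energy_whp (eta t : R) : 0 < eta -> 0 < t ->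
  exists N, forall n, (N <= n)%N -> (0 < n)%N ->
  exists A : set (vec R ('I_K * 'I_n)%type * vec R ('I_n * 'I_n)%type), [/\ measurable A,
    ((gam R ('I_K * 'I_n)%type \x gam R ('I_n * 'I_n)%type)%E A <= t%:E)%E &
    forall p, ~ A p -> quad (expose k p.1 p.2) (spins p.1) <= - (Ek - eta) * Num.sqrt n%:R ^+ 3].
Proof.
move=> eta0 t0.
have t20 : 0 < t / 2 by rewrite divr_gt0.
have eta20 : 0 < eta / 2 by rewrite divr_gt0.
(* Coefficient of e in the loss of the summed gain bound; the choice of e below makes e C at most
   eta/2. *)
pose C := \sum_(i < k) (k.+1%:R * (@aval R k i + @bval R k) + 1).
have bv0 := @bval_gt0 R k.
have C0 : 0 <= C.
  apply: sumr_ge0 => i _; rewrite addr_ge0// mulr_ge0// addr_ge0//.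
    exact: ltW (aval_gt0 (ltn_ord i)).
  exact: ltW.
have k0 : 0 < k.+1%:R :> R by rewrite ltr0n.
have k1 : 1 <= k.+1%:R :> R by rewrite ler1n.
have [e1 [e10 e1P]] := exists_lower (c := fun i : 'I_k => @aval R k i / k.+1%:R)
  (fun i => divr_gt0 (aval_gt0 (ltn_ord i)) k0).
pose e := Num.min 1 (Num.min e1 (Num.min (@bval R k / k.+1%:R) (eta / 2 / (C + 1)))).
have C10 : 0 < C + 1 by exact: ltr_wpDl.
have e0 : 0 < e by rewrite !lt_min ltr01 e10 (divr_gt0 bv0 k0) (divr_gt0 eta20 C10).
have /andP[el1 /andP[ee1 /andP[eb eC]]] : [&& e <= 1, e <= e1, e <= @bval R k / k.+1%:R &
    e <= eta / 2 / (C + 1)] by rewrite -!le_min.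
have da i : (i < k)%N -> k.+1%:R * e <= @aval R k i.
  by move=> ik; have := le_trans ee1 (e1P (Ordinal ik)); rewrite /= ler_pdivlMr// mulrC.
have ea i : (i < k)%N -> e <= @aval R k i.
  by move=> ik; apply: le_trans (da i ik); rewrite ler_peMl// ltW.
have e01 : 0 < e <= 1 by rewrite e0.
have [N1 H1] := typical e01 ea t20.
pose x := (eta / 2) ^- 2 / (t / 2).
have x0 : 0 <= x by rewrite divr_ge0 ?invr_ge0 ?exprn_ge0 ?(ltW t20) ?(ltW eta20).
exists (maxn N1 (Num.truncn x).+1) => n; rewrite geq_max => /andP[n1 nx] n0.
have n0' : 0 < n%:R :> R by rewrite ltr0n.
have [B [mB PB HB]] := H1 n n1 n0.
have [mD PD] := noise_whp eta20 n0.
set D := [set _ | _] in mD PD.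
have mBT : measurable (B `*` [set: vec R ('I_n * 'I_n)%type]) by exact: measurableX.
exists (B `*` setT `|` D); split; first exact: measurableU.
- apply: le_trans (measureU2 _ mBT mD) _.
  rewrite [t in leRHS]splitr EFinD leeD//.
    have pT := @probability_setT _ _ _ (gam R ('I_n * 'I_n)%type).
    apply: (@le_trans _ _ (gam R ('I_K * 'I_n)%type B * gam R ('I_n * 'I_n)%type setT)%E).
      by rewrite le_eqVlt; apply/orP; left; apply/eqP; exact: product_measure1E.
    by rewrite pT mule1.
  apply: le_trans PD _; rewrite lee_fin.
  rewrite ler_pdivrMr// [leRHS]mulrC -ler_pdivrMr// -/x.
  by apply: le_trans (ltW (Num.Theory.truncnS_gt x)) _; rewrite ler_nat.
- move=> [Z G] /not_orP[ZB /negP ZD] /=.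
  have BZ : ~ B Z by move=> BZ; apply: ZB.
  have [vx zx vv zv] := HB Z BZ.
  set S := Num.sqrt n%:R in vx zx vv zv *.
  have S0 : 0 < S by rewrite sqrtr_gt0.
  have db : k.+1%:R * e <= @bval R k by rewrite mulrC -ler_pdivlMr.
  have := sum_gain_ge S0 (ltW e0) (spins_dot Z) (fun i _ => udir_unit _ Z) vx zx vv zv da db.
  rewrite quad_expose => gge.
  have qle : quad G (reject (vdir Z) (spins Z) k) <= eta / 2 * S ^+ 3.
    move: ZD; rewrite /D /= -ltNge => /ltW; exact: le_trans (ler_norm _).
  have low : Ek - eta / 2 <= \sum_(i < k) ((@aval R k i - k.+1%:R * e) * (@bval R k - k.+1%:R * e) - e).
    apply: (@le_trans _ _ (Ek - e * C)).
      rewrite lerB//; move: eC; rewrite ler_pdivlMr// mulrDr mulr1 => h.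
      by apply: le_trans h; rewrite lerDl ltW.
    rewrite /Ek /C mulr_sumr -sumrB; apply: ler_sum => i _.
    have : 0 <= (k.+1%:R * e) ^+ 2 :> R by exact: sqr_ge0.
    by move: (aval k i) (bval k) => u v; nra.
  have : S ^+ 3 * (Ek - eta / 2) <= \sum_(i < k) gain (vdir Z) (vlay Z) (spins Z) i.
    by apply: le_trans gge; rewrite ler_pM2l ?exprn_gt0.
  by move: (\sum_(i < k) _) => g; nra.
Qed.
End energy_whp.

(** * Numerical bounds on pi *)

Section pi_bounds.
Context {R : realType}.
Implicit Types (f df : R -> R) (x : R).

(** Applied repeatedly, it integrates Taylor inequalities for sine and cosine one order at a
    time. *)
Lemma deriv_ge0_le f df : (forall x, is_derive x 1 f (df x)) ->
  (forall x, 0 <= x -> 0 <= df x) -> forall x, 0 <= x -> f 0 <= f x.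
Proof.
move=> fd d0 x x0.
have fc : {within `[0, x], continuous f}.
  by apply: derivable_within_continuous => y _; have [] := fd y.
have [c] := MVT_segment x0 (fun y _ => fd y) fc.
rewrite in_itv/= => /andP[c0 _] E.
by rewrite -subr_ge0 E mulr_ge0 ?d0// subr0.
Qed.

Lemma deriv_mono (c : R) n (y : R) :
  is_derive y 1 (fun y : R => c * y ^+ n.+1) (c * (n.+1%:R * y ^+ n)).
Proof.
have -> : (fun y : R => c * y ^+ n.+1) = c *: (id ^+ n.+1 : R -> R).
  by apply/funext => z; rewrite exprfctE.
by apply: is_derive_eq; rewrite /GRing.scale/= mulr1.
Qed.

Lemma sin_le x : 0 <= x -> sin x <= x.
Proof.
move=> x0; have := @deriv_ge0_le (fun y => y - sin y) (fun y => 1 - cos y) _ _ x x0.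
rewrite sin0 subr0 subr_ge0; apply.
  by move=> y _; rewrite subr_ge0 cos_le1.
Qed.

Lemma cos_ge2 x : 0 <= x -> 1 - x ^+ 2 / 2 <= cos x.
Proof.
move=> x0; have := @deriv_ge0_le (fun y => cos y + 2^-1 * y ^+ 2)
  (fun y => - sin y + 2^-1 * (2%:R * y ^+ 1)) _ _ x x0.
rewrite cos0 expr0n/= mulr0 addr0 -lerBlDr (mulrC 2^-1); apply.
  by move=> y; have h := (is_deriveD (is_derive_cos y) (deriv_mono (2^-1) 1 y)); exact: h.
  by move=> y y0; have := sin_le y0; rewrite expr1; lra.
Qed.

Lemma sin_ge3 x : 0 <= x -> x - x ^+ 3 / 6 <= sin x.
Proof.
move=> x0; have := @deriv_ge0_le (fun y => (sin y + 6^-1 * y ^+ 3) + (- 1) * y ^+ 1)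
  (fun y => (cos y + 6^-1 * (3%:R * y ^+ 2)) + (- 1) * (1%:R * y ^+ 0)) _ _ x x0.
rewrite sin0 !expr0n/= !mulr0 !addr0 expr1 => h.
suff : 0 <= sin x + 6^-1 * x ^+ 3 + -1 * x by lra.
apply: h.
  by move=> y; have h := (is_deriveD (is_deriveD (is_derive_sin y) (deriv_mono (6^-1) 2 y)) (deriv_mono (-1) 0 y)); exact: h.
  by move=> y y0; have := cos_ge2 y0; rewrite expr0; lra.
Qed.

Lemma cos_le4 x : 0 <= x -> cos x <= 1 - x ^+ 2 / 2 + x ^+ 4 / 24.
Proof.
move=> x0; have := @deriv_ge0_le (fun y => (- cos y + 24^-1 * y ^+ 4) + (- 2^-1) * y ^+ 2)
  (fun y => (- - sin y + 24^-1 * (4%:R * y ^+ 3)) + (- 2^-1) * (2%:R * y ^+ 1)) _ _ x x0.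
rewrite cos0 !expr0n/= !mulr0 !addr0 => h.
suff : - 1 <= - cos x + 24^-1 * x ^+ 4 + (- 2^-1) * x ^+ 2 by lra.
apply: h.
  by move=> y; have h := (is_deriveD (is_deriveD (is_deriveN (is_derive_cos y)) (deriv_mono (24^-1) 3 y)) (deriv_mono (- 2^-1) 1 y)); exact: h.
  by move=> y y0; have := sin_ge3 y0; rewrite expr1; lra.
Qed.

Lemma sin_le5 x : 0 <= x -> sin x <= x - x ^+ 3 / 6 + x ^+ 5 / 120.
Proof.
move=> x0; have := @deriv_ge0_le
  (fun y => ((- sin y + 120^-1 * y ^+ 5) + (- 6^-1) * y ^+ 3) + 1 * y ^+ 1)
  (fun y => ((- cos y + 120^-1 * (5%:R * y ^+ 4)) + (- 6^-1) * (3%:R * y ^+ 2)) + 1 * (1%:R * y ^+ 0)) _ _ x x0.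
rewrite sin0 !expr0n/= !mulr0 !addr0 expr1 => h.
suff : - 0 <= - sin x + 120^-1 * x ^+ 5 + (- 6^-1) * x ^+ 3 + 1 * x by lra.
apply: h.
  by move=> y; have h := (is_deriveD (is_deriveD (is_deriveD (is_deriveN (is_derive_sin y)) (deriv_mono (120^-1) 4 y)) (deriv_mono (- 6^-1) 2 y)) (deriv_mono (1) 0 y)); exact: h.
  by move=> y y0; have := cos_le4 y0; rewrite expr0; lra.
Qed.

Lemma pi_quarter :
  [/\ 0 < sin (pi / 4 : R), sin (pi / 4 : R) ^+ 2 = 1 / 2 & cos (pi / 4 : R) = sin (pi / 4)].
Proof.
have p0 := @pi_gt0 R.
have s0 : 0 < sin (pi / 4 : R) by apply: sin_gt0_pi; lra.
have c0 : 0 < cos (pi / 4 : R) by apply: cos_gt0_pihalf; lra.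
have h : cos (pi / 4 : R) ^+ 2 = sin (pi / 4) ^+ 2.
  have := @cosD R (pi / 4) (pi / 4); rewrite (_ : pi / 4 + pi / 4 = pi / 2) ?cos_pihalf; last by field.
  by rewrite -!expr2 => /esym/eqP; rewrite subr_eq0 => /eqP.
split=> //; first by have := cos2Dsin2 (pi / 4 : R); rewrite h; lra.
by apply/eqP; rewrite -(@eqrXn2 _ 2)// ?ltW// h.
Qed.

(** The quartic bound puts cos(0.7875) below 1/sqrt 2 = cos(pi/4), and cosine decreases there. *)
Lemma pi_le : pi <= (315 / 100 : R).
Proof.
have p0 := @pi_gt0 R; have [s0 s2 cs] := pi_quarter.
rewrite leNgt; apply/negP => hp.
have : cos (pi / 4 : R) <= cos (315 / 400).
  by apply: ltW; rewrite ltr_cos; [lra|rewrite in_itv/=; apply/andP; split; lra..].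
have := @cos_le4 (315 / 400); rewrite cs => /(_ (ltac:(lra))).
by move: s0 s2; move: (sin _) => s; nra.
Qed.

Lemma pi_ge : (31 / 10 : R) <= pi.
Proof.
have p0 := @pi_gt0 R; have [s0 s2 cs] := pi_quarter.
rewrite leNgt; apply/negP => hp.
have : sin (pi / 4 : R) <= sin (31 / 40).
  have q := @pi_ge2 R.
  by apply: ltW; rewrite ltr_sin; [lra|rewrite in_itv/=; apply/andP; split; lra..].
have := @sin_le5 (31 / 40); move=> /(_ (ltac:(lra))).
by move: s0 s2; move: (sin _) => s; nra.
Qed.
End pi_bounds.

(** * The limiting energy constant *)

Section energy_value.
Context {R : realType}.

(** Taylor polynomial of degree four of (1-u)^(-1/4) at 0; [prim] is the primitive of [tay] (x^2)
    vanishing at 0. *)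
Definition tay (u : R) : R := 1 + u / 4 + 5 * u ^+ 2 / 32 + 15 * u ^+ 3 / 128 + 195 * u ^+ 4 / 2048.

Definition prim (x : R) : R :=
  x + x ^+ 3 / 12 + x ^+ 5 / 32 + 15 * x ^+ 7 / 896 + 195 * x ^+ 9 / 18432.

Lemma deriv_tay (u : R) :
  is_derive u 1 tay (1 / 4 + 5 * u / 16 + 45 * u ^+ 2 / 128 + 195 * u ^+ 3 / 512).
Proof.
have := is_deriveD (is_deriveD (is_deriveD (is_deriveD (is_derive_cst (1 : R) u 1)
  (deriv_mono (1 / 4) 0 u)) (deriv_mono (5 / 32) 1 u)) (deriv_mono (15 / 128) 2 u))
  (deriv_mono (195 / 2048) 3 u).
have -> : tay = (fun u => 1 + 1 / 4 * u ^+ 1 + 5 / 32 * u ^+ 2 + 15 / 128 * u ^+ 3 + 195 / 2048 * u ^+ 4).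
  by apply/funext => x; rewrite /tay expr1; field.
move=> h; apply: (is_derive_eq h); rewrite expr0 expr1; by field.
Qed.

(** The function (1-u)^(-1/4) satisfies 4(1-u) f' = f. For the truncated series the defect of this
    equation is the single term (17*195/2048) u^4 >= 0, so tay^4 (1-u) decreases from 1. *)
Lemma tay_le u : 0 <= u -> tay u ^+ 4 * (1 - u) <= 1.
Proof.
move=> u0; have t0 : tay 0 = 1 by rewrite /tay !expr0n/= !mulr0 !mul0r !addr0.
have := @deriv_ge0_le R (fun x => - (tay x ^+ 4 * (1 - x)))
  (fun x => tay x ^+ 3 * (17 * 195 / 2048 * x ^+ 4)) _ _ u u0.
rewrite t0 expr1n mul1r subr0 lerN2; apply.
- move=> x; have ht := deriv_tay x.
  apply: is_derive_eq; rewrite /GRing.scale/= /tay; by field.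
- move=> x x0; have tx0 : 0 <= tay x.
    have := exprn_ge0 2 x0; have := exprn_ge0 3 x0; have := exprn_ge0 4 x0.
    by rewrite /tay; lra.
  have := mulr_ge0 (exprn_ge0 3 tx0) (exprn_ge0 4 x0).
  by move: (tay x ^+ 3) (x ^+ 4) => p q; lra.
Qed.

Lemma bernoulli (x h : R) m : 0 <= h <= x ->
  x ^+ m.+1 - (x - h) ^+ m.+1 <= m.+1%:R * (h * x ^+ m).
Proof.
move=> /andP[h0 hx]; have x0 := le_trans h0 hx; elim: m => [|m IH].
  by rewrite !expr1 expr0; lra.
have xh : 0 <= x - h by rewrite subr_ge0.
have := ler_wpM2l xh IH; rewrite mulrBr -exprS => H.
have h2 : 0 <= m.+1%:R * (h ^+ 2 * x ^+ m) by rewrite mulr_ge0// mulr_ge0 ?exprn_ge0.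
have E : m.+1%:R * (h * x ^+ m.+1) =
    (x - h) * (m.+1%:R * (h * x ^+ m)) + m.+1%:R * (h ^+ 2 * x ^+ m).
  by rewrite [x ^+ m.+1]exprS; ring.
rewrite [x ^+ m.+2]exprS -[m.+2%:R]natr1 [leRHS]mulrDl mul1r E.
by move: H h2; move: (_ * (h ^+ 2 * _)) (m.+1%:R * (h * x ^+ m)) (x ^+ m.+1) ((x - h) ^+ m.+2) => A B C D; lra.
Qed.

Lemma prim_step (x h : R) : 0 <= h <= x -> prim x - prim (x - h) <= h * tay (x ^+ 2).
Proof.
move=> hx.
have := bernoulli 8 hx; have := bernoulli 6 hx; have := bernoulli 4 hx; have := bernoulli 2 hx.
rewrite /prim /tay -!exprM.
by lra.
Qed.

(** A Riemann sum at right endpoints of an increasing function dominates its integral; each step is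
    the Bernoulli-type bound applied to the monomials of [prim]. *)
Lemma prim_sum (K m : nat) : (0 < K)%N ->
  prim (m%:R / K%:R) <= \sum_(i < m) K%:R^-1 * tay ((i.+1%:R / K%:R) ^+ 2).
Proof.
move=> K0; elim: m => [|m IH].
  by rewrite big_ord0 mul0r /prim !expr0n/= !mulr0 !mul0r !addr0.
rewrite big_ord_recr/=.
have hx : 0 <= (K%:R^-1 : R) <= m.+1%:R / K%:R.
  by rewrite invr_ge0 ler0n/= ler_peMl ?invr_ge0// ler1n.
have := prim_step hx.
have -> : m.+1%:R / K%:R - K%:R^-1 = m%:R / K%:R :> R by rewrite -natr1; ring.
by lra.
Qed.

Lemma prim_ge (x : R) : 0 <= x <= 1 -> prim 1 * x ^+ 9 <= prim x.
Proof.
move=> /andP[x0 x1].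
have le9 m : (m <= 9)%N -> x ^+ 9 <= x ^+ m by move=> m9; rewrite ler_wiXn2l.
have := le9 1 isT; have := le9 3 isT; have := le9 5 isT; have := le9 7 isT.
by rewrite /prim !expr1n expr1; lra.
Qed.

(** With u = (l/K)^2, the quantity K b/(c d) is exactly (1-u)^(-1/4), since b^4 = (K-l)/(K+l) and (c
    d)^4 = (K-l)^2 K^2. *)
Lemma quartic_le (K l b c d : R) : 0 < l < K -> 0 < b -> 0 < c -> 0 < d ->
  b ^+ 4 = (1 + 2 * (l / (K - l)))^-1 -> c ^+ 2 = K - l -> d ^+ 2 = K ->
  K^-1 * tay ((l / K) ^+ 2) <= b / (c * d).
Proof.
move=> /andP[l0 lK] bb0 c0 d0 b4 c2 d2.
have K0 : 0 < K by exact: lt_trans lK.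
have Kl0 : 0 < K - l by rewrite subr_gt0.
have Kl1 : 0 < K + l by rewrite addr_gt0.
have {}b4 : b ^+ 4 = (K - l) / (K + l).
  rewrite b4; field; rewrite !gt_eqF//=; lra.
pose t := b / (c * d); rewrite -/t.
have t0 : 0 < t by rewrite divr_gt0// mulr_gt0.
rewrite mulrC ler_pdivrMr//.
set u := (l / K) ^+ 2.
have u0 : 0 <= u by exact: sqr_ge0.
have u1 : 0 < 1 - u.
  by rewrite subr_gt0 /u expr_lt1// ?ltr_pdivrMr ?mul1r//; exact: ltW (divr_gt0 l0 K0).
have tK4 : (t * K) ^+ 4 * (1 - u) = 1.
  have -> : (t * K) ^+ 4 = b ^+ 4 * K ^+ 4 / ((c ^+ 2) ^+ 2 * (d ^+ 2) ^+ 2).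
    by rewrite /t; field; rewrite !gt_eqF.
  by rewrite b4 c2 d2 /u; field; rewrite !gt_eqF.
have := tay_le u0; rewrite -[leRHS]tK4 ler_pM2r// => h.
have tu0 : 0 <= tay u.
  by rewrite /tay; have := exprn_ge0 2 u0; have := exprn_ge0 3 u0; have := exprn_ge0 4 u0; lra.
by rewrite -(@ler_pXn2r _ 4)// nnegrE mulr_ge0// ltW.
Qed.

Lemma gain_value k i : (i < k)%N ->
  kap ^+ 2 * (k.+2%:R^-1 * tay ((i.+1%:R / k.+2%:R) ^+ 2)) <= @aval R k i * @bval R k.
Proof.
move=> ik; have b0 := @beta_gt0 R k i ik.
have iK : (i.+1 < k.+2)%N by rewrite !ltnS ltnW.
have lK : 0 < (i.+1%:R : R) < k.+2%:R by rewrite ltr0n/= ltr_nat.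
have KlE : (k.+2 - i.+1)%:R = k.+2%:R - i.+1%:R :> R by rewrite natrB// ltnW.
have Kl0 : 0 < k.+2%:R - i.+1%:R :> R by rewrite subr_gt0; have /andP[] := lK.
have bb0 : 0 < Num.sqrt (@beta R k i) by rewrite sqrtr_gt0.
have b2 : Num.sqrt (@beta R k i) ^+ 2 = beta k i by rewrite sqr_sqrtr// ltW.
have b4 : Num.sqrt (@beta R k i) ^+ 4 = (1 + 2 * (i.+1%:R / (k.+2%:R - i.+1%:R)))^-1.
  rewrite (_ : 4 = 2 * 2)%N// exprM b2 /beta /ratio inordS// KlE exprVn sqr_sqrtr//.
  by rewrite addr_ge0// mulr_ge0// divr_ge0// ltW.
have c0 : 0 < Num.sqrt (k.+2%:R - i.+1%:R : R) by rewrite sqrtr_gt0.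
have d0 : 0 < Num.sqrt (k.+2%:R : R) by rewrite sqrtr_gt0 ltr0n.
have c2 : Num.sqrt (k.+2%:R - i.+1%:R : R) ^+ 2 = k.+2%:R - i.+1%:R by rewrite sqr_sqrtr// ltW.
have d2 : Num.sqrt (k.+2%:R : R) ^+ 2 = k.+2%:R by rewrite sqr_sqrtr.
have := quartic_le lK bb0 c0 d0 b4 c2 d2.
rewrite /aval /align /bval KlE; move: b2 bb0 c0 d0.
move: (tay _) => g; move: (k.+2%:R^-1) (Num.sqrt (@beta R k i)) (Num.sqrt (k.+2%:R - _)) (Num.sqrt k.+2%:R).
move=> K b c d <- bb0 c0 d0 h.
have -> : kap * b ^+ 2 / c / b * (kap / d) = kap ^+ 2 * (b / (c * d)).
  by field; rewrite !gt_eqF.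
by rewrite ler_pM2l// exprn_gt0// kap_gt0.
Qed.

Lemma kap_sqr : kap ^+ 2 = 2 / pi :> R.
Proof.
have p0 := @pi_gt0 R.
rewrite /kap exprMn exprVn sqr_sqrtr ?mulr_ge0 ?(ltW p0)//.
by move: (pi : R) p0 => p p0; field; rewrite gt_eqF.
Qed.

(** The sum stops at k = K-2, so the integral reaches only 1 - 2/K; bounding [prim] by its value at
    1 times a ninth power costs 9 * 2/K. *)
Lemma Ek_ge k : 2 / pi * (prim 1 * (1 - 18 / k.+2%:R)) <= @Ek R k.
Proof.
apply: (@le_trans _ _ (kap ^+ 2 * \sum_(i < k) k.+2%:R^-1 * tay ((i.+1%:R / k.+2%:R) ^+ 2))); last first.
  by rewrite mulr_sumr; apply: ler_sum => i _; exact: gain_value.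
rewrite kap_sqr ler_wpM2l ?divr_ge0 ?pi_ge0//.
apply: le_trans (prim_sum k (ltn0Sn _)).
have K0 : 0 < k.+2%:R :> R by rewrite ltr0n.
have x01 : 0 <= (k%:R / k.+2%:R : R) <= 1.
  by rewrite divr_ge0//= ler_pdivrMr// mul1r ler_nat ltnW.
apply: le_trans (prim_ge x01); rewrite ler_wpM2l//.
  by rewrite /prim !expr1n; lra.
have xE : k%:R / k.+2%:R = 1 - 2 / k.+2%:R :> R.
  by rewrite -[k.+2]addn2 natrD; field; rewrite -natrD addn2 pnatr_eq0.
have hh : 0 <= (2 / k.+2%:R : R) <= 1.
  by rewrite divr_ge0//= ler_pdivrMr// mul1r ler_nat.
have := bernoulli 8 hh; rewrite !expr1n -xE; move: (_ ^+ 9) => y.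
rewrite (_ : 18 / k.+2%:R = 9%:R * (2 / k.+2%:R * 1)); last by rewrite mulr1 mulrA -natrM.
by move: (2 / _ * 1) => z; lra.
Qed.

Lemma exists_energy : exists k, 721 / 1000 <= @Ek R k.
Proof.
(* With K >= 9000 the endpoint loss is at most 0.002, and 0.634 * 1.141 * 0.998 exceeds 0.721. *)
exists (Num.truncn (9000 : R)); set k := Num.truncn _.
apply: le_trans (Ek_ge k).
have K1 : 9000 <= k.+2%:R :> R.
  by apply: le_trans (ltW (Num.Theory.truncnS_gt _)) _; rewrite ler_nat.
have K0 : 0 < k.+2%:R :> R by rewrite ltr0n.
have h1 : 18 / k.+2%:R <= 2 / 1000 :> R by rewrite ler_pdivrMr//; lra.
have p0 := @pi_gt0 R; have p1 := @pi_le R.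
have h2 : 634 / 1000 <= 2 / pi :> R by rewrite ler_pdivlMr//; lra.
have G : 1141 / 1000 <= prim 1 by rewrite /prim !expr1n; lra.
move: (prim 1) (18 / _) (2 / pi) G h1 h2 => g x y G h1 h2.
have h3 : 1141 / 1000 * (998 / 1000) <= g * (1 - x) by nra.
by move: (g * _) h3 => z h3; nra.
Qed.
End energy_value.

(** * Couplings indexed by pairs i < j, and the passage from square matrices *)

Section pairs.
Context {R : realType}.

Definition upper n : {set 'I_n * 'I_n} := [set p : 'I_n * 'I_n | (p.1 < p.2)%N]%SET.

Definition pairs n : finType := {p | p \in upper n}.

Definition pr1 n (p : pairs n) : 'I_n := (val p).1.
Definition pr2 n (p : pairs n) : 'I_n := (val p).2.

Lemma pr_lt n (p : pairs n) : (pr1 p < pr2 p)%N.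
Proof. by have := valP p; rewrite inE. Qed.

Definition coupling n (a : vec R (pairs n)) (i j : 'I_n) : R := oapp a 0 (insub (i, j)).

Definition mat n (a : vec R (pairs n)) (i j : nat) : R :=
  if insub i is Some i' then if insub j is Some j' then coupling a i' j' else 0 else 0.

Lemma mat_pair n (a : vec R (pairs n)) (p : pairs n) : mat a (pr1 p) (pr2 p) = a p.
Proof. by rewrite /mat !valK /coupling /pr1 /pr2 -surjective_pairing valK. Qed.

Lemma sum_upper n (F : 'I_n -> 'I_n -> R) :
  \sum_(i < n) \sum_(j < n | (i < j)%N) F i j = \sum_p F (@pr1 n p) (pr2 p).
Proof.
transitivity (\sum_(p in upper n) F p.1 p.2); last exact: big_sub.
by rewrite pair_big_dep; apply: eq_bigl => p; rewrite inE.
Qed.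

Lemma xvE n (x : {ffun 'I_n -> bool}) (i : 'I_n) : xv R x i = spin R (x i).
Proof. by rewrite /xv valK. Qed.

Lemma HamE n (a : vec R (pairs n)) (x : {ffun 'I_n -> bool}) :
  Ham (mat a) x = \sum_p a p * spin R (x (pr1 p)) * spin R (x (pr2 p)).
Proof.
rewrite /Ham (sum_upper (fun i j : 'I_n => mat a i j * xv R x i * xv R x j)).
by apply: eq_bigr => p _; rewrite mat_pair !xvE.
Qed.

Lemma finmin_le (T : finType) t0 (F : T -> R) t : finmin t0 F <= F t.
Proof. exact: bigmin_le. Qed.

Lemma finmin_ge (T : finType) t0 (F : T -> R) c : (forall t, c <= F t) -> c <= finmin t0 F.
Proof. by move=> h; exact: le_bigmin. Qed.

Lemma measurable_finmin d (W : measurableType d) (T : finType) t0 (F : W -> T -> R) :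
  (forall t, measurable_fun setT (fun w => F w t)) ->
  measurable_fun setT (fun w => finmin t0 (F w)).
Proof.
move=> mF; rewrite /finmin; elim: (index_enum T) => [|t s IH].
  rewrite (_ : (fun w => _) = (fun w => F w t0)); first exact: mF.
  by apply/funext => w; rewrite big_nil.
rewrite (_ : (fun w => _) = (fun w => Num.min (F w t) (\big[Num.min/F w t0]_(t <- s) F w t))).
  exact: measurable_minr.
by apply/funext => w; rewrite big_cons.
Qed.

Lemma measurable_coupling n (i j : 'I_n) :
  measurable_fun setT (fun a : vec R (pairs n) => coupling a i j).
Proof. by rewrite /coupling; case: insub => [p|] /=; [exact: measurable_coord|exact: measurable_cst]. Qed.

Lemma measurable_mat n i j : measurable_fun setT (fun a : vec R (pairs n) => mat a i j).
Proof.
rewrite /mat; case: insub => [i'|]; last exact: measurable_cst.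
by case: insub => [j'|]; [exact: measurable_coupling|exact: measurable_cst].
Qed.

Lemma measurable_Emin n : measurable_fun setT (fun a : vec R (pairs n) => Emin n (mat a)).
Proof.
apply: measurable_finmin => x; apply: measurable_sum => i.
rewrite (_ : (fun a => _) = (fun a : vec R (pairs n) =>
  \sum_(j < n) if (i < j)%N then mat a i j * xv R x i * xv R x j else 0)).
  apply: measurable_sum => j; case: (i < j)%N; last exact: measurable_cst.
  by apply: measurable_funM => //; apply: measurable_funM => //; exact: measurable_mat.
by apply/funext => a; rewrite big_mkcond.
Qed.

Definition fold n (G : vec R ('I_n * 'I_n)%type) : vec R (pairs n) :=
  fun p => rsq2 * (G (pr1 p, pr2 p) + G (pr2 p, pr1 p)).

Lemma law_fold n : law (gam R ('I_n * 'I_n)%type) (@fold n) (gam R (pairs n)).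
Proof.
pose U (q : 'I_n * 'I_n) (p : pairs n) : R :=
  rsq2 * ((q == (pr1 p, pr2 p))%:R + (q == (pr2 p, pr1 p))%:R).
have sumU (p : pairs n) (F : 'I_n * 'I_n -> R) :
    \sum_q U q p * F q = rsq2 * (F (pr1 p, pr2 p) + F (pr2 p, pr1 p)).
  under eq_bigr do rewrite /U -mulrA mulrDl.
  rewrite -mulr_sumr big_split/=; congr (_ * (_ + _)).
    rewrite (bigD1 (pr1 p, pr2 p))//= eqxx mul1r big1 ?addr0// => q /negbTE ->.
    by rewrite mul0r.
  rewrite (bigD1 (pr2 p, pr1 p))//= eqxx mul1r big1 ?addr0// => q /negbTE ->.
  by rewrite mul0r.
have iso p p' : \sum_q U q p * U q p' = (p == p')%:R.
  rewrite sumU /U !xpair_eqE.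
  have pp' : (pr1 p == pr1 p') && (pr2 p == pr2 p') = (p == p').
    by rewrite -val_eqE [RHS]xpair_eqE.
  have pn : (pr1 p == pr2 p') && (pr2 p == pr1 p') = false.
    apply/negbTE/negP => /andP[/eqP e1 /eqP e2]; have := pr_lt p; have := pr_lt p'.
    by rewrite -e1 -e2 ltnNge => /negP h /ltnW.
  rewrite pp' pn andbC pn andbC pp' addr0 add0r -mulr2n -mulrnAr -mulr_natl.
  rewrite (_ : rsq2 * (rsq2 * (2 * (p == p')%:R)) = (rsq2 * rsq2) * 2 * (p == p')%:R); last by ring.
  by rewrite rsq2_sqr mulVf// mul1r.
have := law_proj iso; congr law; apply/funext => G; apply/funext => p.
by rewrite /proj sumU.
Qed.

(** Spins square to one, so the diagonal contributes a trace term that is the same for every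
    configuration. *)
Lemma quad_fold n (G : vec R ('I_n * 'I_n)%type) (x : {ffun 'I_n -> bool}) :
  quad G (fun i => spin R (x i)) = Ham (mat (fold G)) x + \sum_i rsq2 * G (i, i).
Proof.
have s2 b : spin R b * spin R b = 1 by case: b; rewrite /spin ?mulrNN mulr1.
rewrite /quad /bil.
have -> : \sum_p G p * spin R (x p.1) * spin R (x p.2) =
   \sum_(i < n) \sum_(j < n) G (i, j) * spin R (x i) * spin R (x j).
  by rewrite pair_big/=; apply: eq_bigr => -[i j].
pose F (i j : 'I_n) := G (i, j) * spin R (x i) * spin R (x j).
have -> : \sum_(i < n) \sum_(j < n) F i j =
    \sum_(i < n) \sum_(j < n | (i < j)%N) (F i j + F j i) + \sum_i F i i.
  rewrite (eq_bigr (fun i : 'I_n => \sum_(j < n | (i < j)%N) F i j + (\sum_(j < n | (j < i)%N) F i j + F i i))).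
    rewrite big_split/= [X in _ + X]big_split/= addrA; congr (_ + _).
    rewrite [RHS](eq_bigr (fun i : 'I_n => \sum_(j < n | (i < j)%N) F i j + \sum_(j < n | (i < j)%N) F j i)).
      by rewrite big_split/=; congr (_ + _); rewrite (exchange_big_dep predT).
    by move=> i _; rewrite big_split.
  move=> i _; rewrite (bigID (fun j : 'I_n => (i < j)%N))/=; congr (_ + _).
  rewrite addrC (bigD1 i) ?ltnn//=; congr (_ + _); apply: eq_bigl => j.
  by rewrite -leqNgt ltn_neqAle andbC.
rewrite (sum_upper (fun i j => F i j + F j i)) HamE mulrDr; congr (_ + _).
  by rewrite mulr_sumr; apply: eq_bigr => p _; rewrite /F /fold; ring.
by rewrite mulr_sumr; apply: eq_bigr => i _; rewrite /F -mulrA s2 mulr1.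
Qed.
End pairs.

(** * Upper bound on the ground state energy *)

Section Emin_whp.
Context {R : realType}.

Lemma trace_tail n (c : R) : 0 < c -> (0 < n)%N ->
  let C := [set G : vec R ('I_n * 'I_n)%type |
    (c * Num.sqrt n%:R ^+ 3) ^+ 2 <= (\sum_i rsq2 * G (i, i)) ^+ 2] in
  measurable C /\ (gam R ('I_n * 'I_n)%type C <= (c ^- 2 / n%:R)%:E)%E.
Proof.
move=> c0 n0 C; have n0' : 0 < n%:R :> R by rewrite ltr0n.
have S0 : 0 < Num.sqrt n%:R :> R by rewrite sqrtr_gt0.
have S2 : Num.sqrt n%:R ^+ 2 = n%:R :> R by rewrite sqr_sqrtr// ltW.
have mT : measurable_fun setT (fun G : vec R ('I_n * 'I_n)%type => (\sum_i rsq2 * G (i, i)) ^+ 2).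
  apply: measurable_funX; apply: measurable_sum => i; apply: measurable_funM => //.
  exact: measurable_coord.
split; first by rewrite -[C]setTI; exact: measurable_fun_le.
pose w (q : 'I_n * 'I_n) : R := if q.1 == q.2 then rsq2 else 0.
have sw (F : 'I_n * 'I_n -> R) : \sum_q (if q.1 == q.2 then F q else 0) = \sum_i F (i, i).
  transitivity (\sum_i \sum_j if i == j then F (i, j) else 0).
    by rewrite pair_big/=; apply: eq_bigr => -[i j].
  by apply: eq_bigr => i _; rewrite (bigD1 i)//= eqxx big1 ?addr0// => j; rewrite eq_sym => /negbTE ->.
have [m [mm mS]] := mean_linear_sq w.
have m1 : m <= n%:R.
  apply: le_trans mS _; rewrite (eq_bigr (fun q : 'I_n * 'I_n => if q.1 == q.2 then 1 / 2 else 0)).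
    by rewrite (sw (fun=> 1 / 2)) sumr_const card_ord -mulr_natl; move: n0'; lra.
  move=> q _; rewrite /w; case: eqP => _; last by rewrite expr0n.
  by rewrite expr2 rsq2_sqr; lra.
have wE G : \sum_i w i * G i = \sum_i rsq2 * G (i, i).
  by rewrite -(sw (fun q => rsq2 * G q)); apply: eq_bigr => q _; rewrite /w; case: eqP; rewrite ?mul0r.
have e0 : 0 < (c * Num.sqrt n%:R ^+ 3) ^+ 2 by rewrite exprn_gt0// mulr_gt0// exprn_gt0.
have := mean_markov mm (fun=> sqr_ge0 _) e0.
have -> : [set x : vec R ('I_n * 'I_n)%type | (c * Num.sqrt n%:R ^+ 3) ^+ 2 <= (\sum_i w i * x i) ^+ 2] = C.
  by apply/seteqP; split=> G; rewrite /C /= wE.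
move/le_trans; apply; rewrite lee_fin ler_pdivrMr//.
apply: le_trans m1 _.
have -> : c ^- 2 / n%:R * (c * Num.sqrt n%:R ^+ 3) ^+ 2 = (Num.sqrt n%:R ^+ 2) ^+ 3 / n%:R.
  by field; rewrite !gt_eqF.
rewrite S2 exprSr mulfK ?gt_eqF// expr2 ler_peMl ?ler1n//; exact: ltW.
Qed.

Lemma Emin_whp (t : R) : 0 < t -> exists N, forall n, (N <= n)%N ->
  (gam R (pairs n) [set a | - (72 / 100) * Num.sqrt n%:R ^+ 3 < Emin n (mat a)]%R <= t%:E)%E.
Proof.
move=> t0; have [k hE] := @exists_energy R.
have t20 : 0 < t / 2 by rewrite divr_gt0.
(* The constant 0.721 is lowered by c for the energy estimate and by c for the trace term, leaving
   0.72. *)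
have [c [c0 cE]] : exists c : R, 0 < c /\ c = 1 / 2000 by exists (1 / 2000); split; [lra|reflexivity].
have [N1 H1] := @energy_whp R k c (t / 2) c0 t20.
pose x := c ^- 2 / (t / 2).
exists (maxn N1 (Num.truncn x).+1) => n; rewrite geq_max => /andP[n1 nx].
have n0 : (0 < n)%N by exact: leq_trans nx.
have n0' : 0 < n%:R :> R by rewrite ltr0n.
have [A [mA PA HA]] := H1 n n1 n0.
have [mC PC] := trace_tail c0 n0; set C := [set G | _] in mC PC.
set E := [set a | _].
have mE : measurable E.
  rewrite (_ : E = ~` [set a | Emin n (mat a) <= - (72 / 100) * Num.sqrt n%:R ^+ 3]); last first.
    by apply/seteqP; split=> a; rewrite /E/= ltNge => /negP.
  apply: measurableC; rewrite -[X in measurable X]setTI.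
  by apply: measurable_fun_le => //; exact: measurable_Emin.
have [mX lX] := law_comp (@law_expose R n k k (leqnn k)) (@law_fold R n).
have [mY lY] := @law_expose R n k k (leqnn k).
rewrite -lX//.
have mYC := mY measurableT C mC; rewrite setTI in mYC.
have mXE := mX measurableT E mE; rewrite setTI in mXE.
apply: le_trans (le_measure _ _ _ (_ : _ `<=` A `|` (fun p => expose k p.1 p.2) @^-1` C)) _.
- by rewrite inE.
- by rewrite inE; exact: measurableU.
- move=> p /= Ep; apply: contrapT => /not_orP[/HA hA hC]; move: Ep; rewrite /E/=.
  apply/negP; rewrite -leNgt.
  (* A Boolean encoding of the constructed spins; its energy bounds the minimum from above. *)
  pose s : {ffun 'I_n -> bool} := [ffun i => 0 <= \sum_j site i p.1 j].
  apply: le_trans (finmin_le _ _ s) _.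
  have := quad_fold (expose k p.1 p.2) s.
  have -> : (fun i => spin R (s i)) = spins p.1.
    by apply/funext => i; rewrite /s ffunE.
  move=> q; move: hC; rewrite /C /=.
  set S := Num.sqrt n%:R in hA *.
  have S0 : 0 < S ^+ 3 by rewrite exprn_gt0// sqrtr_gt0.
  move: hA; rewrite q; move: (\sum_i _) (Ham _ _) => D h hA /negP; rewrite -ltNge => hD.
  have : `|D| < c * S ^+ 3.
    have cS : 0 <= c * S ^+ 3 by exact: mulr_ge0 (ltW c0) (ltW S0).
    move: hD; move: (S ^+ 3) cS => T cS hD; rewrite ltNge; apply/negP => h1; move: hD; apply/negP.
    rewrite -leNgt -[leRHS]real_normK ?num_real//.
    by rewrite ler_pXn2r ?nnegrE.
  rewrite ltr_norml => /andP[D1 _]; move: hA D1 hE; rewrite cE.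
  by move: (S ^+ 3) S0 (Ek k) => T T0 y; nra.
- apply: le_trans (measureU2 _ mA mYC) _.
  rewrite [t in leRHS]splitr EFinD leeD//.
  apply: (@le_trans _ _ (gam R ('I_n * 'I_n)%type C)).
    by rewrite le_eqVlt; apply/orP; left; apply/eqP; exact: lY.
  apply: le_trans PC _; rewrite lee_fin.
  rewrite ler_pdivrMr// [leRHS]mulrC -ler_pdivrMr// -/x.
  by apply: le_trans (ltW (Num.Theory.truncnS_gt x)) _; rewrite ler_nat.
Qed.
End Emin_whp.

(** * Gaussian tails and the lower tail of the ground state energy *)

Section tails.
Context {R : realType}.

(** The Cameron-Martin formula for the constant function 1, with shift -w. *)
Lemma mgf (I : finType) (w : I -> R) :
  mean (gam R I) (fun g => expR (\sum_i w i * g i)) (expR ((\sum_i w i ^+ 2) / 2)).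
Proof.
have := @gam_shift R I (fun i => - w i) (fun=> 1%E) (measurable_cst _) (fun=> lee01).
under eq_integral do rewrite mul1e.
have -> : (\int[gam R I]_g 1 = 1)%E by have [_ ->] := mean_cst (gam R I) 1.
move=> /mean_ge0 - /(_ (@measurable_cm R I _) (fun g => expR_ge0 _)) h.
have := meanZ (expR ((\sum_i w i ^+ 2) / 2)) h; rewrite mulr1; congr mean; apply/funext => g.
have E : \sum_i (- w i) ^+ 2 = \sum_i w i ^+ 2 by apply: eq_bigr => i _; rewrite sqrrN.
rewrite /cm E -expRD; congr expR; rewrite addrCA subrr addr0 -sumrN.
by apply: eq_bigr => i _; rewrite mulNr opprK.
Qed.

Lemma measurable_linear (I : finType) (w : I -> R) :
  measurable_fun setT (fun g : vec R I => \sum_i w i * g i).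
Proof.
by apply: measurable_sum => i; apply: measurable_funM => //; exact: measurable_coord.
Qed.

Lemma gauss_tail (I : finType) (w : I -> R) (v y : R) : 0 < v -> 0 <= y ->
  \sum_i w i ^+ 2 <= v ->
  (gam R I [set g | \sum_i w i * g i <= - y]%R <= (expR (- (y ^+ 2 / (2 * v))))%:E)%E.
Proof.
move=> v0 y0 wv; pose s := y / v.
have s0 : 0 <= s by rewrite divr_ge0// ltW.
have := mean_markov (mgf (fun i => - s * w i)) (fun g => expR_ge0 _) (expR_gt0 (s * y)).
set A := [set x | _] => PA; set B := [set g | _].
have wE (g : vec R I) : \sum_i - s * w i * g i = - s * \sum_i w i * g i.
  by rewrite mulr_sumr; apply: eq_bigr => i _; rewrite mulrA.
apply: (@le_trans _ _ (gam R I A)).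
  apply: le_measure; rewrite ?inE.
  - by rewrite -[B]setTI; apply: measurable_fun_le => //; exact: measurable_linear.
  - rewrite -[A]setTI; apply: measurable_fun_le => //.
    by apply: measurableT_comp => //; exact: measurable_linear.
  - move=> g; rewrite /A /B /= wE ler_expR => h.
    by rewrite mulNr -mulrN ler_wpM2l// lerNr.
apply: le_trans PA _; rewrite lee_fin -expRB ler_expR.
have -> : \sum_i (- s * w i) ^+ 2 = s ^+ 2 * \sum_i w i ^+ 2.
  by rewrite mulr_sumr; apply: eq_bigr => i _; rewrite exprMn sqrrN.
have -> : - (y ^+ 2 / (2 * v)) = s ^+ 2 * v / 2 - s * y.
  by rewrite /s; field; rewrite gt_eqF.
by rewrite lerB// ler_pM2r// ler_wpM2l// sqr_ge0.
Qed.

Lemma bigU_le d (T : measurableType d) (P : probability T R) (J : Type) (s : seq J)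
    (F : J -> set T) (c : J -> R) :
  (forall j, measurable (F j)) -> (forall j, (P (F j) <= (c j)%:E)%E) ->
  measurable (\big[setU/set0]_(j <- s) F j) /\
  (P (\big[setU/set0]_(j <- s) F j) <= (\sum_(j <- s) c j)%:E)%E.
Proof.
move=> mF Fc; elim: s => [|j s [IHm IH]]; first by rewrite !big_nil measure0.
rewrite !big_cons; split; first exact: measurableU.
by apply: le_trans (measureU2 _ (mF j) IHm) _; rewrite EFinD; exact: (leeD (Fc j) IH).
Qed.

Lemma bigU_in (T : Type) (J : eqType) (s : seq J) (F : J -> set T) x :
  (\big[setU/set0]_(j <- s) F j) x <-> exists2 j, j \in s & F j x.
Proof.
elim: s => [|j s IH]; first by rewrite big_nil; split=> // -[].
rewrite big_cons; split.
  by move=> [Fx|/IH[i si Fi]]; [exists j => //|exists i => //]; rewrite inE ?eqxx ?si ?orbT.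
by move=> [i]; rewrite inE => /predU1P[->|si] Fi; [left|right; apply/IH; exists i].
Qed.

Lemma spin_sqr b : spin R b ^+ 2 = 1.
Proof. by case: b; rewrite /spin ?sqrrN expr1n. Qed.

Lemma sum_pairs1 m : (\sum_(p : pairs m) 1) * 2 <= m%:R ^+ 2 :> R.
Proof.
rewrite -(@sum_upper R m (fun _ _ => 1)) mulr_natr mulr2n.
rewrite [X in _ + X](exchange_big_dep predT)//= -big_split/=.
have -> : m%:R ^+ 2 = \sum_(i < m) \sum_(j < m) 1 :> R.
  by rewrite !sumr_const !card_ord expr2 -[RHS]mulr_natl.
apply: ler_sum => i _; rewrite [leRHS](bigID (fun j : 'I_m => (i < j)%N))/= lerD2l.
rewrite [leLHS]big_mkcond [leRHS]big_mkcond; apply: ler_sum => j _; rewrite -leqNgt.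
by case: ltnP => [/ltnW ->|_] //; case: ifP.
Qed.

(** Union bound over 2^m strings; each energy is a Gaussian linear form whose variance, the number
    of pairs, is at most m^2/2. *)
Lemma Emin_tail m (y : R) : (0 < m)%N -> 0 <= y ->
  (gam R (pairs m) [set a | Emin m (mat a) < - y]%R <=
    (2 ^+ m * expR (- (y ^+ 2 / m%:R ^+ 2)))%:E)%E.
Proof.
move=> m0 y0; have m0' : 0 < m%:R ^+ 2 :> R by rewrite exprn_gt0// ltr0n.
pose F (x : {ffun 'I_m -> bool}) := [set a : vec R (pairs m) | Ham (mat a) x <= - y].
have HE x (a : vec R (pairs m)) : Ham (mat a) x =
    \sum_p (spin R (x (pr1 p)) * spin R (x (pr2 p))) * a p.
  by rewrite HamE; apply: eq_bigr => p _; ring.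
have mF x : measurable (F x).
  rewrite /F -[X in measurable X]setTI; apply: measurable_fun_le => //.
  rewrite (_ : (fun a => _) = (fun a : vec R (pairs m) =>
    \sum_p (spin R (x (pr1 p)) * spin R (x (pr2 p))) * a p)); first exact: measurable_linear.
  by apply/funext => a; exact: HE.
have PF x : (gam R (pairs m) (F x) <= (expR (- (y ^+ 2 / m%:R ^+ 2)))%:E)%E.
  rewrite (_ : F x = [set a | \sum_p (spin R (x (pr1 p)) * spin R (x (pr2 p))) * a p <= - y]); last first.
    by apply/seteqP; split=> a; rewrite /F /= HE.
  apply: le_trans (gauss_tail (v := m%:R ^+ 2 / 2) _ y0 _) _.
  - by rewrite divr_gt0.
  - rewrite (eq_bigr (fun=> 1)) ?ler_pdivlMr//; first exact: sum_pairs1.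
    by move=> p _; rewrite exprMn !spin_sqr mulr1.
  - by rewrite mulrCA divff ?mulr1.
have [mU PU] := bigU_le (index_enum {ffun 'I_m -> bool}) mF PF.
apply: (@le_trans _ _ (gam R (pairs m) (\big[setU/set0]_(x : {ffun 'I_m -> bool}) F x))).
  apply: le_measure; rewrite ?inE//.
  - rewrite (_ : [set a | _] = ~` [set a | - y <= Emin m (mat a)]); last first.
      by apply/seteqP; split=> a /=; rewrite ltNge => /negP.
    apply: measurableC; rewrite -[X in measurable X]setTI.
    by apply: measurable_fun_le => //; exact: measurable_Emin.
  - move=> a /= ha; apply: contrapT => hn; move: ha; apply/negP; rewrite -leNgt.
    apply: finmin_ge => x; rewrite leNgt; apply/negP => /ltW h; apply: hn; apply/bigU_in.
    by exists x => //; rewrite mem_index_enum.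
apply: le_trans PU _; rewrite lee_fin sumr_const card_ffun card_bool card_ord.
by rewrite -[leLHS]mulr_natl natrX.
Qed.
End tails.

(** * Lower bound on all suffix minima simultaneously *)

Section tail_min.
Context {R : realType}.

Lemma expR_ge_sum (x : R) n : 0 <= x -> \sum_(0 <= i < n) x ^+ i / i`!%:R <= expR x.
Proof.
move=> x0; apply: (nondecreasing_cvgn_le (u_ := series (exp_coeff x))).
  by apply: nondecreasing_series => i _ _; exact: exp_coeff_ge0.
exact: is_cvg_series_exp_coeff.
Qed.

(** 25/36 is (5/6)^2: it slightly exceeds ln 2, so the level (5/6) m^(3/2) absorbs the 2^m of the
    union bound. *)
Lemma two_le : 2 <= expR (25 / 36 : R).
Proof.
have x0 : 0 <= 25 / 36 :> R by rewrite divr_ge0.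
apply: le_trans (expR_ge_sum 5 x0); rewrite !big_nat_recr//= big_nil /factorial/=.
by lra.
Qed.

Lemma mk_pair_proof n (i j : 'I_n) (ij : (i < j)%N) : (i, j) \in upper n.
Proof. by rewrite inE. Qed.

Definition mk_pair n (i j : 'I_n) (ij : (i < j)%N) : pairs n := exist _ (i, j) (mk_pair_proof ij).

Lemma mat_lt n (a : vec R (pairs n)) (i j : 'I_n) (ij : (i < j)%N) : mat a i j = a (mk_pair ij).
Proof. by rewrite -[RHS]mat_pair. Qed.

Definition late l n (i : 'I_(n - l)) : 'I_n := Ordinal (etrans (esym (ltn_subRL l i n)) (ltn_ord i)).

Lemma late_lt l n (p : pairs (n - l)) : (late (pr1 p) < late (pr2 p))%N.
Proof. by rewrite /= ltn_add2l pr_lt. Qed.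

Definition late_pair l n (p : pairs (n - l)) : pairs n := mk_pair (late_lt p).

Lemma late_pair_inj l n : injective (@late_pair l n).
Proof.
move=> [[i j] ij] [[i' j'] ij'] /(congr1 val)[] /= /eqP; rewrite eqn_add2l => /eqP ii'.
move=> /eqP; rewrite eqn_add2l => /eqP jj'; apply: val_inj => /=.
by congr (_, _); apply: val_inj.
Qed.

Definition late_vec l n (a : vec R (pairs n)) : vec R (pairs (n - l)) :=
  fun p => a (late_pair p).

Lemma law_late l n : law (gam R (pairs n)) (@late_vec l n) (gam R (pairs (n - l))).
Proof. by apply: law_inj; exact: late_pair_inj. Qed.

Lemma tail_minE l n (a : vec R (pairs n)) :
  tail_min n l (mat a) = Emin (n - l) (mat (@late_vec l n a)).
Proof.
rewrite /tail_min /Emin; congr finmin; apply/funext => z.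
rewrite HamE (@sum_upper R (n - l) (fun i j : 'I__ => mat a (l + i) (l + j) * spin R (z i) * spin R (z j))).
apply: eq_bigr => p _; congr (_ * _ * _).
exact: (mat_lt a (late_lt p)).
Qed.

Lemma measurable_tail_min l n :
  measurable_fun setT (fun a : vec R (pairs n) => tail_min n l (mat a)).
Proof.
rewrite (_ : (fun a => _) = (fun a => Emin (n - l) (mat (@late_vec l n a)))); last first.
  by apply/funext => a; exact: tail_minE.
have [ml _] := @law_late l n; exact: (measurableT_comp (@measurable_Emin R (n - l)) ml).
Qed.

(** The second term is measured in n rather than m, so that short suffixes also fail with
    probability exponentially small in n. *)
Definition tail_level (d : R) n (m : nat) : R :=
  5 / 6 * Num.sqrt m%:R ^+ 3 + d * Num.sqrt n%:R ^+ 3.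

(** Drop the cross term of the square and use n^3/m^2 >= n. *)
Lemma tail_level_exponent (d : R) n m : 0 <= d -> (0 < m <= n)%N ->
  25 / 36 * m%:R + d ^+ 2 * n%:R <= tail_level d n m ^+ 2 / m%:R ^+ 2.
Proof.
move=> d0 /andP[m0 mn].
have m0' : 0 < m%:R :> R by rewrite ltr0n.
have mn' : m%:R <= n%:R :> R by rewrite ler_nat.
have M2 : Num.sqrt m%:R ^+ 2 = m%:R :> R by rewrite sqr_sqrtr// ltW.
have S2 : Num.sqrt n%:R ^+ 2 = n%:R :> R by rewrite sqr_sqrtr.
rewrite ler_pdivlMr ?exprn_gt0// /tail_level.
move: (sqrtr_ge0 (m%:R : R)) (sqrtr_ge0 (n%:R : R)) M2 S2.
move: (Num.sqrt m%:R) (Num.sqrt n%:R) => u v u0 v0 M2 S2.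
have uv : u <= v.
  by rewrite -(@ler_pXn2r _ 2) ?nnegrE// M2 S2.
rewrite -M2 -S2.
have h1 : 0 <= 2 * (5 / 6 * u ^+ 3) * (d * v ^+ 3).
  by rewrite mulr_ge0 ?mulr_ge0 ?exprn_ge0//; lra.
have h2 : d ^+ 2 * v ^+ 2 * (u ^+ 4) <= d ^+ 2 * v ^+ 2 * v ^+ 4.
  by rewrite ler_wpM2l ?mulr_ge0 ?sqr_ge0// ler_pXn2r ?nnegrE.
by move: h1 h2; rewrite -!exprM; lra.
Qed.

Lemma tail_whp (d t : R) : 0 < d -> 0 < t -> exists N, forall n, (N <= n)%N ->
  exists A : set (vec R (pairs n)), [/\ measurable A, (gam R (pairs n) A <= t%:E)%E &
    forall a, ~ A a -> forall l, (l <= n)%N -> - tail_level d n (n - l) <= tail_min n l (mat a)].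
Proof.
move=> d0 t0.
(* Since exp(d^2 n) >= (d^2 n)^2/2, the union over n suffixes has probability at most 2/(d^4 n),
   which is at most t once n >= x. *)
pose x := 2 / (d ^+ 4 * t).
exists (Num.truncn x).+1 => n nx.
have n0 : (0 < n)%N by exact: leq_trans nx.
have n0' : 0 < n%:R :> R by rewrite ltr0n.
pose F (l : 'I_n) := [set a : vec R (pairs n) | tail_min n l (mat a) < - tail_level d n (n - l)].
have mF l : measurable (F l).
  rewrite (_ : F l = ~` [set a | - tail_level d n (n - l) <= tail_min n l (mat a)]); last first.
    by apply/seteqP; split=> a; rewrite /F/= ltNge => /negP.
  apply: measurableC; rewrite -[X in measurable X]setTI.
  by apply: measurable_fun_le => //; exact: measurable_tail_min.
have lev0 m : 0 <= tail_level d n m.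
  by rewrite addr_ge0// mulr_ge0 ?exprn_ge0 ?sqrtr_ge0 ?(ltW d0)//; lra.
have PF l : (gam R (pairs n) (F l) <= (expR (- (d ^+ 2 * n%:R)))%:E)%E.
  have m0 : (0 < n - l)%N by rewrite subn_gt0.
  have [ml ll] := @law_late l n.
  have mE : measurable [set b : vec R (pairs (n - l)) | Emin (n - l) (mat b) < - tail_level d n (n - l)].
    rewrite (_ : [set b | _] = ~` [set b | - tail_level d n (n - l) <= Emin (n - l) (mat b)]); last first.
      by apply/seteqP; split=> b; rewrite /= ltNge => /negP.
    apply: measurableC; rewrite -[X in measurable X]setTI.
    by apply: measurable_fun_le => //; exact: measurable_Emin.
  have FE : F l = @late_vec l n @^-1`
      [set b : vec R (pairs (n - l)) | Emin (n - l) (mat b) < - tail_level d n (n - l)].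
    by apply/seteqP; split=> a; rewrite /F/= tail_minE.
  rewrite FE ll//; apply: le_trans (Emin_tail m0 (lev0 _)) _; rewrite lee_fin.
  apply: (@le_trans _ _ (expR (25 / 36) ^+ (n - l) * expR (- (tail_level d n (n - l) ^+ 2 / (n - l)%:R ^+ 2)))).
    by rewrite ler_wpM2r ?expR_ge0// ler_pXn2r ?nnegrE ?expR_ge0// two_le.
  rewrite -expRM_natr -expRD ler_expR.
  have := @tail_level_exponent d n (n - l) (ltW d0); rewrite m0 leq_subr => /(_ isT).
  by lra.
have [mU PU] := bigU_le (index_enum 'I_n) mF PF.
exists (\big[setU/set0]_(l : 'I_n) F l); split=> //.
  apply: le_trans PU _; rewrite lee_fin sumr_const card_ord -[leLHS]mulr_natl.
  rewrite expRN ler_pdivrMr ?expR_gt0//.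
  have := @expR_ge1Dxn R (d ^+ 2 * n%:R) 1; rewrite mulr_ge0 ?sqr_ge0// => /(_ isT) h.
  have {}h : (d ^+ 2 * n%:R) ^+ 2 / 2 <= expR (d ^+ 2 * n%:R) by move: h; rewrite /factorial/=; lra.
  apply: (@le_trans _ _ (t * ((d ^+ 2 * n%:R) ^+ 2 / 2))); last by rewrite ler_pM2l.
  have xn : x <= n%:R.
    by apply: le_trans (ltW (Num.Theory.truncnS_gt x)) _; rewrite ler_nat.
  move: xn; rewrite /x ler_pdivrMr; last by rewrite mulr_gt0// exprn_gt0.
  move=> xn; have := ler_wpM2l (ltW n0') xn.
  by rewrite exprMn -exprM; move: (n%:R : R) => z; lra.
(* At l = n the suffix is empty and its minimum is 0, so the union bound runs over l < n. *)
move=> a aA l; rewrite leq_eqVlt => /predU1P[->|ln].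
  rewrite /tail_min finmin_ge// => z; rewrite big1 ?oppr_le0// => i _.
  by have := leq_ltn_trans (leq0n i) (ltn_ord i); rewrite {1}subnn.
rewrite leNgt; apply/negP => h; apply: aA; apply/bigU_in.
by exists (Ordinal ln) => //; rewrite mem_index_enum.
Qed.
End tail_min.

(** * Exponential moment of the absolute value of a normal variable *)

Section abs_exp.
Context {R : realType}.
Local Notation mu := (@lebesgue_measure R).

(** The interval has length 2s and the density is at most 1/sqrt(2 pi), which is below 201/500
    because pi >= 3.1. *)
Lemma N01_interval (s : R) : 0 <= s ->
  (N01 R [set t : measurableTypeR R | (- s <= t) && (t < s)]%R <= (201 / 250 * s)%:E)%E.
Proof.
move=> s0; set A := [set t | _].
have mA : measurable A.
  rewrite (_ : A = `[(- s), s[%classic); first exact: measurable_itv.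
  by apply/seteqP; split=> t; rewrite /A/= in_itv.
have p0 := @pi_gt0 R; have p1 := @pi_ge R.
pose c : R := (Num.sqrt (2 * pi))^-1.
have c0 : 0 <= c by rewrite invr_ge0 sqrtr_ge0.
have c2 : c ^+ 2 * (2 * pi) = 1.
  rewrite exprVn sqr_sqrtr ?mulr_ge0 ?(ltW p0)// mulVf// gt_eqF// mulr_gt0//.
have c1 : c <= 201 / 500.
  move: c c0 c2 => c c0 c2; move: (pi : R) p1 c2 => p p1 c2.
  have h : c ^+ 2 * (62 / 10) <= 1 by rewrite -[leRHS]c2 ler_wpM2l ?sqr_ge0//; lra.
  by rewrite leNgt; apply/negP => hc; nra.
have := integral_indic (N01 R) measurableT mA; rewrite setIT => <-.
rewrite ge0_integral_N01; last 2 first.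
- by apply/measurable_EFinP; exact: measurable_indic.
- by move=> x; rewrite lee_fin.
apply: (@le_trans _ _ (\int[mu]_x ((\1_A x)%:E * c%:E))%E).
  apply: ge0_le_integral => //.
  - by move=> x _; rewrite mule_ge0// lee_fin phi_ge0.
  - apply: emeasurable_funM; first by apply/measurable_EFinP; exact: measurable_indic.
    by apply/measurable_EFinP; exact: measurable_phi.
  - apply: emeasurable_funM; first by apply/measurable_EFinP; exact: measurable_indic.
    exact: measurable_cst.
  - move=> x _; rewrite lee_pmul// ?lee_fin ?phi_ge0// phiE -/c ler_piMr//.
    by rewrite -expR0 ler_expR oppr_le0 divr_ge0// sqr_ge0.
rewrite ge0_integralZr//; last by apply/measurable_EFinP; exact: measurable_indic.
have -> : (\int[mu]_x (\1_A x)%:E)%E = (2 * s)%:E.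
  transitivity (mu A); first by have := integral_indic mu measurableT mA; rewrite setIT.
  rewrite (_ : A = `[(- s), s[%classic); last first.
    by apply/seteqP; split=> t; rewrite /A/= in_itv.
  rewrite lebesgue_measure_itv/= lte_fin; case: ltP => [_|h].
    by rewrite -EFinB; congr EFin; ring.
  by congr EFin; lra.
rewrite -EFinM lee_fin; nra.
Qed.

(** Shifting each half-line integral by s or -s gives exp(s^2/2) times P(t >= -s) + P(t < s), that
    is 1 + P(-s <= t < s). *)
Lemma mean_abs_exp (s : R) : 0 <= s -> exists c,
  mean (N01 R) (fun t => expR (s * `|t|)) c /\ 0 <= c <= expR (s ^+ 2 / 2) * (1 + 201 / 250 * s).
Proof.
move=> s0.
pose f1 (t : measurableTypeR R) : R := if 0 <= t then expR (s * t) else 0.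
pose f2 (t : measurableTypeR R) : R := if t < 0 then expR (- s * t) else 0.
have mexp (c : R) : measurable_fun setT (fun t : measurableTypeR R => expR (c * t)).
  by apply: measurableT_comp => //; exact: measurable_funM.
have mf1 : measurable_fun setT f1.
  apply: measurable_fun_ifT => //; exact: measurable_fun_ler.
have mf2 : measurable_fun setT f2.
  apply: measurable_fun_ifT => //; exact: measurable_fun_ltr.
have f10 t : 0 <= f1 t by rewrite /f1; case: ifP => // _; exact: expR_ge0.
have f20 t : 0 <= f2 t by rewrite /f2; case: ifP => // _; exact: expR_ge0.
pose A1 := [set t : measurableTypeR R | - s <= t]; pose A2 := [set t : measurableTypeR R | t < s].
have mA1 : measurable A1.
  rewrite (_ : A1 = `[(- s), +oo[%classic); first exact: measurable_itv.
  by apply/seteqP; split=> t; rewrite /A1/= in_itv/= andbT.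
have mA2 : measurable A2.
  rewrite (_ : A2 = `]-oo, s[%classic); first exact: measurable_itv.
  by apply/seteqP; split=> t; rewrite /A2/= in_itv.
have I1 : (\int[N01 R]_t (f1 t)%:E = (expR (s ^+ 2 / 2))%:E * N01 R A1)%E.
  rewrite -(@N01_shift _ s (fun t => (f1 t)%:E)); last 2 first.
  - exact/measurable_EFinP.
  - by move=> t; rewrite lee_fin.
  have := integral_indic (N01 R) measurableT mA1; rewrite setIT => <-.
  rewrite -ge0_integralZl//; last by apply/measurable_EFinP; exact: measurable_indic.
  apply: eq_integral => t _; rewrite -!EFinM; congr EFin.
  rewrite /f1 indicE; have -> : (t \in A1) = (0 <= t + s) by rewrite -lerBlDr sub0r; apply/idP/idP; rewrite inE.
  by case: ifP => _; rewrite ?mulr1 ?mul0r ?mulr0// -expRD; congr expR; field.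
have I2 : (\int[N01 R]_t (f2 t)%:E = (expR (s ^+ 2 / 2))%:E * N01 R A2)%E.
  rewrite -(@N01_shift _ (- s) (fun t => (f2 t)%:E)); last 2 first.
  - exact/measurable_EFinP.
  - by move=> t; rewrite lee_fin.
  have := integral_indic (N01 R) measurableT mA2; rewrite setIT => <-.
  rewrite -ge0_integralZl//; last by apply/measurable_EFinP; exact: measurable_indic.
  apply: eq_integral => t _; rewrite -!EFinM; congr EFin.
  rewrite /f2 indicE; have -> : (t \in A2) = (t - s < 0) by rewrite subr_lt0; apply/idP/idP; rewrite inE.
  by case: ifP => _; rewrite ?mulr1 ?mul0r ?mulr0// -expRD; congr expR; field.
have AU : (N01 R A1 + N01 R A2 <= (1 + 201 / 250 * s)%:E)%E.
  have key (t : R) : (- s <= t) <-> (~ (t < s) \/ ((- s <= t) && (t < s))).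
    split=> [h|[h|/andP[]//]].
      by case: (ltP t s) => ts; [right; rewrite h|left=> h2].
    have st : s <= t by rewrite leNgt; apply/negP.
    by apply: le_trans st; rewrite -subr_ge0 opprK addr_ge0.
  have -> : A1 = ~` A2 `|` [set t : measurableTypeR R | (- s <= t) && (t < s)].
    by apply/seteqP; split=> t; [exact: (key t).1|exact: (key t).2].
  set B := [set t | _].
  have mB : measurable B.
    rewrite (_ : B = `[(- s), s[%classic); first exact: measurable_itv.
    by apply/seteqP; split=> t; rewrite /B/= in_itv.
  have mA2C : measurable (~` A2) by exact: measurableC.
  apply: (@le_trans _ _ ((N01 R (~` A2) + N01 R B) + N01 R A2)%E).
    by apply: leeD => //; exact: measureU2.
  rewrite addeAC [X in (X + _)%E](_ : _ = 1)%E; first by rewrite EFinD leeD2l// N01_interval.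
  rewrite probability_setC// subeK//.
  exact: fin_num_measure.
have E t : expR (s * `|t|) = f1 t + f2 t.
  rewrite /f1 /f2; have [t0|t0] := leP 0 t.
    by rewrite ger0_norm// addr0.
  by rewrite ltr0_norm// add0r mulrN mulNr.
exists (expR (s ^+ 2 / 2) * fine (N01 R A1) + expR (s ^+ 2 / 2) * fine (N01 R A2)).
have fA1 : N01 R A1 = (fine (N01 R A1))%:E by rewrite fineK//; exact: fin_num_measure.
have fA2 : N01 R A2 = (fine (N01 R A2))%:E by rewrite fineK//; exact: fin_num_measure.
split.
  rewrite (_ : (fun t => _) = (fun t => f1 t + f2 t)); last by apply/funext => t; exact: E.
  apply: meanD; apply: mean_ge0 => //.
    by rewrite I1 {1}fA1.
  by rewrite I2 {1}fA2.
rewrite -mulrDr; apply/andP; split.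
  by apply: mulr_ge0; [exact: expR_ge0|apply: addr_ge0; exact: fine_ge0].
by rewrite ler_wpM2l ?expR_ge0// -lee_fin EFinD -fA1 -fA2.
Qed.
End abs_exp.

(** * Exponential moment of the prefix part of a node's bound *)

Section first_moment.
Context {R : realType}.

Definition Vp l n (a : vec R (pairs n)) (x : {ffun 'I_l -> bool}) : R :=
  \sum_(i < l) \sum_(j < l | (i < j)%N) mat a i j * xv R x i * xv R x j
  - \sum_(l <= j < n) `| \sum_(i < l) mat a i j * xv R x i |.

Section early.
Variables (l n : nat) (ln : (l <= n)%N).

Lemma early_lt (p : pairs l) : (widen_ord ln (pr1 p) < widen_ord ln (pr2 p))%N.
Proof. exact: pr_lt. Qed.

Definition early_pair (p : pairs l) : pairs n := mk_pair (early_lt p).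

Lemma cross_lt (q : 'I_l * 'I_(n - l)) : (widen_ord ln q.1 < @late l n q.2)%N.
Proof. by rewrite /= ltn_addr. Qed.

Definition cross_pair (q : 'I_l * 'I_(n - l)) : pairs n := mk_pair (cross_lt q).

(** Couplings inside the prefix and couplings between prefix and suffix sit on disjoint pairs, hence
    are independent. *)
Lemma law_early_cross : law (gam R (pairs n))
  (fun a => ((fun p => a (early_pair p)) : vec R (pairs l),
             (fun q => a (cross_pair q)) : vec R ('I_l * 'I_(n - l))%type))
  (gam R (pairs l) \x gam R ('I_l * 'I_(n - l))%type : probability _ R)%E.
Proof.
apply: law_pairs.
- move=> [[i j] ij] [[i' j'] ij'] /(congr1 val)[] /= ii' jj'.
  by apply: val_inj => /=; congr (_, _); apply: val_inj.
- move=> [i j] [i' j'] /(congr1 val)[] /= ii' /eqP; rewrite eqn_add2l => /eqP jj'.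
  by congr (_, _); apply: val_inj.
- move=> [[i j] ij] [i' j']; apply/eqP => /(congr1 val)[] /= _ jj'.
  by have := ltn_ord j; rewrite jj' ltnNge leq_addr.
Qed.

Lemma VpE (a : vec R (pairs n)) (x : {ffun 'I_l -> bool}) : Vp a x =
  \sum_p a (early_pair p) * (spin R (x (pr1 p)) * spin R (x (pr2 p)))
  - \sum_(j < n - l) `|\sum_(i < l) a (cross_pair (i, j)) * spin R (x i)|.
Proof.
rewrite /Vp (@sum_upper R l (fun i j => mat a i j * xv R x i * xv R x j)); congr (_ - _).
  by apply: eq_bigr => p _; rewrite !xvE mulrA -(mat_lt a (early_lt p)).
rewrite -{1}[l]add0n big_addn big_mkord; apply: eq_bigr => j _; congr (`|_|).
apply: eq_bigr => i _; rewrite xvE addnC; congr (_ * _).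
exact: (mat_lt a (cross_lt (i, j))).
Qed.

Lemma mean_prod_coord (I : finType) (h : measurableTypeR R -> R) c :
  (forall t, 0 <= h t) -> mean (N01 R) h c ->
  mean (gam R I) (fun g => \prod_i h (g i)) (c ^+ #|I|).
Proof.
move=> h0 mh; apply: mean_ge0.
- apply: measurable_prod => i _.
  exact: (measurableT_comp (mean_measurable mh) (measurable_coord i)).
- by move=> g; exact: prodr_ge0.
- rewrite (ge0_integral_prod (f := fun=> h))//; last by move=> _; exact: mean_measurable mh.
  rewrite (eq_bigr (fun=> c%:E)); last by move=> i _; exact: mh.2.
  by rewrite -(big_morph EFin EFinM (erefl 1%E)) prodr_const.
Qed.

(** For fixed x the prefix energy is Gaussian with variance at most l^2/2, giving the first factor.
    The n-l local fields divided by sqrt l are independent standard normals, giving the power, with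
    s = lam sqrt l. *)
Lemma mean_level (lam : R) (x : {ffun 'I_l -> bool}) : (0 < l)%N -> 0 <= lam ->
  exists c, mean (gam R (pairs n)) (fun a => expR (- lam * Vp a x)) c /\
    c <= expR (lam ^+ 2 * l%:R ^+ 2 / 4) *
      (expR ((lam * Num.sqrt l%:R) ^+ 2 / 2) * (1 + 201 / 250 * (lam * Num.sqrt l%:R))) ^+ (n - l).
Proof.
move=> l0 lam0; set s := lam * _.
have l0' : 0 < l%:R :> R by rewrite ltr0n.
have r0 : 0 < Num.sqrt l%:R :> R by rewrite sqrtr_gt0.
have r2 : Num.sqrt l%:R ^+ 2 = l%:R :> R by rewrite sqr_sqrtr// ltW.
have s0 : 0 <= s by rewrite mulr_ge0// ltW.
have [c [mc /andP[c0 cle]]] := mean_abs_exp s0.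
pose w (p : pairs l) : R := - lam * (spin R (x (pr1 p)) * spin R (x (pr2 p))).
(* Column j collects the couplings into suffix spin j, signed by x and normalised; different columns
   have disjoint supports. *)
pose U (q : 'I_l * 'I_(n - l)) (j : 'I_(n - l)) : R :=
  if q.2 == j then spin R (x q.1) / Num.sqrt l%:R else 0.
have sumU (F : 'I_l * 'I_(n - l) -> R) j :
    \sum_q U q j * F q = \sum_i spin R (x i) / Num.sqrt l%:R * F (i, j).
  transitivity (\sum_i \sum_j' U (i, j') j * F (i, j')).
    by rewrite pair_big/=; apply: eq_bigr => -[].
  apply: eq_bigr => i _; rewrite (bigD1 j)//= big1 ?addr0 => [|j' /negbTE jj'].
    by rewrite /U eqxx.
  by rewrite /U /= jj' mul0r.
have iso j j' : \sum_q U q j * U q j' = (j == j')%:R.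
  rewrite sumU /U/=; case: eqP => _; last by rewrite big1// => i _; rewrite mulr0.
  rewrite (eq_bigr (fun=> l%:R^-1)); last first.
    move=> i _; rewrite mulrACA -expr2 spin_sqr mul1r -expr2 exprVn r2.
    by [].
  by rewrite sumr_const card_ord -[LHS]mulr_natl divff// gt_eqF.
have mg := (mean_law _ (law_proj iso) (mean_measurable (@mean_prod_coord 'I_(n - l)
  (fun t => expR (s * `|t|)) c (fun t => expR_ge0 _) mc))).2
  (@mean_prod_coord 'I_(n - l) _ c (fun t => expR_ge0 _) mc).
have mfg := mean_prod (mgf w) mg.
have [mX _] := law_early_cross.
have := (mean_law _ law_early_cross (mean_measurable mfg)).2 mfg.
move=> m; exists (expR ((\sum_i w i ^+ 2) / 2) * c ^+ #|'I_(n - l)|); split.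
  move: m; congr mean; apply/funext => a /=.
  rewrite VpE mulrBr expRD; congr (_ * _).
    by rewrite mulr_sumr; congr expR; apply: eq_bigr => p _; rewrite /w; ring.
  rewrite mulNr opprK mulr_sumr expR_sum; apply: eq_bigr => j _; congr expR.
  rewrite /proj sumU /s -mulrA; congr (_ * _).
  rewrite -(gtr0_norm r0) -normrM; congr (`|_|); rewrite gtr0_norm// mulr_sumr.
  by apply: eq_bigr => i _; field; rewrite gt_eqF.
rewrite card_ord ler_pM ?expR_ge0 ?exprn_ge0//.
  rewrite ler_expR; have := @sum_pairs1 R l.
  have -> : \sum_i w i ^+ 2 = lam ^+ 2 * \sum_(p : pairs l) 1.
    by rewrite mulr_sumr; apply: eq_bigr => p _; rewrite /w exprMn sqrrN exprMn !spin_sqr !mulr1.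
  by have := sqr_ge0 lam; move: (\sum_p 1) (lam ^+ 2) (l%:R ^+ 2) => p q r; nra.
by apply: lerXn2r => //; rewrite nnegrE; exact: le_trans c0 cle.
Qed.
End early.
End first_moment.

(** * The numerical inequality behind the exponent *)

Section numerics.
Context {R : realType}.

(** Exponent per n of the first moment at depth l, with r^2 = 1 - l/n: entropy beyond 0.4505 n,
    minus lam times the level, plus the two Gaussian factors. The fraction over 138/100 bounds
    sqrt(l/n) by its tangent at 0.69. *)
Lemma rate_le (r : R) : 0 <= r -> r ^+ 2 <= 5495 / 10000 ->
  25 / 36 * (1 - r ^+ 2 - 4505 / 10000) - 71 / 100 * (72 / 100 - 5 / 6 * r ^+ 3 - 1 / 2000)
  + (71 / 100) ^+ 2 * (1 - r ^+ 2) ^+ 2 / 4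
  + r ^+ 2 * ((71 / 100) ^+ 2 * (1 - r ^+ 2) / 2 + 1683 / 5000
     + (201 / 250 * (71 / 100 * ((1 - r ^+ 2 + (69 / 100) ^+ 2) / (138 / 100))) - 2 / 5) / (7 / 5))
  <= - (2 / 1000).
Proof.
move=> r0 r2.
(* This square trades the cubic term for terms in r^4 and r^2, so that linear arithmetic can
   finish. *)
have h1 : 0 <= r ^+ 2 * (r - 351 / 500) ^+ 2 by rewrite mulr_ge0 ?sqr_ge0.
have h2 : 0 <= r ^+ 3 by rewrite exprn_ge0.
by lra.
Qed.

(** Tangent line of ln(1+y) at y = 2/5, with 1683/5000 slightly above ln(7/5). *)
Lemma one_add_le (y : R) : 1 + y <= expR (1683 / 5000 + (y - 2 / 5) / (7 / 5)).
Proof.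
have [y1|y1] := ltP (1 + y) 0; first by apply: ltW; apply: lt_trans y1 (expR_gt0 _).
rewrite expRD.
have h : 7 / 5 <= expR (1683 / 5000 : R).
  have x0 : 0 <= 1683 / 5000 :> R by lra.
  apply: le_trans (expR_ge_sum 5 x0); rewrite !big_nat_recr//= big_nil /factorial/=.
  by lra.
have h2 := @expR_ge1Dx R ((y - 2 / 5) / (7 / 5)).
have h3 : 0 <= 1 + (y - 2 / 5) / (7 / 5) by lra.
apply: le_trans (ler_pM _ h3 h h2); last by lra.
by lra.
Qed.

(** Rescaling to [rate_le]: S, u, q stand for sqrt n, sqrt(n-l), sqrt l, and every term scales like
    S^2. *)
Lemma exponent_le (S u q : R) : 0 < S -> 0 <= u -> 0 <= q ->
  q ^+ 2 + u ^+ 2 = S ^+ 2 -> 4505 / 10000 * S ^+ 2 <= q ^+ 2 ->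
  25 / 36 * (q ^+ 2 - 4505 / 10000 * S ^+ 2)
  - 71 / 100 / S * (72 / 100 * S ^+ 3 - (5 / 6 * u ^+ 3 + 1 / 2000 * S ^+ 3))
  + (71 / 100 / S) ^+ 2 * (q ^+ 2) ^+ 2 / 4
  + u ^+ 2 * ((71 / 100 / S * q) ^+ 2 / 2 + (1683 / 5000 + (201 / 250 * (71 / 100 / S * q) - 2 / 5) / (7 / 5)))
  <= - (2 / 1000) * S ^+ 2.
Proof.
move=> S0 u0 q0 quS qS.
pose r := u / S; pose t := q / S.
have r0 : 0 <= r by rewrite divr_ge0// ltW.
have uE : u = r * S by rewrite divfK// gt_eqF.
have qE : q = t * S by rewrite divfK// gt_eqF.
have S20 : 0 < S ^+ 2 by rewrite exprn_gt0.
have tr : t ^+ 2 = 1 - r ^+ 2.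
  apply: (mulIf (lt0r_neq0 S20)); rewrite mulrBl mul1r -!exprMn -uE -qE -quS; ring.
have r2 : r ^+ 2 <= 5495 / 10000.
  have : 4505 / 10000 <= t ^+ 2 by rewrite -(@ler_pM2r _ (S ^+ 2))// -exprMn -qE.
  by rewrite tr; lra.
have tle : t <= (1 - r ^+ 2 + (69 / 100) ^+ 2) / (138 / 100).
  by rewrite -tr; have := sqr_ge0 (t - 69 / 100); lra.
apply: le_trans (ler_wpM2r (ltW S20) (rate_le r0 r2)).
have -> : 71 / 100 / S * q = 71 / 100 * t by rewrite /t; ring.
rewrite [u in leLHS]uE qE; clear uE qE.
have -> : 71 / 100 / S * (72 / 100 * S ^+ 3 - (5 / 6 * (r * S) ^+ 3 + 1 / 2000 * S ^+ 3)) =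
  71 / 100 * (72 / 100 - 5 / 6 * r ^+ 3 - 1 / 2000) * S ^+ 2 by field; rewrite gt_eqF.
have -> : (71 / 100 / S) ^+ 2 * ((t * S) ^+ 2) ^+ 2 / 4 = (71 / 100) ^+ 2 * (t ^+ 2) ^+ 2 / 4 * S ^+ 2.
  by field; rewrite gt_eqF.
have -> : (t * S) ^+ 2 = (1 - r ^+ 2) * S ^+ 2 by rewrite exprMn tr.
have -> : (r * S) ^+ 2 = r ^+ 2 * S ^+ 2 by rewrite exprMn.
have -> : (71 / 100 * t) ^+ 2 = (71 / 100) ^+ 2 * (1 - r ^+ 2) by rewrite -tr; ring.
rewrite tr.
have rS : 0 <= r ^+ 2 * S ^+ 2 by rewrite mulr_ge0 ?sqr_ge0.
have := ler_wpM2l rS tle; move: (_ / (138 / 100)) => w.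
by move: (S ^+ 2) (r ^+ 3) (r ^+ 2) => s r3 rr; lra.
Qed.
End numerics.

(** * Expected number of surviving nodes at a deep level *)

Section tree.
Context {R : realType}.

Lemma decay (c t : R) : 0 < c -> 0 < t -> exists N, forall n, (N <= n)%N ->
  (0 < n)%N /\ n.+1%:R * expR (- (c * n%:R)) <= t.
Proof.
move=> c0 t0; pose x := 4 / (c ^+ 2 * t); exists (Num.truncn x).+1 => n nx.
have n0 : (0 < n)%N by exact: leq_trans nx.
have n0' : 0 < n%:R :> R by rewrite ltr0n.
split=> //; rewrite expRN ler_pdivrMr ?expR_gt0//.
have := @expR_ge1Dxn R (c * n%:R) 1; rewrite mulr_ge0 ?(ltW c0)// => /(_ isT) h.
have {}h : (c * n%:R) ^+ 2 / 2 <= expR (c * n%:R) by move: h; rewrite /factorial/=; lra.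
apply: (@le_trans _ _ (t * ((c * n%:R) ^+ 2 / 2))); last by rewrite ler_pM2l.
have xn : x <= n%:R by apply: le_trans (ltW (Num.Theory.truncnS_gt x)) _; rewrite ler_nat.
move: xn; rewrite /x ler_pdivrMr; last by rewrite mulr_gt0// exprn_gt0.
move=> xn; have := ler_wpM2l (ltW n0') xn.
have n1 : 1 <= n%:R :> R by rewrite ler1n.
by rewrite exprMn -[n.+1%:R]natr1; move: (n%:R : R) n1 => z z1; lra.
Qed.

Lemma ln2_bounds : 1 / 2 <= ln (2 : R) <= 25 / 36.
Proof.
have e0 : 0 < 2 :> R by [].
apply/andP; split; rewrite -ler_expR lnK ?posrE//; last exact: two_le.
have := @expR_ge1Dx R (- (1 / 2)); rewrite expRN => h.
have p := @expR_gt0 R (1 / 2).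
have := ler_wpM2r (ltW p) h; rewrite mulVf ?gt_eqF//.
by move: (expR _) p => z z0; lra.
Qed.

Definition lam n : R := 71 / 100 / Num.sqrt n%:R.

(** If the ground state and suffix bounds hold, every survivor x of depth l satisfies [Vp] <=
    -[tau]; so [Wlev] dominates the number of survivors at that depth. *)
Definition tau n l : R := 72 / 100 * Num.sqrt n%:R ^+ 3 - tail_level (1 / 2000) n (n - l).

Definition Wlev n l (a : vec R (pairs n)) : R :=
  \sum_(x : {ffun 'I_l -> bool}) expR (- lam n * (Vp a x + tau n l)).

Lemma mean_Wlev n l : (0 < l <= n)%N -> 4505 / 10000 * n%:R <= l%:R :> R ->
  exists c, mean (gam R (pairs n)) (@Wlev n l) c /\
    c <= (2 : R) `^ (451 / 1000 * n%:R) * expR (- (2 / 1000 * n%:R)).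
Proof.
move=> /andP[l0 lln] high.
have n0 : (0 < n)%N by exact: leq_trans lln.
have n0' : 0 < n%:R :> R by rewrite ltr0n.
have S0 : 0 < Num.sqrt n%:R :> R by rewrite sqrtr_gt0.
have lam0 : 0 <= lam n by rewrite /lam divr_ge0 ?(ltW S0)//; lra.
pose L : R := expR (lam n ^+ 2 * l%:R ^+ 2 / 4) * (expR ((lam n * Num.sqrt l%:R) ^+ 2 / 2) *
   (1 + 201 / 250 * (lam n * Num.sqrt l%:R))) ^+ (n - l).
have /choice[cx Hcx] : forall x : {ffun 'I_l -> bool}, exists c,
    mean (gam R (pairs n)) (fun a => expR (- lam n * Vp a x)) c /\ c <= L.
  by move=> x; exact: mean_level.
exists (\sum_x expR (- lam n * tau n l) * cx x); split.
  have : mean (gam R (pairs n)) (fun a => \sum_(x : {ffun 'I_l -> bool})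
      expR (- lam n * tau n l) * expR (- lam n * Vp a x)) (\sum_x expR (- lam n * tau n l) * cx x).
    by apply: mean_sum => x _; apply: meanZ; exact: (Hcx x).1.
  congr mean; apply/funext => a; apply: eq_bigr => x _.
  by rewrite -expRD; congr expR; rewrite [RHS]mulrDr [RHS]addrC.
apply: (@le_trans _ _ (2 ^+ l * (expR (- lam n * tau n l) * L))).
  apply: (@le_trans _ _ (\sum_(x : {ffun 'I_l -> bool}) expR (- lam n * tau n l) * L)).
    by apply: ler_sum => x _; rewrite ler_wpM2l ?expR_ge0//; exact: (Hcx x).2.
  by rewrite sumr_const card_ffun card_bool card_ord -[leLHS]mulr_natl natrX.
have /andP[g1 g2] := ln2_bounds.
have E2 : 2 = expR (ln 2) :> R by rewrite lnK// posrE.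
have -> : (2 : R) `^ (451 / 1000 * n%:R) = expR (451 / 1000 * n%:R * ln 2).
  by rewrite /powR gt_eqF.
rewrite [X in X ^+ l]E2 -expRM_natl -[leRHS]expRD.
pose s := lam n * Num.sqrt l%:R.
have LE : L <= expR (lam n ^+ 2 * l%:R ^+ 2 / 4 + (n - l)%:R *
    (s ^+ 2 / 2 + (1683 / 5000 + (201 / 250 * s - 2 / 5) / (7 / 5)))).
  rewrite /L expRD ler_wpM2l ?expR_ge0// expRM_natl.
  have s0 : 0 <= s by rewrite mulr_ge0 ?sqrtr_ge0.
  have p0 : 0 <= 1 + 201 / 250 * s by lra.
  apply: lerXn2r; rewrite ?nnegrE ?expR_ge0 ?mulr_ge0 ?expR_ge0//.
  by rewrite expRD ler_wpM2l ?expR_ge0//; exact: one_add_le.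
apply: le_trans (ler_wpM2l (expR_ge0 _) (ler_wpM2l (expR_ge0 _) LE)) _.
rewrite -!expRD ler_expR /tau /tail_level /s.
have M2 : Num.sqrt (n - l)%:R ^+ 2 = (n - l)%:R :> R by rewrite sqr_sqrtr.
have Q2 : Num.sqrt l%:R ^+ 2 = l%:R :> R by rewrite sqr_sqrtr.
have S2 : Num.sqrt n%:R ^+ 2 = n%:R :> R by rewrite sqr_sqrtr.
have quS : Num.sqrt l%:R ^+ 2 + Num.sqrt (n - l)%:R ^+ 2 = Num.sqrt n%:R ^+ 2 :> R.
  by rewrite M2 Q2 S2 natrB// addrC subrK.
have qS : 4505 / 10000 * Num.sqrt n%:R ^+ 2 <= Num.sqrt l%:R ^+ 2 :> R by rewrite S2 Q2.
have := exponent_le S0 (sqrtr_ge0 _) (sqrtr_ge0 _) quS qS.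
rewrite M2 Q2 S2 /lam.
(* The estimate ln 2 <= 25/36 is spent only on the nonnegative excess of l over 0.4505 n; the
   remaining 0.4505 n ln 2 is compared with the exact 0.451 n ln 2. *)
have : (l%:R - 4505 / 10000 * n%:R) * ln 2 <= (l%:R - 4505 / 10000 * n%:R) * (25 / 36) :> R.
  by apply: ler_wpM2l g2; rewrite subr_ge0; exact: high.
have : 0 <= n%:R * ln 2 :> R by apply: mulr_ge0; [exact: ler0n|exact: le_trans (divr_ge0 ler01 (ler0n _ 2)) g1].
rewrite !mulNr; move: (71 / 100 / Num.sqrt n%:R * (72 / 100 * Num.sqrt n%:R ^+ 3 - _)) => X.
move: ((71 / 100 / Num.sqrt n%:R) ^+ 2 * _ / 4) ((n - l)%:R * _) => Y Z.
by clear; move: (ln 2) (n%:R : R) (l%:R : R) => e z w; lra.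
Qed.
End tree.

(** * Assembling the bound on the tree size *)

Section tree_size.
Context {R : realType}.

Lemma TAE n (a : nat -> nat -> R) : (TA n a)%:R =
  \sum_(l < n.+1) \sum_(x : {ffun 'I_l -> bool}) (if Bound n a x <= Emin n a then 1 else 0) :> R.
Proof.
rewrite /TA natr_sum; apply: eq_bigr => l _.
rewrite -sum1_card natr_sum big_mkcond; apply: eq_bigr => x _.
by congr (if _ then _ else _); apply/idP/idP; rewrite inE.
Qed.

Lemma measurable_Vp n l (x : {ffun 'I_l -> bool}) :
  measurable_fun setT (fun a : vec R (pairs n) => Vp a x).
Proof.
have mm i j : measurable_fun setT (fun a : vec R (pairs n) => mat a i j) by exact: measurable_mat.
apply: measurable_funB.
  apply: measurable_sum => i.
  rewrite (_ : (fun a => _) = (fun a : vec R (pairs n) =>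
    \sum_(j < l) if (i < j)%N then mat a i j * xv R x i * xv R x j else 0)).
    apply: measurable_sum => j; case: (i < j)%N; last exact: measurable_cst.
    by apply: measurable_funM => //; apply: measurable_funM.
  by apply/funext => a; rewrite big_mkcond.
apply: measurable_sum => j; apply: measurableT_comp => //.
by apply: measurable_sum => i; apply: measurable_funM.
Qed.

Lemma measurable_TA n : measurable_fun setT (fun a : vec R (pairs n) => (TA n (mat a))%:R : R).
Proof.
rewrite (_ : (fun a => _) = (fun a : vec R (pairs n) => \sum_(l < n.+1)
    \sum_(x : {ffun 'I_l -> bool}) (if Bound n (mat a) x <= Emin n (mat a) then 1 else 0))).
  apply: measurable_sum => l; apply: measurable_sum => x.
  apply: measurable_fun_ifT => //.
  apply: measurable_fun_ler; last exact: measurable_Emin.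
  by apply: measurable_funD; [exact: measurable_Vp|exact: measurable_tail_min].
by apply/funext => a; exact: TAE.
Qed.

Definition low n l : bool := (l%:R <= 4505 / 10000 * n%:R :> R).

(** At high depth each survivor contributes at least exp 0 = 1 to [Wlev]; at low depth all 2^l nodes
    are counted. *)
Lemma TA_le n (a : vec R (pairs n)) :
  Emin n (mat a) <= - (72 / 100) * Num.sqrt n%:R ^+ 3 ->
  (forall l, (l <= n)%N -> - tail_level (1 / 2000) n (n - l) <= tail_min n l (mat a)) ->
  (TA n (mat a))%:R <= \sum_(l < n.+1) (if low n l then 2 ^+ l else 0)
    + \sum_(l < n.+1) (if low n l then 0 else @Wlev R n l a).
Proof.
move=> hE hT; rewrite TAE -big_split; apply: ler_sum => l _ /=.
case: ifP => hl.
  rewrite addr0; apply: (@le_trans _ _ (\sum_(x : {ffun 'I_l -> bool}) 1)).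
    by apply: ler_sum => x _; case: ifP.
  by rewrite sumr_const card_ffun card_bool card_ord natrX.
rewrite add0r; apply: ler_sum => x _; case: ifP => [hB|_]; last exact: expR_ge0.
rewrite -[leLHS]expR0 ler_expR mulNr -mulrN mulr_ge0//.
  by rewrite /lam divr_ge0 ?sqrtr_ge0//; lra.
have := hT l; rewrite -ltnS ltn_ord => /(_ isT) ht.
have {}hB : Vp a x + tail_min n l (mat a) <= Emin n (mat a) by exact: hB.
by rewrite /tau; move: ht hB hE; move: (tail_level _ _ _) (Num.sqrt _ ^+ 3) => u v; lra.
Qed.

Lemma mean_high n : (0 < n)%N -> exists c,
  mean (gam R (pairs n)) (fun a => \sum_(l < n.+1) (if low n l then 0 else @Wlev R n l a)) c /\
  c <= n.+1%:R * ((2 : R) `^ (451 / 1000 * n%:R) * expR (- (2 / 1000 * n%:R))).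
Proof.
move=> n0; set B := _ `^ _ * _.
have B0 : 0 <= B by rewrite mulr_ge0 ?powR_ge0 ?expR_ge0.
have /choice[c Hc] : forall l : 'I_n.+1, exists c,
    mean (gam R (pairs n)) (fun a => if low n l then 0 else @Wlev R n l a) c /\ c <= B.
  move=> l; case hl : (low n l); first by exists 0; split=> //; exact: mean_cst.
  move/negbT: hl; rewrite /low -ltNge => hl.
  have l0 : (0 < l)%N.
    rewrite lt0n; apply/eqP => l0; move: hl; rewrite l0 ltNge => /negP; apply.
    exact: mulr_ge0 (divr_ge0 (ler0n R _) (ler0n R _)) (ler0n R n).
  by apply: mean_Wlev; [rewrite l0 -ltnS ltn_ord|exact: ltW].
exists (\sum_l c l); split; first by apply: mean_sum => l _; exact: (Hc l).1.
apply: (@le_trans _ _ (\sum_(l < n.+1) B)); first by apply: ler_sum => l _; exact: (Hc l).2.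
by rewrite sumr_const card_ord -[leLHS]mulr_natl.
Qed.

(** The gap between 0.451 and 0.4505 gives 0.0005 n ln 2 >= n/4000, because ln 2 >= 1/2. *)
Lemma low_sum n : \sum_(l < n.+1) (if low n l then 2 ^+ l else 0) <=
  n.+1%:R * ((2 : R) `^ (451 / 1000 * n%:R) * expR (- (1 / 4000 * n%:R))).
Proof.
have /andP[g1 g2] := @ln2_bounds R.
rewrite (_ : n.+1%:R * _ = \sum_(l < n.+1) ((2 : R) `^ (451 / 1000 * n%:R) * expR (- (1 / 4000 * n%:R)))); last first.
  by rewrite sumr_const card_ord -[RHS]mulr_natl.
apply: ler_sum => l _; rewrite /low.
have -> : (2 : R) `^ (451 / 1000 * n%:R) = expR (451 / 1000 * n%:R * ln 2).
  by rewrite /powR gt_eqF.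
case: ifP => [hl|_]; last by rewrite mulr_ge0 ?expR_ge0.
have E2 : 2 = expR (ln 2) :> R by rewrite lnK// posrE.
rewrite [X in X ^+ _]E2 -expRM_natl -expRD ler_expR.
have h1 : l%:R * ln 2 <= 4505 / 10000 * n%:R * ln 2 :> R.
  by apply: ler_wpM2r hl; exact: le_trans (divr_ge0 ler01 (ler0n _ 2)) g1.
have h2 := ler_wpM2l (ler0n R n) g1.
by move: h1 h2; move: (ln 2) (n%:R : R) (l%:R : R) => e z w; clear; lra.
Qed.

Lemma TA_whp : exists N, forall n, (N <= n)%N ->
  (gam R (pairs n) [set a | (2 : R) `^ (451 / 1000 * n%:R) <= (TA n (mat a))%:R]%R
    <= (1 / 100)%:E)%E.
Proof.
(* Budget: t for the ground state, t for the suffixes and 2t for Markov's inequality at half the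
   threshold, in total 4t = 1/100. *)
have [t [t0 tE]] : exists t : R, 0 < t /\ t = 1 / 400 by exists (1 / 400); split; [lra|reflexivity].
have [c [c0 cE]] : exists c : R, 0 < c /\ c = 1 / 4000 by exists (1 / 4000); split; [lra|reflexivity].
have [d [d0 dE]] : exists c : R, 0 < c /\ c = 1 / 2000 by exists (1 / 2000); split; [lra|reflexivity].
have [N1 H1] := Emin_whp t0; have [N2 H2] := tail_whp d0 t0; have [N3 H3] := decay c0 t0.
exists (maxn N1 (maxn N2 N3)) => n; rewrite !geq_max => /andP[n1 /andP[n2 n3]].
have [n0 dec] := H3 n n3; have {}H1 := H1 n n1; have [A [mA PA HA]] := H2 n n2.
have [w [mw wle]] := mean_high n0; have lle := low_sum n.
set th := (2 : R) `^ _ in wle lle *.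
have th0 : 0 < th by exact: powR_gt0.
pose W (a : vec R (pairs n)) : R := \sum_(l < n.+1) (if low n l then 0 else @Wlev R n l a).
rewrite -/W in mw.
have W0 (a : vec R (pairs n)) : 0 <= W a.
  apply: sumr_ge0 => l _; case: ifP => // _; apply: sumr_ge0 => x _; exact: expR_ge0.
have th20 : 0 < th / 2 by rewrite divr_gt0.
have PC := mean_markov mw W0 th20; set C := [set a | _] in PC.
have mC : measurable C.
  rewrite -[C]setTI; apply: measurable_fun_le => //; exact: mean_measurable mw.
set B := [set a | _] in H1.
have mB : measurable B.
  rewrite (_ : B = ~` [set a | Emin n (mat a) <= - (72 / 100) * Num.sqrt n%:R ^+ 3]); last first.
    by apply/seteqP; split=> a; rewrite /B/= ltNge => /negP.
  apply: measurableC; rewrite -[X in measurable X]setTI.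
  by apply: measurable_fun_le => //; exact: measurable_Emin.
set E := [set a | _].
have mE : measurable E.
  by rewrite -[E]setTI; apply: measurable_fun_le => //; exact: measurable_TA.
have mAC := measurableU _ _ mA mC.
have dec2 : n.+1%:R * expR (- (2 / 1000 * n%:R)) <= t.
  apply: le_trans dec; rewrite ler_wpM2l// ler_expR lerN2 cE ler_wpM2r//; lra.
have wle2 : w / (th / 2) <= t + t.
  rewrite ler_pdivrMr//; apply: le_trans wle _; rewrite mulrCA.
  by have := ler_wpM2l (ltW th0) dec2; lra.
apply: (@le_trans _ _ (gam R (pairs n) (B `|` (A `|` C)))).
  apply: le_measure; rewrite ?inE//; first exact: measurableU.
  move=> a; rewrite /E /= => hE; apply: contrapT => /not_orP[hB /not_orP[/HA hA hC]].
  have {}hB : Emin n (mat a) <= - (72 / 100) * Num.sqrt n%:R ^+ 3.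
    by rewrite leNgt; apply/negP.
  rewrite dE in hA; have := TA_le hB hA; rewrite -/(W a).
  have {}hC : W a < th / 2 by rewrite ltNge; apply/negP.
  have : n.+1%:R * (th * expR (- (1 / 4000 * n%:R))) <= th * t.
    by rewrite mulrCA -cE; exact: ler_wpM2l (ltW th0) _ _ dec.
  (* The low levels use less than half of the threshold, so exceeding it forces the high levels
     above the other half. *)
  have : th * t < th / 2 by rewrite ltr_pM2l// tE; lra.
  by move=> h1 h2 h3; have := le_trans hE h3; move: lle h1 h2 hC; lra.
apply: le_trans (measureU2 _ mB mAC) _.
apply: (@le_trans _ _ (t%:E + (t%:E + (t + t)%:E))%E); last first.
  by rewrite -!EFinD lee_fin tE; lra.
apply: leeD; first exact: H1.
apply: le_trans (measureU2 _ mA mC) _; apply: leeD; first exact: PA.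
by apply: le_trans PC _; rewrite lee_fin.
Qed.
End tree_size.

(** * Transfer to an arbitrary probability space *)

Lemma SKmatE (R : realType) (T : Type) n (X : 'I_n -> 'I_n -> T -> R) (w : T) :
  SKmat X w = mat (fun p : pairs n => X (pr1 p) (pr2 p) w).
Proof.
apply/funext => i; apply/funext => j; rewrite /SKmat /mat.
case: insubP => [i' _ <-|//]; case: insubP => [j' _ <-|//].
rewrite /coupling; case: insubP => [p + pE|] /=; rewrite inE/=.
  by move=> ->; rewrite /pr1 /pr2 pE.
by move=> /negbTE ->.
Qed.

Theorem theorem2 (R : realType) :
  exists N : nat, forall n : nat, (N <= n)%N ->
  forall (d : measure_display) (T : measurableType d) (P : probability T R)
         (X : 'I_n -> 'I_n -> {RV P >-> R}),
    (forall i j : 'I_n, (i < j)%N -> forall B : set R, measurable B ->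
        P (X i j @^-1` B) = normal_prob 0 1 B) ->
    mutually_independent P [set p : 'I_n * 'I_n | (p.1 < p.2)%N]
      (fun p w => X p.1 p.2 w) ->
    (P [set w | ((2 : R) `^ (451 / 1000 * n%:R) <=
                  (TA n (SKmat (fun i j => X i j) w))%:R)%R]
       <= (1 / 100 : R)%:E)%E.
Proof.
have [N H] := @TA_whp R; exists N => n Nn d T P X hX indep.
(* The tree size depends only on the entries above the diagonal, whose joint law is fixed by
   independence and the standard normal marginals. *)
have lX : law P (fun w => (fun p => X (pr1 p) (pr2 p) w) : vec R (pairs n)) (gam R (pairs n)).
  apply: law_gam => [i|B mB]; first exact: measurable_funPT.
  (* Independence is stated for families over all index pairs, so the box is extended by the whole
     line off the upper triangle. *)
  pose B' (p : 'I_n * 'I_n) : set R := oapp B setT (insub p : option (pairs n)).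
  have B'E (i : pairs n) : B' (val i) = B i by rewrite /B' valK.
  have mB' p : measurable (B' p) by rewrite /B'; case: insub => //= i.
  transitivity (P (\big[setI/setT]_(p in upper n) ((fun w => X p.1 p.2 w) @^-1` B' p))).
    congr (P _); apply/seteqP; split=> w /=.
      move=> h; apply/bigsetI_all => p pu; rewrite /= -[p]/(val (exist _ p pu : pairs n)) B'E.
      exact: h.
    move=> /bigsetI_all h i; rewrite -B'E; exact: (h (val i) (valP i)).
  rewrite indep//.
  transitivity (\prod_(i : pairs n) P ((fun w => X (pr1 i) (pr2 i) w) @^-1` B' (val i)))%E.
    exact: big_sub.
  by apply: eq_bigr => i _; rewrite B'E hX// pr_lt.
have [mX lE] := lX.
have mE : measurable [set a : vec R (pairs n) |
    (2 : R) `^ (451 / 1000 * n%:R) <= (TA n (mat a))%:R].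
  by rewrite -[X in measurable X]setTI; apply: measurable_fun_le => //; exact: measurable_TA.
apply: le_trans (H n Nn); rewrite -lE// le_eqVlt; apply/orP; left; apply/eqP.
by congr (P _); apply/seteqP; split=> w; rewrite /= (SKmatE (fun i j => X i j)).
Qed.
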